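(* Let $\Lambda$ be a set of exponents, let $U=\{s\in\mathbb{C}:\alpha<\operatorname{Re}s<\beta\}$ with $-\infty\le\alpha<\beta\le\infty$, let $\mathcal{G}$ be an equivalence class in $\mathcal{D}_{\Lambda}$ with respect to $\overset{*}{\sim}$ (consisting of functions almost periodic in $U$), and let $f\in\mathcal{G}$. Then, in the topology of uniform convergence on every reduced strip of $U$, the set of functions $\mathcal{T}_f=\{f_{\tau}(s):=f(s+i\tau):\tau\in\mathbb{R}\}$ is dense in $\mathcal{G}$.
   Context: A set of exponents is a countable set $\Lambda=\{\lambda_1,\lambda_2,\ldots\}$ of distinct real numbers. For an open vertical strip $U=\{s=\sigma+it:\alpha<\sigma<\beta\}$, a reduced strip of $U$ is a set $\{s=\sigma+it:\sigma_1\le\sigma\le\sigma_2\}$ with $\alpha<\sigma_1<\sigma_2<\beta$. $AP(U,\mathbb{C})$ is the space of almost periodic functions in $U$: analytic $f:U\to\mathbb{C}$ such that for every $\varepsilon>0$ and every reduced strip $U_1$ of $U$ there is $l>0$ such that each interval of length $l$ contains a $\tau$ with $|f(s+i\tau)-f(s)|\le\varepsilon$ for all $s\in U_1$. The Dirichlet series of $f\in AP(U,\mathbb{C})$ is the unique series $\sum_{j\ge1}a_je^{\lambda_js}$ (real $\lambda_j$) such that, for every $\sigma\in(\alpha,\beta)$, the Fourier series of the almost periodic function $t\mapsto f(\sigma+it)$ is $\sum_{j\ge1}a_je^{\lambda_j\sigma}e^{i\lambda_jt}$. $\mathcal{D}_{\Lambda}$ is the set of $f\in AP(U,\mathbb{C})$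 whose Dirichlet series has the form $\sum_{j\ge1}a_je^{\lambda_js}$ with $a_j\in\mathbb{C}$, $\lambda_j\in\Lambda$. Equivalence: two functions in $\mathcal{D}_{\Lambda}$ with Dirichlet series $\sum_{j\ge1}a_je^{\lambda_js}$ and $\sum_{j\ge1}b_je^{\lambda_js}$ are equivalent (written $\overset{*}{\sim}$) if for each integer $n$ with $1\le n\le\sharp\Lambda$ there exists a $\mathbb{Q}$-linear map $\psi_n:V_n\to\mathbb{R}$, where $V_n\subset\mathbb{R}$ is the $\mathbb{Q}$-vector space generated by $\{\lambda_1,\ldots,\lambda_n\}$, such that $b_j=a_je^{i\psi_n(\lambda_j)}$ for $j=1,\ldots,n$. *)

(* Defs.v *)
From Stdlib Require Import Reals QArith_base Qreals.
From Coquelicot Require Export Coquelicot.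
Open Scope R_scope.

Definition Cexp (z : C) : C :=
  (RtoC (exp (Re z)) * (cos (Im z), sin (Im z)))%C.

(** A finite or countably infinite set of exponents, with its enumeration:
    [card = Some N] for N exponents, [card = None] for infinitely many. The
    enumeration starts at 0, so that [expo L j] is lambda_(j+1); the values of
    [expo] outside [index] are irrelevant. *)
Record exponents := Exponents {
  card : option nat;
  expo : nat -> R;
  index (j : nat) : Prop := match card with Some N => (j < N)%nat | None => True end;
  expo_inj : forall j k, index j -> index k -> expo j = expo k -> j = k
}.

Definition le_card (L : exponents) (n : nat) : Prop :=
  match card L with Some N => (n <= N)%nat | None => True end.

(** Functions on a strip U are represented by total functions on C, whose values
    outside U are irrelevant in every definition below. *)
Definition strip (alpha beta : Rbar) (s : C) : Prop :=
  Rbar_lt alpha (Re s) /\ Rbar_lt (Re s) beta.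

Definition reduced_bounds (alpha beta : Rbar) (s1 s2 : R) : Prop :=
  Rbar_lt alpha s1 /\ s1 < s2 /\ Rbar_lt s2 beta.

Definition closed_strip (s1 s2 : R) (s : C) : Prop := s1 <= Re s <= s2.

Definition vshift (tau : R) (s : C) : C := (s + Ci * RtoC tau)%C.

Definition AP (alpha beta : Rbar) (f : C -> C) : Prop :=
  (forall s, strip alpha beta s ->
     ex_derive (K := C_AbsRing) (V := C_NormedModule) f s) /\
  (forall (eps s1 s2 : R), 0 < eps -> reduced_bounds alpha beta s1 s2 ->
     exists l : R, 0 < l /\
       forall x : R, exists tau : R, x <= tau <= x + l /\
         forall s, closed_strip s1 s2 s -> Cmod (f (vshift tau s) - f s) <= eps).

(** The mean value  lim_{T -> +oo} 1/(2T) \int_{-T}^{T} F(t) dt. *)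
Definition is_mean_value (F : R -> C) (m : C) : Prop :=
  filterlim
    (fun T : R =>
       (RtoC (/ (2 * T)) * RInt (V := C_R_CompleteNormedModule) F (- T) T)%C)
    (Rbar_locally p_infty) (locally (T := C_UniformSpace) m).

Definition is_fourier_coef (F : R -> C) (mu : R) (c : C) : Prop :=
  is_mean_value (fun t => (F t * Cexp (- (Ci * RtoC (mu * t))))%C) c.

(** The Fourier series of F is  \sum_j c_j e^{i lambda_j t}; since some c_j may
    vanish, the actual frequencies of F are among the lambda_j. *)
Definition fourier_series (L : exponents) (F : R -> C) (c : nat -> C) : Prop :=
  (forall j, index L j -> is_fourier_coef F (expo L j) (c j)) /\
  (forall mu, (forall j, index L j -> expo L j <> mu) ->
     is_fourier_coef F mu (RtoC 0)).

Definition dirichlet_series (L : exponents) (alpha beta : Rbar)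
    (f : C -> C) (a : nat -> C) : Prop :=
  forall sigma : R, Rbar_lt alpha sigma -> Rbar_lt sigma beta ->
    fourier_series L (fun t : R => f (sigma, t))
      (fun j => (a j * RtoC (exp (expo L j * sigma)))%C).

Definition in_D (L : exponents) (alpha beta : Rbar) (f : C -> C) : Prop :=
  AP alpha beta f /\ exists a : nat -> C, dirichlet_series L alpha beta f a.

Inductive Qspan (S : R -> Prop) : R -> Prop :=
| Qspan_zero : Qspan S 0
| Qspan_gen x : S x -> Qspan S x
| Qspan_plus x y : Qspan S x -> Qspan S y -> Qspan S (x + y)
| Qspan_scal (q : Q) x : Qspan S x -> Qspan S (Q2R q * x).

Definition Qlinear_on (V : R -> Prop) (psi : R -> R) : Prop :=
  (forall x y, V x -> V y -> psi (x + y) = psi x + psi y) /\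
  (forall (q : Q) x, V x -> psi (Q2R q * x) = Q2R q * psi x).

Definition Vspace (L : exponents) (n : nat) : R -> Prop :=
  Qspan (fun x => exists j, (j < n)%nat /\ x = expo L j).

Definition coef_equiv (L : exponents) (a b : nat -> C) : Prop :=
  forall n, (1 <= n)%nat -> le_card L n ->
    exists psi : R -> R, Qlinear_on (Vspace L n) psi /\
      forall j, (j < n)%nat ->
        b j = (a j * Cexp (Ci * RtoC (psi (expo L j))))%C.

Definition star_equiv (L : exponents) (alpha beta : Rbar) (f g : C -> C) : Prop :=
  exists a b : nat -> C,
    dirichlet_series L alpha beta f a /\ dirichlet_series L alpha beta g b /\
    coef_equiv L a b.

Definition star_class (L : exponents) (alpha beta : Rbar)
    (G : (C -> C) -> Prop) : Prop :=
  exists f0, in_D L alpha beta f0 /\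
    forall g, G g <-> in_D L alpha beta g /\ star_equiv L alpha beta f0 g.

Definition translates (alpha beta : Rbar) (f : C -> C) (h : C -> C) : Prop :=
  exists tau : R, forall s, strip alpha beta s -> h s = f (vshift tau s).

(** Neighbourhoods of g in the topology of uniform convergence on every reduced
    strip. A single strip suffices in the basis, because finitely many reduced
    strips are contained in a common one. *)
Definition strip_nbhd (alpha beta : Rbar) (g : C -> C)
    (A : (C -> C) -> Prop) : Prop :=
  exists s1 s2 eps : R, reduced_bounds alpha beta s1 s2 /\ 0 < eps /\
    forall h, (forall s, closed_strip s1 s2 s -> Cmod (h s - g s) < eps) -> A h.

Definition strip_dense (alpha beta : Rbar) (T G : (C -> C) -> Prop) : Prop :=
  (forall h, T h -> G h) /\
  (forall g, G g -> forall A, strip_nbhd alpha beta g A -> exists h, A h /\ T h).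

(* Main.v *)
Require Import Defs.
From Stdlib Require Import Reals.
From Coquelicot Require Import Coquelicot.
From Stdlib Require Import Lra Lia List Classical ClassicalEpsilon.

(** Let [a] and [b] be the Dirichlet coefficients of [f] and of another member [g] of the
    class. On the line [Re s = sigma] the functions [f] and [g] have Fourier coefficients of
    equal moduli, those of [g] being those of [f] turned by the phases [psi_n (lambda_j)].
    A translate [f (s + i tau)] has the coefficients of [f] turned by the phases
    [lambda_j tau]. So one wants a [tau] for which [lambda_j tau] is close to
    [psi_n (lambda_j)] modulo [2 pi] for the finitely many [j] that matter, and one wants
    closeness of the coefficients in mean square to imply uniform closeness of the
    functions.

    Existence of [tau] ([kronecker]). Put [W = sum_j w_j], where the weight [w_j] is the
    sum of the squared moduli of the [j]-th coefficients on two lines. The even moments of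
    [|W + sum_j w_j exp (i (lambda_j t - psi (lambda_j)))|] are finite sums over additive
    relations between the [lambda_j], and by additivity of [psi] they coincide with
    those for [psi = 0]. For [psi = 0] the sum is nearly [2 W] at the almost periods of [f],
    hence on a set of positive density. If for the given [psi] the sum stayed away from
    [2 W], its high moments would be too small.

    Closeness in mean square. By Parseval's identity the mean square of [f (s + i tau) - g s]
    on a line is computed from the coefficients; it is small simultaneously on all lines of a
    reduced strip because the squared coefficients are dominated by those on the two
    bounding lines ([coef_approximation]). The mean square of [g (s + i x) - g s] depends
    on the moduli of the coefficients only, so that [f] and [g] have the same
    almost periods ([strip_close_equiv]). The difference [f (s + i tau) - g s]
    then has, with constants uniform over the strip, a relatively dense set of almost
    periods filling intervals; a large value of it would be repeated on a set of
    positive density and contradict the small mean square ([sup_le_of_mean]).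

    Parseval's identity ([parseval]). Subtract from an almost periodic [F] its first [n]
    harmonics. If the mean squares of the remainders [r_n] exceeded some [eps > 0] for all
    [n], the autocorrelation of [r_n] would stay above half of its value at [0] on a
    relatively dense set that depends on [F] and [eps] but not on [n] ([bessel_shift]),
    while the Fourier coefficients of [r_n] tend to [0] uniformly. These two facts are
    incompatible by [autocorr_le_coef]: sample the autocorrelation along an arithmetic
    progression and consider its Fejer sum [S] of length [N], which is the mean square of
    an exponential sum of translates of [r_n]. Orthogonality on a finite grid gives the averages of [S] and [S ^ 2] over the
    circle, and their ratio shows that [S] somewhere reaches a fixed multiple of
    [N ^ 2] times the mean square of [r_n]. On the other hand [S / N ^ 2] is
    asymptotically at most a constant times the largest squared Fourier coefficient,
    uniformly on the circle, because the averages of [r_n (t) exp (- i mu t)] over long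
    intervals converge uniformly in the position of the interval and in bounded [mu]
    ([fourier_average_uniform]). *)

(** * Finite sums *)

Fixpoint rsum (n : nat) (f : nat -> R) : R :=
  match n with O => 0 | S k => rsum k f + f k end.

Fixpoint csum (n : nat) (f : nat -> C) : C :=
  match n with O => RtoC 0 | S k => (csum k f + f k)%C end.

Lemma rsum_ext n f g : (forall k, (k < n)%nat -> f k = g k) -> rsum n f = rsum n g.
Proof.
induction n as [|n IH]; intros H; simpl; auto.
rewrite IH, H; auto.
Qed.

Lemma rsum_plus n f g : rsum n (fun k => f k + g k) = rsum n f + rsum n g.
Proof. induction n as [|n IH]; simpl; [ring|rewrite IH; ring]. Qed.

Lemma rsum_scal n c f : rsum n (fun k => c * f k) = c * rsum n f.
Proof. induction n as [|n IH]; simpl; [ring|rewrite IH; ring]. Qed.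

Lemma rsum_const n c : rsum n (fun _ => c) = INR n * c.
Proof.
induction n as [|n IH]; [simpl; ring|].
rewrite S_INR; simpl; rewrite IH; ring.
Qed.

Lemma rsum_le n f g : (forall k, (k < n)%nat -> f k <= g k) -> rsum n f <= rsum n g.
Proof.
induction n as [|n IH]; intros H; simpl; [lra|].
apply Rplus_le_compat; auto.
Qed.

Lemma rsum_ge0 n f : (forall k, (k < n)%nat -> 0 <= f k) -> 0 <= rsum n f.
Proof.
intros H; rewrite <- (Rmult_0_r (INR n)), <- rsum_const.
apply rsum_le; auto.
Qed.

Lemma rsum_0 n f : (forall k, (k < n)%nat -> f k = 0) -> rsum n f = 0.
Proof. intros H; rewrite (rsum_ext n f (fun _ => 0)), rsum_const; auto; ring. Qed.

Lemma rsum_swap n m (f : nat -> nat -> R) :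
  rsum n (fun j => rsum m (fun k => f j k)) = rsum m (fun k => rsum n (fun j => f j k)).
Proof.
induction n as [|n IH]; simpl.
- symmetry; apply rsum_0; auto.
- rewrite IH, <- rsum_plus; reflexivity.
Qed.

Lemma rsum_add n m f : rsum (n + m) f = rsum n f + rsum m (fun k => f (n + k)%nat).
Proof.
induction m as [|m IH]; simpl; [rewrite Nat.add_0_r; ring|].
rewrite Nat.add_succ_r; simpl; rewrite IH; ring.
Qed.

(** * The plane as a real inner product space *)

Definition dot (z w : C) : R := Re z * Re w + Im z * Im w.
Definition nsq (z : C) : R := dot z z.
Definition cis (x : R) : C := (cos x, sin x).

Ltac cring := unfold nsq, dot, cis, Re, Im, Cminus, Cplus, Cmult, Copp, RtoC, Ci; simpl;
  try (apply injective_projections; simpl); ring.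

Lemma dot_sym z w : dot z w = dot w z.
Proof. cring. Qed.
Lemma dot_plus_l a b w : dot (a + b)%C w = dot a w + dot b w.
Proof. cring. Qed.
Lemma dot_plus_r a b w : dot w (a + b)%C = dot w a + dot w b.
Proof. cring. Qed.
Lemma dot_minus_l a b w : dot (a - b)%C w = dot a w - dot b w.
Proof. cring. Qed.
Lemma dot_minus_r a b w : dot w (a - b)%C = dot w a - dot w b.
Proof. cring. Qed.
Lemma dot_scal_l r z w : dot (RtoC r * z)%C w = r * dot z w.
Proof. cring. Qed.
Lemma dot_scal_r r z w : dot w (RtoC r * z)%C = r * dot w z.
Proof. cring. Qed.
Lemma dot_0_l w : dot (RtoC 0) w = 0.
Proof. cring. Qed.
Lemma dot_csum_l n f w : dot (csum n f) w = rsum n (fun k => dot (f k) w).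
Proof.
induction n as [|n IH]; simpl; [apply dot_0_l|].
rewrite dot_plus_l, IH; reflexivity.
Qed.

Lemma nsq_ge0 z : 0 <= nsq z.
Proof. unfold nsq, dot; nra. Qed.

Lemma nsq_plus z w : nsq (z + w)%C = nsq z + 2 * dot z w + nsq w.
Proof. cring. Qed.

Lemma nsq_minus z w : nsq (z - w)%C = nsq z - 2 * dot z w + nsq w.
Proof. cring. Qed.

Lemma nsq_mult z w : nsq (z * w)%C = nsq z * nsq w.
Proof. cring. Qed.

Lemma cos2_sin2 x : cos x * cos x + sin x * sin x = 1.
Proof. generalize (sin2_cos2 x); unfold Rsqr; lra. Qed.

Lemma nsq_cis x : nsq (cis x) = 1.
Proof. unfold nsq, dot, cis; simpl; apply cos2_sin2. Qed.

Lemma nsq_Cmod z : nsq z = Cmod z * Cmod z.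
Proof.
generalize (Cmod2_alt z); unfold nsq, dot; intros H.
replace (Cmod z * Cmod z) with (Cmod z ^ 2) by ring. rewrite H; ring.
Qed.

Lemma Cmod_le_nsq z r : 0 <= r -> nsq z <= r * r -> Cmod z <= r.
Proof. rewrite nsq_Cmod; intros H1 H2; generalize (Cmod_ge_0 z); nra. Qed.

Lemma nsq_le_Cmod z r : Cmod z <= r -> nsq z <= r * r.
Proof. rewrite nsq_Cmod; intros H; generalize (Cmod_ge_0 z); nra. Qed.

Lemma dot_le z w : Rabs (dot z w) <= Cmod z * Cmod w.
Proof.
generalize (Cmod_ge_0 z) (Cmod_ge_0 w); intros Hz Hw.
assert (H : dot z w * dot z w <= (Cmod z * Cmod w) * (Cmod z * Cmod w)).
{ replace (Cmod z * Cmod w * (Cmod z * Cmod w)) with (nsq z * nsq w)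
    by (rewrite !nsq_Cmod; ring).
  unfold nsq, dot.
  generalize (Rle_0_sqr (Re z * Im w - Im z * Re w)); unfold Rsqr; nra. }
apply Rsqr_le_abs_0 in H; rewrite (Rabs_pos_eq (_ * _)) in H; auto; nra.
Qed.

Lemma dot_bound z w a b : Cmod z <= a -> Cmod w <= b -> Rabs (dot z w) <= a * b.
Proof.
intros Ha Hb; eapply Rle_trans; [apply dot_le|].
apply Rmult_le_compat; auto using Cmod_ge_0.
Qed.

Lemma Cmod_cis x : Cmod (cis x) = 1.
Proof.
generalize (nsq_Cmod (cis x)) (Cmod_ge_0 (cis x)); rewrite nsq_cis; intros; nra.
Qed.

Lemma cis_plus x y : cis (x + y) = (cis x * cis y)%C.
Proof.
unfold cis, Cmult; simpl; rewrite cos_plus, sin_plus.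
apply injective_projections; simpl; ring.
Qed.

Lemma cis_0 : cis 0 = RtoC 1.
Proof. unfold cis, RtoC; now rewrite cos_0, sin_0. Qed.

Lemma dot_rot z w x : dot (z * cis x)%C (w * cis x)%C = dot z w.
Proof.
transitivity (dot z w * (cos x * cos x + sin x * sin x)); [cring|].
rewrite cos2_sin2; ring.
Qed.

Lemma dot_rot_l z w x : dot (z * cis x)%C w = dot z (w * cis (- x))%C.
Proof.
rewrite <- (dot_rot z (w * cis (- x))%C x), <- Cmult_assoc, <- cis_plus.
now rewrite Rplus_opp_l, cis_0, Cmult_1_r.
Qed.

Lemma nsq_rot_sub A x : nsq (A * cis x - A)%C = nsq A * (2 * (1 - cos x)).
Proof.
transitivity (nsq A * (1 + (cos x * cos x + sin x * sin x) - 2 * cos x)); [cring|].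
rewrite cos2_sin2; ring.
Qed.

Lemma dot_rot_self A x : dot A (A * cis x)%C = nsq A * cos x.
Proof. cring. Qed.

(** Take [w = z / |z|]. This reduces bounds on moduli of complex sums and integrals to
    bounds on real ones. *)
Lemma nsq_dual z K : 0 <= K ->
  (forall w, Cmod w <= 1 -> dot z w <= K) -> nsq z <= K * K.
Proof.
intros HK H.
destruct (Req_dec (Cmod z) 0) as [H0|H0].
- rewrite nsq_Cmod, H0; nra.
- generalize (Cmod_ge_0 z); intros Hz.
  assert (Hw : dot z (RtoC (/ Cmod z) * z)%C <= K).
  { apply H. rewrite Cmod_mult, Cmod_R, Rabs_pos_eq.
    - rewrite Rinv_l; lra.
    - apply Rlt_le, Rinv_0_lt_compat; lra. }
  rewrite dot_scal_r in Hw; fold (nsq z) in Hw; rewrite nsq_Cmod in *.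
  replace (/ Cmod z * (Cmod z * Cmod z)) with (Cmod z) in Hw by (field; auto).
  nra.
Qed.

(** * Integrals of continuous functions *)

Definition cont (u : R -> R) : Prop := forall x, continuous u x.
Definition contC (F : R -> C) : Prop :=
  cont (fun t => Re (F t)) /\ cont (fun t => Im (F t)).

Lemma cont_const c : cont (fun _ => c).
Proof. intros x; apply continuous_const. Qed.
Lemma cont_plus u v : cont u -> cont v -> cont (fun t => u t + v t).
Proof. intros H1 H2 x; apply (continuous_plus u v x); auto. Qed.
Lemma cont_minus u v : cont u -> cont v -> cont (fun t => u t - v t).
Proof. intros H1 H2 x; apply (continuous_minus u v x); auto. Qed.
Lemma cont_mult u v : cont u -> cont v -> cont (fun t => u t * v t).
Proof. intros H1 H2 x; apply (continuous_mult u v x); auto. Qed.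
Lemma cont_lin a b : cont (fun t => a * t + b).
Proof.
apply cont_plus; [|apply cont_const].
apply cont_mult; [apply cont_const|intros x; apply continuous_id].
Qed.
Lemma cont_comp u v : cont u -> cont v -> cont (fun t => u (v t)).
Proof. intros H1 H2 x; apply (continuous_comp v u x); auto. Qed.
Lemma cont_ext u v : (forall t, u t = v t) -> cont u -> cont v.
Proof. intros H1 H2 x; apply (continuous_ext u v x); auto. Qed.
Lemma cont_shift u a : cont u -> cont (fun t => u (t + a)).
Proof.
intros H; apply (cont_ext (fun t => u (1 * t + a))).
- intros t; now rewrite Rmult_1_l.
- apply (cont_comp u (fun t => 1 * t + a)); auto using cont_lin.
Qed.
Lemma cont_cos a b : cont (fun t => cos (a * t + b)).
Proof. intros x; apply continuous_cos_comp, cont_lin. Qed.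
Lemma cont_sin a b : cont (fun t => sin (a * t + b)).
Proof. intros x; apply continuous_sin_comp, cont_lin. Qed.
Lemma cont_rsum n (u : nat -> R -> R) :
  (forall k, (k < n)%nat -> cont (u k)) -> cont (fun t => rsum n (fun k => u k t)).
Proof.
induction n as [|n IH]; intros H; simpl; [apply cont_const|].
apply cont_plus; auto.
Qed.

Lemma contC_const c : contC (fun _ => c).
Proof. split; apply cont_const. Qed.
Lemma contC_plus F G : contC F -> contC G -> contC (fun t => (F t + G t)%C).
Proof. intros [H1 H2] [H3 H4]; split; now apply cont_plus. Qed.
Lemma contC_minus F G : contC F -> contC G -> contC (fun t => (F t - G t)%C).
Proof.
intros [H1 H2] [H3 H4]; split.
- now apply cont_minus with (1 := H1).
- now apply cont_minus with (1 := H2).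
Qed.
Lemma contC_mult F G : contC F -> contC G -> contC (fun t => (F t * G t)%C).
Proof.
intros [H1 H2] [H3 H4]; split; simpl.
- now apply (cont_minus (fun t => Re (F t) * Re (G t)) (fun t => Im (F t) * Im (G t)));
    apply cont_mult.
- now apply (cont_plus (fun t => Re (F t) * Im (G t)) (fun t => Im (F t) * Re (G t)));
    apply cont_mult.
Qed.
Lemma contC_shift F a : contC F -> contC (fun t => F (t + a)).
Proof.
intros [H1 H2]; split.
- now apply (cont_shift (fun t => Re (F t))).
- now apply (cont_shift (fun t => Im (F t))).
Qed.
Lemma contC_cis mu : contC (fun t => cis (mu * t)).
Proof.
split; simpl.
- apply (cont_ext (fun t => cos (mu * t + 0))); [intros; f_equal; ring|apply cont_cos].
- apply (cont_ext (fun t => sin (mu * t + 0))); [intros; f_equal; ring|apply cont_sin].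
Qed.
Lemma contC_csum n (F : nat -> R -> C) :
  (forall k, (k < n)%nat -> contC (F k)) -> contC (fun t => csum n (fun k => F k t)).
Proof.
induction n as [|n IH]; intros H; simpl; [apply contC_const|].
apply contC_plus; auto.
Qed.
Lemma cont_dot F G : contC F -> contC G -> cont (fun t => dot (F t) (G t)).
Proof.
intros [H1 H2] [H3 H4]; unfold dot.
apply cont_plus; apply cont_mult; auto.
Qed.
Lemma cont_nsq F : contC F -> cont (fun t => nsq (F t)).
Proof. intros H; now apply cont_dot. Qed.

Lemma cont_ex_RInt u a b : cont u -> ex_RInt u a b.
Proof. intros H; apply (@ex_RInt_continuous R_CompleteNormedModule); auto. Qed.
#[local] Hint Resolve cont_const cont_plus cont_minus cont_mult cont_cos
  cont_sin cont_rsum contC_const contC_plus contC_minus contC_mult contC_cis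
  contC_csum cont_dot cont_nsq cont_ex_RInt : cont.
#[local] Hint Extern 2 (cont (fun t => ?u (t + ?a))) => apply (cont_shift u a) : cont.
#[local] Hint Extern 2 (contC (fun t => ?u (t + ?a))) => apply (contC_shift u a) : cont.

(** Restores the type [R] of an equation between integrals, where unification has put
    the carrier of the canonical normed module. *)
Ltac in_R := match goal with |- @eq _ ?a ?b => change (@eq R a b) end.

Lemma RInt_plus_cont u v a b : cont u -> cont v ->
  RInt (fun t => u t + v t) a b = RInt u a b + RInt v a b.
Proof. intros; apply (@RInt_plus R_CompleteNormedModule); auto with cont. Qed.

Lemma RInt_scal_cont c u a b : cont u ->
  RInt (fun t => c * u t) a b = c * RInt u a b.
Proof. intros; apply (@RInt_scal R_CompleteNormedModule); auto with cont. Qed.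

Lemma RInt_const_R c a b : RInt (fun _ => c) a b = (b - a) * c.
Proof. apply (@RInt_const R_CompleteNormedModule). Qed.

Lemma RInt_Chasles_cont u a b c : cont u ->
  RInt u a b + RInt u b c = RInt u a c.
Proof. intros; apply (@RInt_Chasles R_CompleteNormedModule); auto with cont. Qed.

Lemma RInt_shift u a b z : cont u ->
  RInt (fun t => u (t + z)) a b = RInt u (a + z) (b + z).
Proof.
intros H.
generalize (RInt_comp_lin u 1 z a b); rewrite !Rmult_1_l; intros H1.
rewrite <- H1; auto with cont.
apply RInt_ext; intros x _; unfold scal; simpl; unfold mult; simpl.
now rewrite !Rmult_1_l.
Qed.

Lemma RInt_le_cont u v a b : a <= b -> cont u -> cont v ->
  (forall t, a <= t <= b -> u t <= v t) -> RInt u a b <= RInt v a b.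
Proof. intros; apply RInt_le; auto with cont. intros; apply H2; lra. Qed.

Lemma RInt_upper u a b M : a <= b -> cont u ->
  (forall t, a <= t <= b -> u t <= M) -> RInt u a b <= (b - a) * M.
Proof. intros; rewrite <- RInt_const_R; apply RInt_le_cont; auto with cont. Qed.

Lemma RInt_lower u a b M : a <= b -> cont u ->
  (forall t, a <= t <= b -> M <= u t) -> (b - a) * M <= RInt u a b.
Proof. intros; rewrite <- RInt_const_R; apply RInt_le_cont; auto with cont. Qed.

Lemma RInt_abs_le u a b M : a <= b -> cont u ->
  (forall t, a <= t <= b -> Rabs (u t) <= M) -> Rabs (RInt u a b) <= (b - a) * M.
Proof. intros; apply abs_RInt_le_const; auto with cont. Qed.

(** * Mean values *)

Definition mean (u : R -> R) (m : R) : Prop :=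
  forall eps, 0 < eps -> exists T0, 0 < T0 /\
    forall T, T0 <= T -> Rabs (RInt u (- T) T - 2 * T * m) <= eps * (2 * T).

Lemma mean_ext u v m : (forall t, u t = v t) -> mean u m -> mean v m.
Proof.
intros H Hu eps He; destruct (Hu eps He) as [T0 [H0 H1]].
exists T0; split; auto; intros T HT.
rewrite <- (RInt_ext u v); auto.
Qed.

Lemma mean_plus u v a b : cont u -> cont v -> mean u a -> mean v b ->
  mean (fun t => u t + v t) (a + b).
Proof.
intros Cu Cv Hu Hv eps He.
destruct (Hu (eps / 2)) as [T1 [H1 H1']]; [lra|].
destruct (Hv (eps / 2)) as [T2 [H2 H2']]; [lra|].
exists (T1 + T2); split; [lra|]; intros T HT.
rewrite RInt_plus_cont; auto.
specialize (H1' T ltac:(lra)); specialize (H2' T ltac:(lra)).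
revert H1' H2'; do 3 (unfold Rabs at 1; destruct Rcase_abs); nra.
Qed.

Lemma mean_scal c u a : cont u -> mean u a -> mean (fun t => c * u t) (c * a).
Proof.
intros Cu Hu eps He.
assert (Hc : 0 <= Rabs c) by apply Rabs_pos.
destruct (Hu (eps / (Rabs c + 1))) as [T1 [H1 H1']].
{ apply Rdiv_lt_0_compat; lra. }
exists T1; split; auto; intros T HT.
rewrite RInt_scal_cont; auto.
replace (c * RInt u (- T) T - 2 * T * (c * a)) with (c * (RInt u (- T) T - 2 * T * a)) by ring.
rewrite Rabs_mult.
specialize (H1' T HT).
apply Rle_trans with ((Rabs c + 1) * (eps / (Rabs c + 1) * (2 * T))).
- apply Rmult_le_compat; try lra; apply Rabs_pos.
- right; field; lra.
Qed.

Lemma mean_minus u v a b : cont u -> cont v -> mean u a -> mean v b ->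
  mean (fun t => u t - v t) (a - b).
Proof.
intros Cu Cv Hu Hv.
replace (a - b) with (a + (-1) * b) by ring.
apply (mean_ext (fun t => u t + (-1) * v t)); [intros; ring|].
apply mean_plus; auto with cont; now apply mean_scal.
Qed.

Lemma mean_const c : mean (fun _ => c) c.
Proof.
intros eps He; exists 1; split; [lra|]; intros T HT.
rewrite RInt_const_R.
replace ((T - - T) * c - 2 * T * c) with 0 by ring.
rewrite Rabs_R0; nra.
Qed.

Lemma mean_rsum n (u : nat -> R -> R) (a : nat -> R) :
  (forall k, (k < n)%nat -> cont (u k)) ->
  (forall k, (k < n)%nat -> mean (u k) (a k)) ->
  mean (fun t => rsum n (fun k => u k t)) (rsum n a).
Proof.
induction n as [|n IH]; intros Cu Hu; simpl; [apply mean_const|].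
apply mean_plus; auto with cont.
Qed.

(** Serves for functions whose averages are not known to converge. *)
Definition mean_ge (u : R -> R) (c : R) : Prop :=
  exists T0, 0 < T0 /\ forall T, T0 <= T -> c * (2 * T) <= RInt u (- T) T.

Lemma mean_ge_le u v c m : cont u -> cont v -> mean_ge u c -> mean v m ->
  (forall t, u t <= v t) -> c <= m.
Proof.
intros Cu Cv [T0 [H0 Hc]] Hv Huv.
apply Rnot_lt_le; intros Hlt.
destruct (Hv ((c - m) / 2)) as [T1 [H1 H1']]; [lra|].
specialize (H1' (T0 + T1) ltac:(lra)); specialize (Hc (T0 + T1) ltac:(lra)).
assert (H2 : RInt u (- (T0 + T1)) (T0 + T1) <= RInt v (- (T0 + T1)) (T0 + T1)).
{ apply RInt_le_cont; auto; lra. }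
apply Rabs_le_between in H1'; nra.
Qed.

Lemma mean_le u v a b : cont u -> cont v -> mean u a -> mean v b ->
  (forall t, u t <= v t) -> a <= b.
Proof.
intros Cu Cv Hu Hv Huv.
apply Rnot_lt_le; intros Hlt.
assert (H : (a + b) / 2 <= b); [|lra].
apply (mean_ge_le u v); auto.
destruct (Hu ((a - b) / 2)) as [T1 [H1 H1']]; [lra|].
exists T1; split; auto; intros T HT; specialize (H1' T HT).
apply Rabs_le_between in H1'; nra.
Qed.

Lemma mean_unique u a b : cont u -> mean u a -> mean u b -> a = b.
Proof.
intros Cu Ha Hb; apply Rle_antisym.
- apply (mean_le u u); auto with real.
- apply (mean_le u u); auto with real.
Qed.

Lemma mean_ge0 u a : cont u -> mean u a -> (forall t, 0 <= u t) -> 0 <= a.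
Proof. intros; apply (mean_le (fun _ => 0) u); auto using mean_const with cont. Qed.

(** The two intervals differ by two intervals of length [|z|], whatever their length. *)
Lemma RInt_move u B a b z : cont u -> (forall t, Rabs (u t) <= B) ->
  Rabs (RInt u (a + z) (b + z) - RInt u a b) <= 2 * Rabs z * B.
Proof.
intros Cu HB.
assert (Hm : forall c, Rabs (RInt u c (c + z)) <= Rabs z * B).
{ intros c; destruct (Rle_dec 0 z) as [Hz|Hz].
  - rewrite (Rabs_pos_eq z); auto.
    replace (z * B) with ((c + z - c) * B) by ring.
    apply RInt_abs_le; auto; lra.
  - rewrite (Rabs_left z); [|lra].
    rewrite <- (opp_RInt_swap u (c + z) c); [|auto with cont].
    unfold opp; simpl; rewrite Rabs_Ropp.
    replace (- z * B) with ((c - (c + z)) * B) by ring.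
    apply RInt_abs_le; auto; lra. }
rewrite <- (RInt_Chasles_cont u (a + z) b (b + z)); auto.
rewrite <- (RInt_Chasles_cont u a (a + z) b); auto.
generalize (Hm a) (Hm b); intros Ha Hb.
apply Rabs_le_between in Ha; apply Rabs_le_between in Hb.
apply Rabs_le; lra.
Qed.

Lemma mean_shift u B m z : cont u -> (forall t, Rabs (u t) <= B) ->
  mean u m -> mean (fun t => u (t + z)) m.
Proof.
intros Cu HB Hu eps He.
assert (HB0 : 0 <= B) by (generalize (HB 0) (Rabs_pos (u 0)); lra).
destruct (Hu (eps / 2)) as [T1 [H1 H1']]; [lra|].
exists (T1 + 2 * Rabs z * B / eps); split.
{ apply Rplus_lt_le_0_compat; auto.
  apply Rdiv_le_0_compat; auto. generalize (Rabs_pos z); nra. }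
intros T HT; rewrite RInt_shift; auto.
assert (H2 : 0 <= 2 * Rabs z * B / eps).
{ apply Rdiv_le_0_compat; auto. generalize (Rabs_pos z); nra. }
specialize (H1' T ltac:(lra)).
generalize (RInt_move u B (- T) T z Cu HB); intros H3.
assert (H4 : 2 * Rabs z * B <= eps * T).
{ replace (2 * Rabs z * B) with (eps * (2 * Rabs z * B / eps)) by (field; lra). nra. }
apply Rabs_le_between in H1'; apply Rabs_le_between in H3.
apply Rabs_le; lra.
Qed.

(** Tile the interval by blocks of length [L]; the incomplete last block accounts for the
    terms that do not grow with [S]. *)
Lemma RInt_tile g L K B : cont g -> 0 < L -> 0 <= B -> (forall t, g t <= B) ->
  (forall t, RInt g t (t + L) <= K) ->
  forall t S, 0 <= S -> RInt g t (t + S) <= S / L * K + Rabs K + L * B.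
Proof.
intros Cg HL HB0 HB HK t S HS.
assert (Hq : exists q : nat, INR q * L <= S < INR q * L + L).
{ destruct (nfloor_ex (S / L)) as [q Hq]; [apply Rdiv_le_0_compat; auto|].
  exists q; replace S with (S / L * L) by (field; lra); nra. }
destruct Hq as [q Hq].
assert (Hblocks : forall q : nat, RInt g t (t + INR q * L) <= INR q * K).
{ induction q0 as [|q0 IH].
  - simpl; rewrite !Rmult_0_l, Rplus_0_r, RInt_point; unfold zero; simpl; lra.
  - rewrite <- (RInt_Chasles_cont g t (t + INR q0 * L)); auto.
    rewrite S_INR.
    replace (t + (INR q0 + 1) * L) with (t + INR q0 * L + L) by ring.
    generalize (HK (t + INR q0 * L)); lra. }
rewrite <- (RInt_Chasles_cont g t (t + INR q * L)); auto.
assert (Hrem : RInt g (t + INR q * L) (t + S) <= L * B).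
{ apply Rle_trans with ((t + S - (t + INR q * L)) * B); [|nra].
  apply RInt_upper; auto; lra. }
generalize (Hblocks q); intros Hb.
assert (Hr : INR q * K <= S / L * K + Rabs K); [|lra].
replace (INR q * K) with (S / L * K - (S - INR q * L) / L * K) by (field; lra).
assert (H1 : 0 <= (S - INR q * L) / L <= 1).
{ split; [apply Rdiv_le_0_compat; lra|].
  apply Rmult_le_reg_r with L; auto.
  replace ((S - INR q * L) / L * L) with (S - INR q * L) by (field; lra); lra. }
generalize (Rle_abs K) (Rle_abs (- K)) (Rabs_pos K); rewrite Rabs_Ropp; intros.
nra.
Qed.

(** * Relatively dense unions of intervals *)

(** The two lengths are explicit because the estimates below must hold with the same constants
    for whole families of functions. *)
Definition rdense (l d : R) (Z : R -> Prop) : Prop :=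
  forall x, exists y, x <= y <= x + l /\ forall z, y <= z <= y + d -> Z z.

Lemma rdense_mono l d (Z Z' : R -> Prop) :
  (forall z, Z z -> Z' z) -> rdense l d Z -> rdense l d Z'.
Proof.
intros HZ H x; destruct (H x) as [y [Hy Hz]]; exists y; auto.
Qed.

(** Every interval of length [l + d] contributes at least [c d] to the integral; the factor
    [2] absorbs the incomplete last block. *)
Lemma rdense_mean_ge u l d c Z : cont u -> (forall t, 0 <= u t) -> 0 < l -> 0 < d ->
  0 < c -> rdense l d Z -> (forall z, Z z -> c <= u z) ->
  mean_ge u (c * d / (2 * (l + d))).
Proof.
intros Cu Hu Hl Hd Hc HZ Hcz.
assert (HK : forall t, RInt (fun s => (-1) * u s) t (t + (l + d)) <= - (c * d)).
{ intros t; rewrite RInt_scal_cont; auto.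
  destruct (HZ t) as [y [Hy Hyz]].
  rewrite <- (RInt_Chasles_cont u t y); auto.
  rewrite <- (RInt_Chasles_cont u y (y + d)); auto.
  assert (H1 : (y + d - y) * c <= RInt u y (y + d)) by (apply RInt_lower; auto; lra).
  assert (H2 : (y - t) * 0 <= RInt u t y) by (apply RInt_lower; auto; lra).
  assert (H3 : (t + (l + d) - (y + d)) * 0 <= RInt u (y + d) (t + (l + d)))
    by (apply RInt_lower; auto; lra).
  nra. }
assert (Cm : cont (fun s => (-1) * u s)) by auto with cont.
generalize (RInt_tile _ (l + d) _ 0 Cm ltac:(lra) (Rle_refl 0)
  ltac:(intros t; generalize (Hu t); lra) HK); intros Ht.
exists (l + d); split; [lra|]; intros T HT.
specialize (Ht (- T) (2 * T) ltac:(lra)).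
replace (- T + 2 * T) with T in Ht by ring.
rewrite RInt_scal_cont in Ht; auto.
assert (Hcd : 0 < c * d) by nra.
rewrite Rabs_left in Ht; [|nra].
assert (H1 : c * d / (2 * (l + d)) * (2 * T) * 2 = 2 * T / (l + d) * (c * d))
  by (field; lra).
assert (H2 : c * d <= c * d / (2 * (l + d)) * (2 * T)).
{ replace (c * d / (2 * (l + d)) * (2 * T)) with (c * d * (T / (l + d))) by (field; lra).
  assert (1 <= T / (l + d)); [|generalize dependent (T / (l + d)); intros; nra].
  apply Rmult_le_reg_r with (l + d); [lra|].
  replace (T / (l + d) * (l + d)) with T by (field; lra); lra. }
nra.
Qed.

(** * Existence of mean values *)

(** Almost periods carry any interval into a fixed one, so that averages over long
    intervals do not depend on where the interval lies. *)
Lemma almost_periodic_mean u B : cont u -> (forall t, Rabs (u t) <= B) ->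
  (forall e, 0 < e -> exists l d, 0 < l /\ 0 < d /\
    rdense l d (fun z => forall t, Rabs (u (t + z) - u t) <= e)) ->
  exists m, mean u m.
Proof.
intros Cu HB HZ.
assert (HB0 : 0 <= B) by (generalize (HB 0) (Rabs_pos (u 0)); lra).
assert (Hloc : forall e, 0 < e -> exists m T0, 0 < T0 /\
  forall T, T0 <= T -> Rabs (RInt u (- T) T - 2 * T * m) <= e * (2 * T)).
{ intros e He.
  destruct (HZ (e / 4)) as [l [d [Hl [Hd Hz]]]]; [lra|].
  set (L := 1 + 8 * l * B / e).
  assert (HL1 : 0 <= 8 * l * B / e) by (apply Rdiv_le_0_compat; nra).
  assert (HL : 8 * l * B <= e * L).
  { unfold L; replace (e * (1 + 8 * l * B / e)) with (e + 8 * l * B) by (field; lra); lra. }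
  assert (HL0 : 0 < L) by (unfold L; lra).
  set (J := RInt u 0 L).
  assert (HJ : forall a, Rabs (RInt u a (a + L) - J) <= e / 2 * L).
  { intros a; destruct (Hz a) as [z [Ha Hz']].
    assert (H1 : Rabs (RInt u (0 + z) (L + z) - J) <= e / 4 * L).
    { rewrite <- RInt_shift; auto.
      replace (RInt (fun t => u (t + z)) 0 L - J) with
        (RInt (fun t => u (t + z) + (-1) * u t) 0 L).
      - replace (e / 4 * L) with ((L - 0) * (e / 4)) by ring.
        apply RInt_abs_le; auto with cont; [lra|]; intros t _.
        replace (u (t + z) + (-1) * u t) with (u (t + z) - u t) by ring.
        apply Hz'; lra.
      - rewrite RInt_plus_cont, RInt_scal_cont; auto with cont; in_R; unfold J; ring. }
    generalize (RInt_move u B a (a + L) (z - a) Cu HB).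
    replace (a + (z - a)) with (0 + z) by ring.
    replace (a + L + (z - a)) with (L + z) by ring.
    rewrite (Rabs_pos_eq (z - a)); [|lra]; intros H2.
    assert (2 * (z - a) * B <= 2 * l * B) by nra.
    apply Rabs_le_between in H1; apply Rabs_le_between in H2.
    apply Rabs_le; lra. }
  assert (HJb : Rabs J <= L * B).
  { unfold J; replace (L * B) with ((L - 0) * B) by ring; apply RInt_abs_le; auto; lra. }
  (* [C0] collects the boundary terms of the two tilings, for [u] and for [- u] *)
  set (C0 := L * B + e / 2 * L + L * B).
  exists (J / L), (2 * C0 / e + 1).
  assert (HC0 : 0 <= C0) by (unfold C0; nra).
  assert (HC1 : 0 <= 2 * C0 / e) by (apply Rdiv_le_0_compat; lra).
  split; [lra|]; intros T HT.
  assert (HC2 : 2 * C0 <= e * T).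
  { replace (2 * C0) with (e * (2 * C0 / e)) by (field; lra). nra. }
  assert (Hup : forall s, (s = 1 \/ s = -1) ->
    s * RInt u (- T) T <= 2 * T / L * (s * J + e / 2 * L) + C0).
  { intros s Hs.
    generalize (RInt_tile (fun t => s * u t) L (s * J + e / 2 * L) B).
    intros H; specialize (H ltac:(auto with cont) HL0 HB0).
    specialize (H ltac:(intros t; generalize (HB t); intros Hb;
      apply Rabs_le_between in Hb; destruct Hs; subst; lra)).
    assert (HK : forall t, RInt (fun t => s * u t) t (t + L) <= s * J + e / 2 * L).
    { intros t; rewrite RInt_scal_cont; auto.
      generalize (HJ t); intros Hj; apply Rabs_le_between in Hj.
      destruct Hs; subst; lra. }
    specialize (H HK (- T) (2 * T) ltac:(lra)).
    replace (- T + 2 * T) with T in H by ring.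
    rewrite RInt_scal_cont in H; auto.
    assert (Rabs (s * J + e / 2 * L) <= L * B + e / 2 * L); [|unfold C0; lra].
    apply Rabs_le_between in HJb; apply Rabs_le.
    destruct Hs; subst; split; nra. }
  generalize (Hup 1 (or_introl eq_refl)) (Hup (-1) (or_intror eq_refl)).
  replace (2 * T / L * (1 * J + e / 2 * L)) with (2 * T * (J / L) + e * T) by (field; lra).
  replace (2 * T / L * (-1 * J + e / 2 * L)) with (- (2 * T * (J / L)) + e * T)
    by (field; lra).
  intros H1 H2; apply Rabs_le; lra. }
(* the averages over symmetric intervals with integer end points form a Cauchy sequence *)
assert (Hc : Cauchy_crit (fun n => RInt u (- INR (S n)) (INR (S n)) / (2 * INR (S n)))).
{ intros e He.
  destruct (Hloc (e / 3)) as [m [T0 [H0 H1]]]; [lra|].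
  destruct (nfloor_ex T0) as [N HN]; [lra|].
  assert (Hn : forall n, (n >= N)%nat ->
    Rabs (RInt u (- INR (S n)) (INR (S n)) / (2 * INR (S n)) - m) <= e / 3).
  { intros n Hn.
    assert (HT : T0 <= INR (S n)).
    { rewrite S_INR; apply Rle_trans with (INR N + 1); [lra|].
      apply le_INR in Hn; lra. }
    specialize (H1 _ HT).
    set (T := INR (S n)) in *.
    replace (RInt u (- T) T / (2 * T) - m) with ((RInt u (- T) T - 2 * T * m) / (2 * T))
      by (field; lra).
    unfold Rdiv; rewrite Rabs_mult, (Rabs_pos_eq (/ (2 * T))).
    - apply Rmult_le_reg_r with (2 * T); [lra|].
      rewrite Rmult_assoc, Rinv_l; lra.
    - apply Rlt_le, Rinv_0_lt_compat; lra. }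
  exists N; intros n1 n2 Hn1 Hn2; unfold Rdist.
  generalize (Hn n1 Hn1) (Hn n2 Hn2); intros K1 K2.
  apply Rabs_le_between in K1; apply Rabs_le_between in K2.
  apply Rabs_def1; lra. }
destruct (Rcomplete.R_complete _ Hc) as [m Hm].
exists m; intros e He.
destruct (Hloc (e / 4)) as [m' [T0 [H0 H1]]]; [lra|].
assert (Hmm : Rabs (m' - m) <= e / 2).
{ destruct (Hm (e / 4)) as [N HN]; [lra|].
  destruct (nfloor_ex T0) as [N' HN']; [lra|].
  specialize (HN (N + N')%nat ltac:(lia)).
  assert (HT : T0 <= INR (S (N + N'))).
  { rewrite S_INR, plus_INR; generalize (pos_INR N); lra. }
  specialize (H1 _ HT).
  unfold Rdist in HN.
  set (T := INR (S (N + N'))) in *.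
  set (q := RInt u (- T) T / (2 * T)) in *.
  assert (Hd : forall x y : R, 0 < y -> x = y * (x / y)) by (intros; field; lra).
  assert (Hq : RInt u (- T) T = 2 * T * q) by (apply Hd; lra).
  rewrite Hq in H1.
  replace (2 * T * q - 2 * T * m') with (2 * T * (q - m')) in H1 by ring.
  rewrite Rabs_mult, Rabs_pos_eq in H1; [|lra].
  assert (H2 : Rabs (q - m') <= e / 4) by nra.
  apply Rabs_le_between in H2; apply Rabs_def2 in HN.
  apply Rabs_le; lra. }
exists T0; split; auto; intros T HT; specialize (H1 T HT).
apply Rabs_le_between in H1; apply Rabs_le_between in Hmm.
apply Rabs_le; nra.
Qed.

(** * Mean values of exponentials *)

Lemma mean_bounded_primitive u B : cont u ->
  (forall T, Rabs (RInt u (- T) T) <= B) -> mean u 0.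
Proof.
intros Cu HB eps He.
assert (HB0 : 0 <= B) by (generalize (HB 0) (Rabs_pos (RInt u (- 0) 0)); lra).
exists (B / eps + 1).
assert (H0 : 0 <= B / eps) by (apply Rdiv_le_0_compat; lra).
split; [lra|]; intros T HT.
rewrite Rmult_0_r, Rminus_0_r; apply Rle_trans with (1 := HB T).
replace B with (eps * (B / eps)) by (field; lra); nra.
Qed.

Lemma RInt_cos mu b c a : mu <> 0 ->
  RInt (fun t => cos (mu * t + b)) a c = (sin (mu * c + b) - sin (mu * a + b)) / mu.
Proof.
intros Hmu; apply is_RInt_unique.
replace ((sin (mu * c + b) - sin (mu * a + b)) / mu) with
  (minus (sin (mu * c + b) / mu) (sin (mu * a + b) / mu))
  by (unfold minus, plus, opp; simpl; field; auto).
apply (is_RInt_derive (fun t => sin (mu * t + b) / mu)).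
- intros x _; auto_derive; auto; field; auto.
- intros x _; apply cont_cos.
Qed.

Lemma mean_cos mu b : mu <> 0 -> mean (fun t => cos (mu * t + b)) 0.
Proof.
intros Hmu.
apply (mean_bounded_primitive _ (2 / Rabs mu)); [apply cont_cos|].
intros T; rewrite RInt_cos; auto.
unfold Rdiv; rewrite Rabs_mult, Rabs_inv.
apply Rmult_le_compat_r.
- apply Rlt_le, Rinv_0_lt_compat, Rabs_pos_lt; auto.
- generalize (SIN_bound (mu * T + b)) (SIN_bound (mu * - T + b)); intros.
  apply Rabs_le; lra.
Qed.

Lemma mean_dot_cis z w lam mu : lam <> mu ->
  mean (fun t => dot (z * cis (lam * t))%C (w * cis (mu * t))%C) 0.
Proof.
intros Hne.
assert (Hne' : lam - mu <> 0) by lra.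
(* the real and imaginary parts of [z * conj w] are [dot z w] and
   [dot z (w * i)], with [w * i = w * cis (PI / 2)] *)
apply (mean_ext (fun t => dot z w * cos ((lam - mu) * t + 0) +
  dot z (w * cis (PI / 2))%C * cos ((lam - mu) * t + PI / 2))).
- intros t; rewrite (dot_rot_l z), <- Cmult_assoc, <- cis_plus.
  replace (mu * t + - (lam * t)) with (- ((lam - mu) * t)) by ring.
  rewrite Rplus_0_r, (cos_plus _ (PI / 2)), cos_PI2, sin_PI2.
  set (x := (lam - mu) * t).
  unfold cis, dot; simpl.
  rewrite cos_neg, sin_neg, cos_PI2, sin_PI2; unfold Re, Im; simpl; ring.
- replace 0 with (dot z w * 0 + dot z (w * cis (PI / 2))%C * 0) by ring.
  apply mean_plus; try apply mean_scal; auto using mean_cos with cont.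
Qed.

(** * Almost periodic functions on a line *)

Definition shift_close (F : R -> C) (e z : R) : Prop :=
  forall t, Cmod (F (t + z)%R - F t)%C <= e.

(** Bohr's condition, with the almost periods asked to fill intervals of a fixed length;
    this also encodes uniform continuity. *)
Definition almost_periodic (F : R -> C) : Prop :=
  contC F /\ (exists B, 0 <= B /\ forall t, Cmod (F t) <= B) /\
  forall e, 0 < e -> exists l d, 0 < l /\ 0 < d /\ rdense l d (shift_close F e).

(** The complex number [c] is the mean value of [F t * exp (- i mu t)], tested against
    real linear functionals. *)
Definition fcoef (F : R -> C) (mu : R) (c : C) : Prop :=
  forall w, mean (fun t => dot (F t) (w * cis (mu * t))%C) (dot c w).

Definition autocorr (F : R -> C) (rho : R -> R) : Prop :=
  forall x, mean (fun t => dot (F (t + x)) (F t)) (rho x).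

Lemma dot_F_bound F B w mu t : (forall t, Cmod (F t) <= B) ->
  Rabs (dot (F t) (w * cis (mu * t))%C) <= B * Cmod w.
Proof.
intros HB; apply dot_bound; auto.
rewrite Cmod_mult, Cmod_cis; lra.
Qed.

Lemma dot_eq a b : (forall w, dot a w = dot b w) -> a = b.
Proof.
intros H; generalize (H (RtoC 1)) (H Ci); unfold dot; simpl; intros H1 H2.
apply injective_projections; unfold Re, Im in *; lra.
Qed.

Lemma fcoef_unique F mu a b : contC F -> fcoef F mu a -> fcoef F mu b -> a = b.
Proof.
intros CF Ha Hb; apply dot_eq; intros w.
apply (mean_unique (fun t => dot (F t) (w * cis (mu * t))%C)); auto with cont.
Qed.

Lemma fcoef_ext F G mu c : (forall t, F t = G t) -> fcoef F mu c -> fcoef G mu c.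
Proof.
intros H HF w; apply (mean_ext (fun t => dot (F t) (w * cis (mu * t))%C)); auto.
intros t; now rewrite H.
Qed.

Lemma fcoef_minus F G mu a b : contC F -> contC G -> fcoef F mu a -> fcoef G mu b ->
  fcoef (fun t => F t - G t)%C mu (a - b)%C.
Proof.
intros CF CG HF HG w; rewrite dot_minus_l.
apply (mean_ext (fun t => dot (F t) (w * cis (mu * t))%C - dot (G t) (w * cis (mu * t))%C)).
- intros t; now rewrite dot_minus_l.
- apply mean_minus; auto with cont.
Qed.

Lemma fcoef_shift F B mu c z : contC F -> (forall t, Cmod (F t) <= B) ->
  fcoef F mu c -> fcoef (fun t => F (t + z)%R) mu (c * cis (mu * z))%C.
Proof.
intros CF HB HF w; rewrite dot_rot_l.
set (w' := (w * cis (- (mu * z)))%C).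
apply (mean_ext (fun t => dot (F (t + z)) (w' * cis (mu * (t + z)))%C)).
- intros t; unfold w'; rewrite <- Cmult_assoc, <- cis_plus; do 3 f_equal; ring.
- apply (mean_shift (fun t => dot (F t) (w' * cis (mu * t))%C) (B * Cmod w'));
    auto with cont.
  intros t; now apply dot_F_bound.
Qed.

Lemma fcoef_le F mu c e : contC F -> (forall t, Cmod (F t) <= e) ->
  fcoef F mu c -> nsq c <= e * e.
Proof.
intros CF He HF.
assert (He0 : 0 <= e) by (generalize (He 0) (Cmod_ge_0 (F 0)); lra).
apply nsq_dual; auto; intros w Hw.
apply (mean_le (fun t => dot (F t) (w * cis (mu * t))%C) (fun _ => e));
  auto using mean_const with cont.
intros t; generalize (dot_F_bound F e w mu t He); intros H.
apply Rabs_le_between in H; generalize (Cmod_ge_0 w); nra.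
Qed.

(** The difference [F (t + z) - F t] has the Fourier coefficient [c (exp (i mu z) - 1)].
    Thus an almost period of [F] is one for each of its harmonics, and subtracting harmonics
    preserves almost periodicity. *)
Lemma fcoef_shift_close F B mu c e z : contC F -> (forall t, Cmod (F t) <= B) ->
  shift_close F e z -> fcoef F mu c -> Cmod (c * cis (mu * z) - c)%C <= e.
Proof.
intros CF HB Hz HF.
assert (He0 : 0 <= e) by (generalize (Hz 0) (Cmod_ge_0 (F (0 + z)%R - F 0%R)%C); lra).
apply Cmod_le_nsq; auto.
apply (fcoef_le (fun t => F (t + z)%R - F t)%C mu); auto with cont.
apply fcoef_minus; auto with cont.
now apply (fcoef_shift F B).
Qed.

Definition peel (F : R -> C) (lam : R) (A : C) : R -> C :=
  fun t => (F t - A * cis (lam * t))%C.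

Lemma contC_peel F lam A : contC F -> contC (peel F lam A).
Proof.
intros CF; unfold peel.
apply contC_minus; auto; apply (contC_mult (fun _ => A)); auto with cont.
Qed.

Lemma Cmod_minus_le a b : Cmod (a - b)%C <= Cmod a + Cmod b.
Proof. unfold Cminus; rewrite <- (Cmod_opp b); apply Cmod_triangle. Qed.

Lemma almost_periodic_peel F lam A : almost_periodic F -> fcoef F lam A ->
  almost_periodic (peel F lam A).
Proof.
intros [CF [[B [HB0 HB]] HZ]] HA; split; [|split].
- now apply contC_peel.
- exists (B + Cmod A); split; [generalize (Cmod_ge_0 A); lra|].
  intros t; unfold peel; apply Rle_trans with (1 := Cmod_minus_le _ _).
  rewrite Cmod_mult, Cmod_cis; generalize (HB t); lra.
- intros e He; destruct (HZ (e / 2)) as [l [d [Hl [Hd Hz]]]]; [lra|].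
  exists l, d; repeat split; auto.
  apply rdense_mono with (2 := Hz); intros z Hcl t; unfold peel.
  replace (F (t + z)%R - A * cis (lam * (t + z)) - (F t - A * cis (lam * t)))%C with
    ((F (t + z)%R - F t) - (A * cis (lam * z) - A) * cis (lam * t))%C.
  + apply Rle_trans with (1 := Cmod_minus_le _ _).
    rewrite Cmod_mult, Cmod_cis.
    generalize (Hcl t) (fcoef_shift_close F B lam A (e / 2) z CF HB Hcl HA); lra.
  + rewrite Rmult_plus_distr_l, cis_plus; ring.
Qed.

Lemma fcoef_cis_same A lam : fcoef (fun t => A * cis (lam * t))%C lam A.
Proof.
intros w; apply (mean_ext (fun _ => dot A w)); [|apply mean_const].
intros t; now rewrite dot_rot.
Qed.

Lemma fcoef_cis_other A lam mu : lam <> mu ->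
  fcoef (fun t => A * cis (lam * t))%C mu (RtoC 0).
Proof. intros H w; rewrite dot_0_l; now apply mean_dot_cis. Qed.

Lemma contC_wave A lam : contC (fun t => A * cis (lam * t))%C.
Proof. apply (contC_mult (fun _ => A)); auto with cont. Qed.

Lemma fcoef_peel_same F lam A : contC F -> fcoef F lam A ->
  fcoef (peel F lam A) lam (RtoC 0).
Proof.
intros CF HA; replace (RtoC 0) with (A - A)%C by ring.
apply fcoef_minus; auto using contC_wave, fcoef_cis_same.
Qed.

Lemma fcoef_peel_other F lam A mu c : contC F -> lam <> mu -> fcoef F mu c ->
  fcoef (peel F lam A) mu c.
Proof.
intros CF Hne Hc; replace c with (c - RtoC 0)%C by ring.
apply fcoef_minus; auto using contC_wave, fcoef_cis_other.
Qed.

(** * Autocorrelations *)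

(** [F (t + x) * conj (F t)] has the almost periods of [F] for every [x]; the values at the
    different [x] are then collected by choice. *)
Lemma autocorr_exists F : almost_periodic F -> exists rho, autocorr F rho.
Proof.
intros [CF [[B [HB0 HB]] HZ]].
assert (H : forall x, exists m, mean (fun t => dot (F (t + x)) (F t)) m).
{ intros x; apply (almost_periodic_mean _ (B * B)); auto with cont.
  - intros t; apply dot_bound; auto.
  - intros e He.
    destruct (HZ (e / (2 * B + 1))) as [l [d [Hl [Hd Hz]]]].
    { apply Rdiv_lt_0_compat; lra. }
    exists l, d; repeat split; auto.
    apply rdense_mono with (2 := Hz); intros z Hcl t.
    set (e' := e / (2 * B + 1)) in *.
    assert (He' : 2 * B * e' + e' = e) by (unfold e'; field; lra).
    replace (dot (F (t + z + x)) (F (t + z)) - dot (F (t + x)) (F t)) with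
      (dot (F (t + x + z)%R - F (t + x)%R)%C (F (t + z)%R) +
       dot (F (t + x)) (F (t + z)%R - F t)%C).
    + apply Rle_trans with (1 := Rabs_triang _ _).
      generalize (dot_bound _ _ _ _ (Hcl (t + x)) (HB (t + z))).
      generalize (dot_bound _ _ _ _ (HB (t + x)) (Hcl t)).
      assert (0 < e') by (unfold e'; apply Rdiv_lt_0_compat; lra).
      lra.
    + rewrite dot_minus_l, dot_minus_r.
      replace (t + x + z) with (t + z + x) by ring; ring. }
exists (fun x => proj1_sig (constructive_indefinite_description _ (H x))).
intros x; now destruct constructive_indefinite_description.
Qed.

Lemma autocorr_shift F B rho x y : contC F -> (forall t, Cmod (F t) <= B) ->
  autocorr F rho -> mean (fun t => dot (F (t + x)) (F (t + y))) (rho (x - y)).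
Proof.
intros CF HB Hr.
apply (mean_ext (fun t => dot (F (t + y + (x - y))) (F (t + y)%R))).
- intros t; do 2 f_equal; ring.
- apply (mean_shift (fun t => dot (F (t + (x - y))) (F t)) (B * B)); auto with cont.
  intros t; apply dot_bound; auto.
Qed.

Lemma autocorr_even F B rho x : contC F -> (forall t, Cmod (F t) <= B) ->
  autocorr F rho -> rho (- x) = rho x.
Proof.
intros CF HB Hr.
apply (mean_unique (fun t => dot (F (t + x)) (F t))); auto with cont.
apply (mean_ext (fun t => dot (F (t + 0)) (F (t + x)))).
- intros t; now rewrite Rplus_0_r, dot_sym.
- rewrite <- (Rminus_0_l x); now apply (autocorr_shift F B).
Qed.

Lemma autocorr_nsq F rho : autocorr F rho -> mean (fun t => nsq (F t)) (rho 0).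
Proof.
intros Hr; apply (mean_ext (fun t => dot (F (t + 0)) (F t))); auto.
intros t; now rewrite Rplus_0_r.
Qed.

Lemma autocorr_0_ge0 F rho : contC F -> autocorr F rho -> 0 <= rho 0.
Proof.
intros CF Hr; apply (mean_ge0 (fun t => nsq (F t))); auto using autocorr_nsq with cont.
intros t; apply nsq_ge0.
Qed.

Lemma autocorr_diff F B rho x : contC F -> (forall t, Cmod (F t) <= B) ->
  autocorr F rho -> mean (fun t => nsq (F (t + x)%R - F t)%C) (2 * (rho 0 - rho x)).
Proof.
intros CF HB Hr.
apply (mean_ext (fun t => dot (F (t + x)) (F (t + x)) + nsq (F t)
  + (-2) * dot (F (t + x)) (F t))).
- intros t; rewrite nsq_minus; unfold nsq; ring.
- replace (2 * (rho 0 - rho x)) with (rho (x - x) + rho 0 + (-2) * rho x)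
    by (replace (x - x) with 0 by ring; ring).
  apply mean_plus; [| |apply mean_plus|apply mean_scal];
    auto using autocorr_nsq with cont.
  now apply (autocorr_shift F B).
Qed.

Lemma autocorr_le F B rho x : contC F -> (forall t, Cmod (F t) <= B) ->
  autocorr F rho -> rho x <= rho 0.
Proof.
intros CF HB Hr.
generalize (mean_ge0 _ _ (cont_nsq _ (contC_minus _ _ (contC_shift F x CF) CF))
  (autocorr_diff F B rho x CF HB Hr) (fun t => nsq_ge0 _)); lra.
Qed.

Lemma autocorr_shift_close F B rho e z : contC F -> (forall t, Cmod (F t) <= B) ->
  autocorr F rho -> shift_close F e z -> rho 0 - rho z <= e * e / 2.
Proof.
intros CF HB Hr Hz.
assert (H : 2 * (rho 0 - rho z) <= e * e); [|lra].
apply (mean_le (fun t => nsq (F (t + z)%R - F t)%C) (fun _ => e * e));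
  auto using mean_const with cont.
- now apply (autocorr_diff F B).
- intros t; apply nsq_le_Cmod, Hz.
Qed.

(** The two mixed terms of the expansion and the term without [F] all have the mean value
    [nsq A * cos (lam x)], with signs minus, minus, plus. *)
Lemma autocorr_peel F B rho lam A : contC F -> (forall t, Cmod (F t) <= B) ->
  autocorr F rho -> fcoef F lam A ->
  autocorr (peel F lam A) (fun x => rho x - nsq A * cos (lam * x)).
Proof.
intros CF HB Hr HA x.
set (c := nsq A * cos (lam * x)).
assert (Hcis : forall t, (A * cis (lam * (t + x)) = A * cis (lam * x) * cis (lam * t))%C).
{ intros t; rewrite Rmult_plus_distr_l, Rplus_comm, cis_plus; ring. }
apply (mean_ext (fun t => dot (F (t + x)) (F t)
  - dot (F t) (A * cis (lam * x) * cis (lam * t))%C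
  - dot (F (t + x)) (A * cis (lam * t))%C + c)).
- intros t; unfold peel; rewrite dot_minus_l, !dot_minus_r, Hcis, dot_rot.
  rewrite (dot_sym (A * _ * _)%C (F t)).
  rewrite (dot_sym (A * cis (lam * x))%C A), dot_rot_self; unfold c; ring.
- replace (rho x - c) with (rho x - c - c + c) by ring.
  assert (contC (fun t => A * cis (lam * x) * cis (lam * t))%C) by apply contC_wave.
  assert (contC (fun t => A * cis (lam * t))%C) by apply contC_wave.
  apply mean_plus; auto using mean_const with cont.
  apply mean_minus; auto with cont; [apply mean_minus; auto with cont|].
  + unfold c; rewrite <- dot_rot_self; apply HA.
  + replace c with (dot (A * cis (lam * x))%C A)
      by (rewrite dot_sym; unfold c; apply dot_rot_self).
    now apply (fcoef_shift F B).
Qed.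

(** * Averages against exponentials *)

(** From [cos x = 1 - 2 sin (x / 2) ^ 2] and [|sin y| <= |y|]. *)
Lemma cos_lower x : 1 - x * x / 2 <= cos x.
Proof.
replace x with (2 * (x / 2)) at 3 by field; rewrite cos_2a_sin.
assert (H : forall y, 0 <= y -> - y <= sin y <= y).
{ intros y Hy; destruct (Req_dec y 0) as [->|Hy0]; [rewrite sin_0; lra|].
  split; [|apply Rlt_le, sin_lt_x; lra].
  destruct (Rle_dec y 1) as [H1|H1].
  - generalize (sin_ge_0 y ltac:(lra) ltac:(generalize PI2_1; lra)); lra.
  - generalize (SIN_bound y); lra. }
assert (H2 : forall y, sin y * sin y <= y * y).
{ intros y; destruct (Rle_dec 0 y) as [Hy|Hy].
  - generalize (H y Hy); nra.
  - generalize (H (- y) ltac:(lra)); rewrite sin_neg; nra. }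
generalize (H2 (x / 2)); lra.
Qed.

Lemma Cmod_cis_sub1 x : Cmod (cis x - RtoC 1)%C <= Rabs x.
Proof.
apply Cmod_le_nsq; [apply Rabs_pos|].
rewrite <- cis_0; unfold nsq.
replace (cis x - cis 0)%C with (RtoC 1 * cis x - RtoC 1)%C by (rewrite cis_0; ring).
fold (nsq (RtoC 1 * cis x - RtoC 1)%C); rewrite nsq_rot_sub.
replace (nsq (RtoC 1)) with 1 by cring.
rewrite <- Rabs_mult, Rabs_pos_eq by nra.
generalize (cos_lower x); lra.
Qed.

Lemma cont_dot_wave F w lam : contC F -> cont (fun s => dot (F s) (w * cis (lam * s))%C).
Proof. intros CF; apply cont_dot; auto using contC_wave. Qed.
#[local] Hint Resolve cont_dot_wave contC_wave : cont.

(** An almost period [z] of [F] carries any interval close to a symmetric one, and merely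
    rotates the test vector [w]; so the averages of [F s * exp (- i lam s)] are, in
    modulus, uniformly close to the Fourier coefficient. *)
Lemma fourier_average F lam c k eta : almost_periodic F -> fcoef F lam c ->
  0 <= k -> nsq c <= k * k -> 0 < eta ->
  exists L, 0 < L /\ forall t w, Cmod w <= 1 ->
    RInt (fun s => dot (F s) (w * cis (lam * s))%C) t (t + L) <= (k + eta) * L.
Proof.
intros [CF [[B [HB0 HB]] HZ]] Hc Hk Hck Heta.
destruct (HZ (eta / 4)) as [l [d [Hl [Hd Hz]]]]; [lra|].
destruct (Hc (RtoC 1) (eta / 8)) as [T1 [HT1 H1]]; [lra|].
destruct (Hc Ci (eta / 8)) as [T2 [HT2 H2]]; [lra|].
assert (H3 : 0 <= 2 * l * B / eta) by (apply Rdiv_le_0_compat; nra).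
set (T := T1 + T2 + 2 * l * B / eta).
assert (HT : 2 * l * B <= eta * T).
{ apply Rle_trans with (eta * (2 * l * B / eta)); [right; field; lra|].
  apply Rmult_le_compat_l; unfold T; lra. }
assert (HTpos : 0 < T) by (unfold T; lra).
specialize (H1 T ltac:(unfold T; lra)); specialize (H2 T ltac:(unfold T; lra)).
apply Cmod_le_nsq in Hck; auto.
assert (Hw : forall w, Cmod w <= 1 ->
  RInt (fun s => dot (F s) (w * cis (lam * s))%C) (- T) T <= (k + eta / 4) * (2 * T)).
{ intros w Hw.
  rewrite (RInt_ext _ (fun s => Re w * dot (F s) (RtoC 1 * cis (lam * s))%C +
    Im w * dot (F s) (Ci * cis (lam * s))%C)) by (intros; cring).
  rewrite RInt_plus_cont, !RInt_scal_cont; auto with cont.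
  set (I1 := RInt (fun s => dot (F s) (RtoC 1 * cis (lam * s))%C) (- T) T) in *.
  set (I2 := RInt (fun s => dot (F s) (Ci * cis (lam * s))%C) (- T) T) in *.
  assert (Hcw : dot c w <= k).
  { generalize (dot_bound c w _ _ Hck Hw); intros Hb.
    apply Rabs_le_between in Hb; lra. }
  generalize (nsq_le_Cmod w 1 Hw); unfold nsq, dot at 1; intros Hw2.
  assert (Hdw : dot c w = Re w * dot c (RtoC 1) + Im w * dot c Ci) by cring.
  apply Rabs_le_between in H1; apply Rabs_le_between in H2.
  set (a := Re w) in *; set (b := Im w) in *.
  assert (Ha : -1 <= a <= 1) by nra.
  assert (Hb : -1 <= b <= 1) by nra.
  set (x1 := I1 - 2 * T * dot c (RtoC 1)) in *.
  set (x2 := I2 - 2 * T * dot c Ci) in *.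
  replace (a * I1 + b * I2) with (a * x1 + b * x2 + 2 * T * dot c w)
    by (rewrite Hdw; unfold x1, x2; ring).
  assert (a * x1 <= eta / 8 * (2 * T)) by nra.
  assert (b * x2 <= eta / 8 * (2 * T)) by nra.
  nra. }
exists (2 * T); split; [lra|]; intros t w Hw1.
destruct (Hz (t + T)) as [z [Hzt Hzz]].
specialize (Hzz z ltac:(lra)).
assert (Hmove := RInt_move (fun s => dot (F s) (w * cis (lam * s))%C) B t (t + 2 * T)
  (z - T - t) ltac:(auto with cont)).
assert (Hdb : forall s, Rabs (dot (F s) (w * cis (lam * s))%C) <= B).
{ intros s; generalize (dot_F_bound F B w lam s HB); nra. }
specialize (Hmove Hdb).
replace (t + (z - T - t)) with (- T + z) in Hmove by ring.
replace (t + 2 * T + (z - T - t)) with (T + z) in Hmove by ring.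
rewrite (Rabs_pos_eq (z - T - t)) in Hmove by lra.
rewrite <- RInt_shift in Hmove; auto with cont; cbv beta in Hmove.
assert (Hsh : RInt (fun s => dot (F (s + z)%R) (w * cis (lam * (s + z)))%C) (- T) T <=
  RInt (fun s => dot (F s) (w * cis (lam * z) * cis (lam * s))%C + eta / 4) (- T) T).
{ apply RInt_le_cont; try lra.
  - apply (cont_shift (fun s => dot (F s) (w * cis (lam * s))%C)); auto with cont.
  - auto with cont.
  - intros s _.
    rewrite Rmult_plus_distr_l, (Rplus_comm (lam * s)), cis_plus, Cmult_assoc.
    set (v := (w * cis (lam * z) * cis (lam * s))%C).
    replace (F (s + z)%R) with (F s + (F (s + z)%R - F s))%C by ring.
    rewrite dot_plus_l.
    assert (Hv : Cmod v <= 1) by (unfold v; rewrite !Cmod_mult, !Cmod_cis; lra).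
    generalize (dot_bound _ v _ _ (Hzz s) Hv); intros Hb.
    apply Rabs_le_between in Hb; lra. }
rewrite RInt_plus_cont, RInt_const_R in Hsh; auto with cont.
assert (Hw2 : Cmod (w * cis (lam * z))%C <= 1) by (rewrite Cmod_mult, Cmod_cis; lra).
specialize (Hw _ Hw2).
assert (2 * (z - T - t) * B <= 2 * l * B) by nra.
apply Rabs_le_between in Hmove; lra.
Qed.

(** Inside a block the two exponentials, aligned at its left end, differ by at most
    [|mu - lam| * L]. *)
Lemma fourier_average_near F B lam mu K L t w : contC F -> 0 <= B ->
  (forall t, Cmod (F t) <= B) -> 0 <= L ->
  (forall w, Cmod w <= 1 ->
    RInt (fun s => dot (F s) (w * cis (lam * s))%C) t (t + L) <= K) ->
  Cmod w <= 1 ->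
  RInt (fun s => dot (F s) (w * cis (mu * s))%C) t (t + L) <=
    K + B * Rabs (mu - lam) * L * L.
Proof.
intros CF HB0 HB HL HK Hw.
set (w' := (w * cis ((mu - lam) * t))%C).
apply Rle_trans with (RInt (fun s => dot (F s) (w' * cis (lam * s))%C +
  B * (Rabs (mu - lam) * L)) t (t + L)).
- apply RInt_le_cont; auto with cont; [lra|]; intros s Hs.
  replace (w * cis (mu * s))%C with
    (w' * cis (lam * s) +
     w' * cis (lam * s) * (cis ((mu - lam) * (s - t)) - RtoC 1))%C.
  + rewrite dot_sym, dot_plus_l, dot_sym; apply Rplus_le_compat_l.
    apply Rle_trans with (1 := Rle_abs _); rewrite dot_sym.
    apply dot_bound; auto.
    unfold w'; rewrite !Cmod_mult, !Cmod_cis.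
    generalize (Cmod_cis_sub1 ((mu - lam) * (s - t))); rewrite Rabs_mult.
    rewrite (Rabs_pos_eq (s - t)) by lra.
    generalize (Rabs_pos (mu - lam))
      (Cmod_ge_0 (cis ((mu - lam) * (s - t)) - RtoC 1)%C) (Cmod_ge_0 w); intros.
    nra.
  + unfold w'.
    transitivity (w * (cis ((mu - lam) * t) * cis (lam * s) *
      cis ((mu - lam) * (s - t))))%C; [ring|].
    rewrite <- !cis_plus; do 2 f_equal; ring.
- rewrite RInt_plus_cont, RInt_const_R; auto with cont.
  assert (Hw' : Cmod w' <= 1) by (unfold w'; rewrite Cmod_mult, Cmod_cis; lra).
  generalize (HK w' Hw'); nra.
Qed.

(** Uniformity in the frequency follows by compactness of [[-M, M]]: each frequency has a
    block length [L] and a neighbourhood on which blocks of that length do. *)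
Lemma fourier_average_uniform F k eta M : almost_periodic F -> 0 <= k ->
  (forall mu, exists c, fcoef F mu c /\ nsq c <= k * k) -> 0 < eta ->
  exists T0, 0 < T0 /\ forall T t w mu, T0 <= T -> Cmod w <= 1 -> - M <= mu <= M ->
    RInt (fun s => dot (F s) (w * cis (mu * s))%C) t (t + T) <= (k + eta) * T.
Proof.
intros HF Hk Hc Heta.
assert (HL : forall lam, exists L, 0 < L /\ forall t w, Cmod w <= 1 ->
  RInt (fun s => dot (F s) (w * cis (lam * s))%C) t (t + L) <= (k + eta / 4) * L).
{ intros lam; destruct (Hc lam) as [c [Hc1 Hc2]].
  apply (fourier_average F lam c k (eta / 4)); auto; lra. }
destruct HF as [CF [[B [HB0 HB]] _]].
set (Lf := fun lam => proj1_sig (constructive_indefinite_description _ (HL lam))).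
assert (HLf : forall lam, 0 < Lf lam /\ forall t w, Cmod w <= 1 ->
  RInt (fun s => dot (F s) (w * cis (lam * s))%C) t (t + Lf lam) <=
    (k + eta / 4) * Lf lam).
{ intros lam; unfold Lf; now destruct constructive_indefinite_description. }
clearbody Lf; clear HL.
assert (Hdel : forall lam, 0 < Rmin (eta / (4 * (B + 1) * Lf lam)) (/ Lf lam)).
{ intros lam; destruct (HLf lam) as [H _]; apply Rmin_pos.
  - apply Rdiv_lt_0_compat; nra.
  - now apply Rinv_0_lt_compat. }
destruct (compactness_value_1d (- M) M (fun lam => mkposreal _ (Hdel lam))) as [d Hd].
assert (Hdpos := cond_pos d).
set (K := (k + eta / 2) / d + B / d).
assert (HK0 : 0 <= K).
{ unfold K; apply Rplus_le_le_0_compat; apply Rdiv_le_0_compat; lra. }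
assert (HK1 : 0 <= 2 * K / eta) by (apply Rdiv_le_0_compat; lra).
exists (2 * K / eta + 1); split; [lra|].
intros T t w mu HT Hw Hmu.
destruct (NNPP _ (Hd mu Hmu)) as [lam [_ [H1 H2]]]; simpl in H1, H2.
destruct (HLf lam) as [HL HLw]; set (L := Lf lam) in *.
assert (HLd : L <= / d).
{ apply Rmult_le_reg_r with (/ L); [now apply Rinv_0_lt_compat|].
  rewrite Rinv_r; [|lra].
  assert (H3 : d <= / L) by (eapply Rle_trans; [apply H2|apply Rmin_r]).
  apply Rmult_le_reg_l with d; auto.
  rewrite Rmult_1_r, <- Rmult_assoc, Rinv_r; lra. }
assert (Hnear : B * Rabs (mu - lam) * L <= eta / 4).
{ assert (H3 : Rabs (mu - lam) < eta / (4 * (B + 1) * L))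
    by (eapply Rlt_le_trans; [apply H1|apply Rmin_l]).
  assert (H4 : Rabs (mu - lam) * ((B + 1) * L) <= eta / 4).
  { replace (eta / 4) with (eta / (4 * (B + 1) * L) * ((B + 1) * L)) by (field; lra).
    apply Rmult_le_compat_r; nra. }
  generalize (Rabs_pos (mu - lam)); intros; nra. }
assert (Hblock : forall t, RInt (fun s => dot (F s) (w * cis (mu * s))%C) t (t + L) <=
  (k + eta / 2) * L).
{ intros t'.
  generalize (fourier_average_near F B lam mu _ L t' w CF HB0 HB (Rlt_le _ _ HL)
    (HLw t') Hw).
  intros H; apply Rle_trans with (1 := H); nra. }
assert (Hup : forall s, dot (F s) (w * cis (mu * s))%C <= B).
{ intros s; generalize (dot_F_bound F B w mu s HB); intros H.
  apply Rabs_le_between in H; nra. }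
generalize (RInt_tile (fun s => dot (F s) (w * cis (mu * s))%C) L _ B
  ltac:(auto with cont) HL HB0 Hup Hblock t T ltac:(lra)); intros H.
rewrite Rabs_pos_eq in H by nra.
replace (T / L * ((k + eta / 2) * L)) with ((k + eta / 2) * T) in H by (field; lra).
assert (H3 : (k + eta / 2) * L + L * B <= K).
{ unfold K, Rdiv; nra. }
assert (H4 : K <= eta / 2 * T).
{ replace K with (eta / 2 * (2 * K / eta)) by (field; lra); nra. }
lra.
Qed.

(** * From integrals to sums over an arithmetic progression *)

Lemma RInt_odd v p : cont v -> (forall x, v (- x) = - v x) -> RInt v (- p) p = 0.
Proof.
intros Cv Hodd.
generalize (RInt_comp_lin v (-1) 0 (- p) p); intros H.
replace (-1 * - p + 0) with p in H by ring.
replace (-1 * p + 0) with (- p) in H by ring.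
specialize (H ltac:(auto with cont)).
rewrite (RInt_ext _ v) in H.
- rewrite <- (opp_RInt_swap v (- p) p) in H; auto with cont.
  unfold opp in H; simpl in H; lra.
- intros x _; unfold scal; simpl; unfold mult; simpl.
  replace (-1 * x + 0) with (- x) by ring; rewrite Hodd; ring.
Qed.

(** For [|mu x| <= pi / 2] the integral of [1 - (mu x) ^ 2 / 2] is at least
    [h (1 - pi ^ 2 / 24)], and [pi <= 4] suffices for a third of [h]. *)
Lemma RInt_cos_lower mu h : 0 <= h -> Rabs (mu * h) <= PI ->
  h / 3 <= RInt (fun x => cos (mu * x)) (- (h / 2)) (h / 2).
Proof.
intros Hh Hmu.
assert (Cq : cont (fun x => 1 - mu * x * (mu * x) / 2)).
{ intros x; apply (@ex_derive_continuous R_AbsRing R_NormedModule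
    (fun x => 1 - mu * x * (mu * x) / 2)); auto_derive; auto. }
apply Rle_trans with (RInt (fun x => 1 - mu * x * (mu * x) / 2) (- (h / 2)) (h / 2)).
- assert (H : is_RInt (fun x => 1 - mu * x * (mu * x) / 2) (- (h / 2)) (h / 2)
    (h - mu * h * (mu * h) * h / 24)).
  { replace (h - mu * h * (mu * h) * h / 24) with
      (minus (h / 2 - mu * mu * (h / 2) ^ 3 / 6)
        (- (h / 2) - mu * mu * (- (h / 2)) ^ 3 / 6))
      by (unfold minus, plus, opp; simpl; field).
    apply (is_RInt_derive (fun x => x - mu * mu * x ^ 3 / 6)).
    - intros x _; auto_derive; auto; field.
    - intros x _; apply Cq. }
  rewrite (is_RInt_unique _ _ _ _ H).
  generalize PI_4; intros H4.
  apply Rabs_le_between in Hmu.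
  set (y := mu * h) in *.
  assert (0 <= (4 - y) * (4 + y)) by (apply Rmult_le_pos; lra).
  assert (y * y * h <= 16 * h) by (apply Rmult_le_compat_r; lra). lra.
- apply RInt_le_cont; try lra.
  + exact Cq.
  + apply (cont_ext (fun x => cos (mu * x + 0))); [intros; f_equal; ring|apply cont_cos].
  + intros x _; apply cos_lower.
Qed.

(** Averaging over a cell of length [h] turns the term at the node into an integral; the
    cost is the factor [RInt cos], at least [h / 3], and the oscillation [om] of [F]. *)
Lemma exp_sum_cell F mu h om t w : contC F -> 0 <= h ->
  (forall x, Rabs x <= h / 2 -> shift_close F om x) -> Cmod w <= 1 ->
  RInt (fun x => cos (mu * x)) (- (h / 2)) (h / 2) * dot (F t) (w * cis (mu * t))%C <=
  RInt (fun s => dot (F s) (w * cis (mu * s))%C) (t - h / 2) (t - h / 2 + h) + h * om.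
Proof.
intros CF Hh Hom Hw.
set (b := (w * cis (mu * t))%C).
assert (Ccos : cont (fun x => cos (mu * x)))
  by (apply (cont_ext (fun x => cos (mu * x + 0))); [intros; f_equal; ring|apply cont_cos]).
assert (Csin : cont (fun x => sin (mu * x)))
  by (apply (cont_ext (fun x => sin (mu * x + 0))); [intros; f_equal; ring|apply cont_sin]).
assert (H1 : RInt (fun x => dot (F t) (b * cis (mu * x))%C) (- (h / 2)) (h / 2) =
  RInt (fun x => cos (mu * x)) (- (h / 2)) (h / 2) * dot (F t) b).
{ rewrite (RInt_ext _ (fun x => dot (F t) b * cos (mu * x) +
    dot (F t) (b * Ci)%C * sin (mu * x))) by (intros; cring).
  rewrite RInt_plus_cont, !RInt_scal_cont; auto with cont.
  rewrite (RInt_odd (fun x => sin (mu * x))); auto; [in_R; ring|].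
  intros x; rewrite <- sin_neg; f_equal; ring. }
rewrite <- H1.
replace (t - h / 2) with (- (h / 2) + t) by ring.
replace (- (h / 2) + t + h) with (h / 2 + t) by field.
rewrite <- RInt_shift; auto with cont.
replace (h * om) with ((h / 2 - - (h / 2)) * om) by field.
rewrite <- RInt_const_R, <- RInt_plus_cont; auto with cont.
2:{ apply (cont_shift (fun s => dot (F s) (w * cis (mu * s))%C)); auto with cont. }
apply RInt_le_cont; try lra.
- apply (cont_dot_wave (fun _ => F t)); auto with cont.
- apply cont_plus; auto with cont.
  apply (cont_shift (fun s => dot (F s) (w * cis (mu * s))%C)); auto with cont.
- intros x Hx.
  replace (w * cis (mu * (x + t)))%C with (b * cis (mu * x))%C
    by (unfold b; rewrite <- Cmult_assoc, <- cis_plus; do 2 f_equal; ring).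
  set (v := (b * cis (mu * x))%C).
  assert (Hv : Cmod v <= 1) by (unfold v, b; rewrite !Cmod_mult, !Cmod_cis; lra).
  assert (Hx' : Rabs x <= h / 2) by (apply Rabs_le; lra).
  generalize (dot_bound _ v _ _ (Hom x Hx' t) Hv); rewrite dot_minus_l.
  rewrite (Rplus_comm x t); intros Hb; apply Rabs_le_between in Hb; lra.
Qed.

(** The cells around the nodes [t + j h] tile one long interval, so that the integrals from
    [exp_sum_cell] add up to a single average against an exponential. *)
Lemma exp_sum_le F mu h om t w Y N : contC F -> 0 < h -> 0 <= om -> 0 <= Y ->
  Rabs (mu * h) <= PI ->
  (forall x, Rabs x <= h / 2 -> shift_close F om x) -> Cmod w <= 1 ->
  (forall t w, Cmod w <= 1 ->
    RInt (fun s => dot (F s) (w * cis (mu * s))%C) t (t + INR N * h) <= Y) ->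
  rsum N (fun j => dot (F (t + INR j * h)) (w * cis (mu * h * INR j))%C) <=
    3 * (Y / h + INR N * om).
Proof.
intros CF Hh Hom0 HY Hmu Hom Hw HI.
set (w' := (w * cis (- (mu * t)))%C).
assert (Hw' : Cmod w' <= 1) by (unfold w'; rewrite Cmod_mult, Cmod_cis; lra).
set (c := RInt (fun x => cos (mu * x)) (- (h / 2)) (h / 2)).
assert (Hc : h / 3 <= c) by (apply RInt_cos_lower; lra).
set (X := fun n => rsum n (fun j => dot (F (t + INR j * h)) (w * cis (mu * h * INR j))%C)).
assert (Hind : forall n, c * X n <=
  RInt (fun s => dot (F s) (w' * cis (mu * s))%C) (t - h / 2) (t - h / 2 + INR n * h)
  + INR n * h * om).
{ induction n as [|n IH].
  - simpl INR; rewrite !Rmult_0_l, !Rplus_0_r, RInt_point; unfold X, zero; simpl; lra.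
  - unfold X; simpl rsum; fold (X n); rewrite S_INR.
    rewrite <- (RInt_Chasles_cont _ (t - h / 2) (t - h / 2 + INR n * h));
      [|auto with cont].
    generalize (exp_sum_cell F mu h om (t + INR n * h) w' CF (Rlt_le _ _ Hh) Hom Hw').
    fold c.
    replace (w' * cis (mu * (t + INR n * h)))%C with (w * cis (mu * h * INR n))%C
      by (unfold w'; rewrite <- Cmult_assoc, <- cis_plus; do 2 f_equal; ring).
    replace (t + INR n * h - h / 2) with (t - h / 2 + INR n * h) by ring.
    replace (t - h / 2 + INR n * h + h) with (t - h / 2 + (INR n + 1) * h) by ring.
    lra. }
specialize (Hind N); specialize (HI (t - h / 2) w' Hw').
fold (X N).
assert (HN := pos_INR N).
assert (H1 : c * X N <= Y + INR N * h * om) by lra.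
assert (H0 : 0 <= Y / h) by (apply Rdiv_le_0_compat; lra).
assert (H2 : 0 <= INR N * om) by nra.
destruct (Rle_dec (X N) 0) as [Hx|Hx]; [lra|].
assert (H3 : h / 3 * X N <= h * (Y / h + INR N * om)).
{ replace (h * (Y / h + INR N * om)) with (Y + INR N * h * om) by (field; lra). nra. }
apply Rmult_le_reg_l with (h / 3); lra.
Qed.

(** * Discrete Fourier analysis *)

Lemma rsum_shift1 n f : rsum n (fun k => f (S k)) = rsum (S n) f - f O.
Proof. induction n as [|n IH]; simpl in *; [ring|rewrite IH; ring]. Qed.

Lemma rsum_rev n f : rsum n (fun k => f (n - S k)%nat) = rsum n f.
Proof.
induction n as [|n IH]; auto.
transitivity (f n + rsum n f); [|simpl; ring].
rewrite <- IH.
generalize (rsum_shift1 n (fun k => f (S n - S k)%nat)); simpl.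
rewrite Nat.sub_0_r; lra.
Qed.

(** Fejer's rearrangement of a Toeplitz sum by the value of the difference. *)
Lemma toeplitz_sum n (g : nat -> R) (G : nat -> nat -> R) :
  (forall j k, (k <= j)%nat -> G j k = g (j - k)%nat) ->
  (forall j k, G j k = G k j) ->
  rsum n (fun j => rsum n (fun k => G j k)) =
  2 * rsum n (fun m => (INR n - INR m) * g m) - INR n * g O.
Proof.
intros Hg Hsym; induction n as [|n IH]; [simpl; ring|].
transitivity (rsum n (fun j => rsum n (fun k => G j k)) + 2 * rsum n (fun k => G n k) + G n n).
{ simpl; rewrite rsum_plus, (rsum_ext n (fun j => G j n) (fun k => G n k)); auto; ring. }
rewrite IH, (Hg n n), Nat.sub_diag; auto.
rewrite (rsum_ext n (fun k => G n k) (fun k => g (S (n - S k))%nat)).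
2:{ intros k Hk; rewrite Hg by lia; f_equal; lia. }
rewrite (rsum_rev n (fun k => g (S k))), rsum_shift1.
cbn [rsum]; rewrite S_INR.
rewrite (rsum_ext n (fun m => (INR n + 1 - INR m) * g m)
  (fun m => (INR n - INR m) * g m + g m)) by (intros; ring).
rewrite rsum_plus; ring.
Qed.

(** On this grid of [M] points cosines of distinct frequencies are exactly orthogonal as long
    as the sum of the frequencies is less than [M]. *)
Definition node (M q : nat) : R := 2 * PI * INR q / INR M.

Lemma sum_cos_node M m : (0 < m < M)%nat ->
  rsum M (fun q => cos (INR m * node M q)) = 0.
Proof.
intros Hm.
assert (HM : 0 < INR M) by (apply lt_0_INR; lia).
assert (Hm0 : 0 < INR m) by (apply lt_0_INR; lia).
assert (HmM : INR m < INR M) by (apply lt_INR; lia).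
set (x := 2 * PI * INR m / INR M).
rewrite (rsum_ext M _ (fun q => cos (INR q * x)))
  by (intros; f_equal; unfold node, x; field; lra).
assert (HPI := PI_RGT_0).
assert (Hx : 0 < x / 2 < PI).
{ replace (x / 2) with (PI * (INR m / INR M)) by (unfold x; field; lra).
  assert (0 < INR m / INR M) by (apply Rdiv_lt_0_compat; lra).
  assert (INR m / INR M < 1) by (apply Rlt_div_l; lra). nra. }
assert (Hs : 0 < sin (x / 2)) by (apply sin_gt_0; lra).
assert (Htel : forall n, 2 * sin (x / 2) * rsum n (fun q => cos (INR q * x)) =
  sin (INR n * x - x / 2) + sin (x / 2)).
{ induction n as [|n IH].
  - simpl; replace (0 * x - x / 2) with (- (x / 2)) by ring; rewrite sin_neg; ring.
  - simpl rsum; rewrite Rmult_plus_distr_l, IH, S_INR.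
    replace ((INR n + 1) * x - x / 2) with (INR n * x + x / 2) by field.
    rewrite sin_plus, sin_minus; ring. }
specialize (Htel M).
replace (INR M * x - x / 2) with (- (x / 2) + 2 * INR m * PI) in Htel
  by (unfold x; field; lra).
rewrite sin_period, sin_neg in Htel.
nra.
Qed.

Lemma cos_mul_cos a b : cos a * cos b = (cos (a + b) + cos (a - b)) / 2.
Proof. rewrite cos_plus, cos_minus; field. Qed.

Lemma sum_cos_cos_node M m n : (m < n)%nat -> (m + n < M)%nat ->
  rsum M (fun q => cos (INR m * node M q) * cos (INR n * node M q)) = 0.
Proof.
intros H1 H2.
rewrite (rsum_ext M _ (fun q => / 2 * (cos (INR (n + m) * node M q) +
  cos (INR (n - m) * node M q)))).
- rewrite rsum_scal, rsum_plus, !sum_cos_node; try lia; ring.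
- intros q _; rewrite Rmult_comm, cos_mul_cos, plus_INR, minus_INR by lia.
  rewrite <- Rmult_plus_distr_r, <- Rmult_minus_distr_r; field.
Qed.

Lemma sum_cos_sq_node M n : (2 * n < M)%nat ->
  INR M / 2 <= rsum M (fun q => cos (INR n * node M q) * cos (INR n * node M q)).
Proof.
intros H.
assert (HM : 0 < INR M) by (apply lt_0_INR; lia).
destruct (Nat.eq_dec n 0) as [->|Hn].
- rewrite (rsum_ext M _ (fun _ => 1)); [rewrite rsum_const; lra|].
  intros q _; simpl; rewrite Rmult_0_l, cos_0; ring.
- rewrite (rsum_ext M _ (fun q => / 2 * (cos (INR (n + n) * node M q) + 1))).
  + rewrite rsum_scal, rsum_plus, rsum_const, sum_cos_node by lia; lra.
  + intros q _; rewrite cos_mul_cos, plus_INR, Rminus_diag, cos_0.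
    rewrite <- Rmult_plus_distr_r; field.
Qed.

Definition cos_poly (N : nat) (b : nat -> R) (th : R) : R :=
  rsum N (fun m => b m * cos (INR m * th)).

Lemma cos_poly_sum M N b : (0 < N <= M)%nat ->
  rsum M (fun q => cos_poly N b (node M q)) = INR M * b O.
Proof.
intros [H1 H2]; unfold cos_poly; rewrite rsum_swap.
destruct N as [|N]; [lia|].
generalize (rsum_shift1 N (fun m => rsum M (fun q => b m * cos (INR m * node M q)))).
rewrite (rsum_0 N).
- intros H; assert (H3 : rsum M (fun q => b O * cos (INR 0 * node M q)) = INR M * b O).
  { rewrite <- rsum_const; apply rsum_ext; intros q _.
    simpl; rewrite Rmult_0_l, cos_0; ring. }
  lra.
- intros k Hk; rewrite rsum_scal, sum_cos_node by lia; ring.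
Qed.

Lemma cos_poly_sum_sq M N b : (2 * N <= M)%nat ->
  INR M / 2 * rsum N (fun m => b m * b m) <=
  rsum M (fun q => cos_poly N b (node M q) * cos_poly N b (node M q)).
Proof.
induction N as [|N IH]; intros H.
- simpl; rewrite Rmult_0_r; apply rsum_ge0; intros; apply Rle_0_sqr.
- specialize (IH ltac:(lia)).
  rewrite (rsum_ext M _ (fun q => cos_poly N b (node M q) * cos_poly N b (node M q) +
    (2 * b N * (cos_poly N b (node M q) * cos (INR N * node M q)) +
     b N * b N * (cos (INR N * node M q) * cos (INR N * node M q)))))
    by (intros; unfold cos_poly; simpl; ring).
  rewrite !rsum_plus, !rsum_scal.
  assert (Hcross : rsum M (fun q => cos_poly N b (node M q) * cos (INR N * node M q)) = 0).
  { unfold cos_poly.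
    rewrite (rsum_ext M _ (fun q => rsum N (fun m =>
      b m * (cos (INR m * node M q) * cos (INR N * node M q))))).
    - rewrite rsum_swap; apply rsum_0; intros m Hm.
      rewrite rsum_scal, sum_cos_cos_node by lia; ring.
    - intros q _; rewrite Rmult_comm, <- rsum_scal; apply rsum_ext; intros; ring. }
  rewrite Hcross; cbn [rsum].
  generalize (Rmult_le_compat_l _ _ _ (Rle_0_sqr (b N)) (sum_cos_sq_node M N ltac:(lia))).
  unfold Rsqr; lra.
Qed.

Lemma cos_period_nat m x : cos (INR m * (x - 2 * PI)) = cos (INR m * x).
Proof.
rewrite <- (cos_period (INR m * (x - 2 * PI)) m); f_equal; ring.
Qed.

(** * Autocorrelations detect large Fourier coefficients *)

Lemma nsq_csum n (f : nat -> C) :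
  nsq (csum n f) = rsum n (fun j => rsum n (fun k => dot (f j) (f k))).
Proof.
unfold nsq; rewrite dot_csum_l; apply rsum_ext; intros j _.
rewrite dot_sym, dot_csum_l; apply rsum_ext; intros; apply dot_sym.
Qed.

(** The cosine coefficients of the sum over [j, k < N] of [p |j - k| cos ((j - k) th)]. *)
Definition fejer_coef (N : nat) (p : nat -> R) (m : nat) : R :=
  match m with O => INR N * p O | S _ => 2 * ((INR N - INR m) * p m) end.

Lemma fejer_sum N p th : (0 < N)%nat ->
  cos_poly N (fejer_coef N p) th =
  2 * rsum N (fun m => (INR N - INR m) * (p m * cos (INR m * th))) - INR N * p O.
Proof.
intros HN; unfold cos_poly; destruct N as [|N]; [lia|].
generalize (rsum_shift1 N (fun m => fejer_coef (S N) p m * cos (INR m * th))).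
generalize (rsum_shift1 N (fun m => (INR (S N) - INR m) * (p m * cos (INR m * th)))).
rewrite (rsum_ext N (fun k => fejer_coef (S N) p (S k) * cos (INR (S k) * th))
  (fun k => 2 * ((INR (S N) - INR (S k)) * (p (S k) * cos (INR (S k) * th)))))
  by (intros; unfold fejer_coef; ring).
rewrite rsum_scal.
replace (INR 0 * th) with 0 by (simpl; ring); rewrite cos_0.
change (fejer_coef (S N) p 0) with (INR (S N) * p O).
change (INR 0) with 0; lra.
Qed.

(** When the squares are expanded, the products of cosines and of sines combine to
    [cos ((j - k) th)] and multiply [dot (F (t + j h)) (F (t + k h))], whose mean
    [rho ((j - k) h)] depends on the difference [j - k] only. *)
Lemma fejer_mean F B rho h N th : (0 < N)%nat -> contC F ->
  (forall t, Cmod (F t) <= B) -> autocorr F rho ->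
  mean (fun t =>
    nsq (csum N (fun j => RtoC (cos (INR j * th)) * F (t + INR j * h)%R)%C) +
    nsq (csum N (fun j => RtoC (sin (INR j * th)) * F (t + INR j * h)%R)%C))
    (cos_poly N (fejer_coef N (fun m => rho (INR m * h))) th).
Proof.
intros HN CF HB Hr.
rewrite fejer_sum; auto.
set (g := fun m => rho (INR m * h) * cos (INR m * th)).
set (G := fun j k : nat => cos (INR j * th - INR k * th) * rho (INR j * h - INR k * h)).
match goal with |- mean ?u _ =>
  change (mean u (2 * rsum N (fun m => (INR N - INR m) * g m) - INR N * rho (INR 0 * h)))
end.
replace (rho (INR 0 * h)) with (g O)
  by (unfold g; simpl; rewrite !Rmult_0_l, cos_0; ring).
rewrite <- (toeplitz_sum N g G).
2:{ intros j k Hjk; unfold G, g; rewrite minus_INR by lia.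
    rewrite !Rmult_minus_distr_r; ring. }
2:{ intros j k; unfold G; f_equal.
    - rewrite <- cos_neg; f_equal; ring.
    - rewrite <- (autocorr_even F B rho); auto; f_equal; ring. }
apply (mean_ext (fun t => rsum N (fun j => rsum N (fun k =>
  cos (INR j * th - INR k * th) * dot (F (t + INR j * h)) (F (t + INR k * h)))))).
- intros t; rewrite !nsq_csum, <- rsum_plus; apply rsum_ext; intros j _.
  rewrite <- rsum_plus; apply rsum_ext; intros k _.
  rewrite !dot_scal_l, !dot_scal_r, cos_minus; ring.
- apply (mean_rsum N (fun j t => rsum N (fun k =>
    cos (INR j * th - INR k * th) * dot (F (t + INR j * h)) (F (t + INR k * h))))).
  + intros j _; apply cont_rsum; intros k _; auto with cont.
  + intros j _.
    apply (mean_rsum N (fun k t =>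
      cos (INR j * th - INR k * th) * dot (F (t + INR j * h)) (F (t + INR k * h)))).
    * intros k _; auto with cont.
    * intros k _; apply mean_scal; auto with cont.
      now apply (autocorr_shift F B).
Qed.

(** A number [x] with [|x| <= d] is a difference of two almost periods taken from the same
    interval of length [d]. *)
Lemma shift_close_small F l d e : rdense l d (shift_close F e) ->
  forall x, Rabs x <= d -> shift_close F (2 * e) x.
Proof.
intros HZ x Hx t; apply Rabs_le_between in Hx.
destruct (HZ 0) as [y [_ Hy]].
assert (H : exists z1 z2, z2 - z1 = x /\ shift_close F e z1 /\ shift_close F e z2).
{ destruct (Rle_dec 0 x).
  - exists y, (y + x); repeat split; [ring|apply Hy; lra|apply Hy; lra].
  - exists (y - x), y; repeat split; [ring|apply Hy; lra|apply Hy; lra]. }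
destruct H as [z1 [z2 [<- [H1 H2]]]].
replace (F (t + (z2 - z1))%R - F t)%C with
  ((F (t - z1 + z2)%R - F (t - z1)%R) - (F (t - z1 + z1)%R - F (t - z1)%R))%C.
- apply Rle_trans with (1 := Cmod_minus_le _ _).
  generalize (H1 (t - z1)) (H2 (t - z1)); lra.
- replace (t - z1 + z2) with (t + (z2 - z1)) by ring.
  replace (t - z1 + z1) with t by ring; ring.
Qed.

(** The two sums in [fejer_mean] are combinations of the exponential sums at [th] and
    [- th], and [exp_sum_le] bounds these pointwise in [t]. *)
Lemma fejer_upper F rho k eta om h : almost_periodic F -> autocorr F rho -> 0 <= k ->
  (forall mu, exists c, fcoef F mu c /\ nsq c <= k * k) -> 0 < eta -> 0 <= om -> 0 < h ->
  (forall x, Rabs x <= h / 2 -> shift_close F om x) ->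
  exists N0, forall N th, (N0 <= N)%nat -> (0 < N)%nat -> Rabs th <= PI ->
    cos_poly N (fejer_coef N (fun m => rho (INR m * h))) th <=
      2 * ((3 * INR N * (k + eta + om)) * (3 * INR N * (k + eta + om))).
Proof.
intros HF Hr Hk Hc Heta Hom0 Hh Hom.
destruct (fourier_average_uniform F k eta (PI / h) HF Hk Hc Heta) as [T0 [HT0 HT]].
destruct HF as [CF [[B [HB0 HB]] _]].
destruct (nfloor_ex (T0 / h)) as [n Hn]; [apply Rdiv_le_0_compat; lra|].
exists (S n); intros N th HN HN0 Hth.
assert (HNh : T0 <= INR N * h).
{ apply le_INR in HN; rewrite S_INR in HN.
  replace T0 with (T0 / h * h) by (field; lra); apply Rmult_le_compat_r; lra. }
assert (HN1 : 0 < INR N) by (apply lt_0_INR; lia).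
set (K := 3 * INR N * (k + eta + om)).
assert (HK : 0 <= K) by (unfold K; apply Rmult_le_pos; lra).
assert (Hsum : forall s t w, (s = 1 \/ s = -1) -> Cmod w <= 1 ->
  rsum N (fun j => dot (F (t + INR j * h)) (w * cis (s * (INR j * th)))%C) <= K).
{ intros s t w Hs Hw.
  assert (Hmuh : s * th / h * h = s * th) by (field; lra).
  assert (Hmu : Rabs (s * th / h * h) <= PI).
  { rewrite Hmuh, Rabs_mult; destruct Hs; subst s;
      [rewrite Rabs_R1|rewrite Rabs_left by lra]; lra. }
  assert (Hmu' : - (PI / h) <= s * th / h <= PI / h).
  { rewrite Rabs_mult, (Rabs_pos_eq h) in Hmu by lra.
    apply Rabs_le_between; apply Rle_div_r; lra. }
  rewrite (rsum_ext N _ (fun j => dot (F (t + INR j * h))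
    (w * cis (s * th / h * h * INR j))%C))
    by (intros; rewrite Hmuh; do 3 f_equal; ring).
  apply Rle_trans with (3 * ((k + eta) * (INR N * h) / h + INR N * om)).
  - apply exp_sum_le; auto.
    apply Rmult_le_pos; [lra|]; apply Rmult_le_pos; lra.
  - unfold K; right; field; lra. }
assert (Hcos : forall t,
  nsq (csum N (fun j => RtoC (cos (INR j * th)) * F (t + INR j * h)%R)%C) <= K * K).
{ intros t; apply nsq_dual; auto; intros w Hw; rewrite dot_csum_l.
  rewrite (rsum_ext N _ (fun j => / 2 * (
    dot (F (t + INR j * h)) (w * cis (1 * (INR j * th)))%C +
    dot (F (t + INR j * h)) (w * cis (-1 * (INR j * th)))%C))).
  - rewrite rsum_scal, rsum_plus.
    generalize (Hsum 1 t w (or_introl eq_refl) Hw) (Hsum (-1) t w (or_intror eq_refl) Hw).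
    lra.
  - intros j _; replace (-1 * (INR j * th)) with (- (1 * (INR j * th))) by ring.
    rewrite Rmult_1_l, dot_scal_l; unfold cis; rewrite cos_neg, sin_neg.
    unfold dot, Re, Im; simpl; field. }
assert (Hsin : forall t,
  nsq (csum N (fun j => RtoC (sin (INR j * th)) * F (t + INR j * h)%R)%C) <= K * K).
{ intros t; apply nsq_dual; auto; intros w Hw; rewrite dot_csum_l.
  rewrite (rsum_ext N _ (fun j => / 2 * (
    dot (F (t + INR j * h)) (- (Ci * w) * cis (1 * (INR j * th)))%C +
    dot (F (t + INR j * h)) (Ci * w * cis (-1 * (INR j * th)))%C))).
  - rewrite rsum_scal, rsum_plus.
    assert (Hw1 : Cmod (Ci * w)%C <= 1) by (rewrite Cmod_mult, Cmod_Ci; lra).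
    assert (Hw2 : Cmod (- (Ci * w))%C <= 1) by (rewrite Cmod_opp; auto).
    generalize (Hsum 1 t _ (or_introl eq_refl) Hw2) (Hsum (-1) t _ (or_intror eq_refl) Hw1).
    lra.
  - intros j _; replace (-1 * (INR j * th)) with (- (1 * (INR j * th))) by ring.
    rewrite Rmult_1_l, dot_scal_l; unfold cis; rewrite cos_neg, sin_neg.
    unfold dot, Re, Im; simpl; field. }
assert (Cw : forall a : nat -> R, contC (fun t => csum N (fun j =>
  RtoC (a j) * F (t + INR j * h)%R)%C)).
{ intros a; apply (contC_csum N (fun j t => RtoC (a j) * F (t + INR j * h)%R)%C).
  intros j _; apply (contC_mult (fun _ => RtoC (a j))); auto with cont. }
apply (mean_le (fun t =>
    nsq (csum N (fun j => RtoC (cos (INR j * th)) * F (t + INR j * h)%R)%C) +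
    nsq (csum N (fun j => RtoC (sin (INR j * th)) * F (t + INR j * h)%R)%C))
  (fun _ => 2 * (K * K))); auto using mean_const with cont.
- now apply (fejer_mean F B).
- intros t; generalize (Hcos t) (Hsin t); lra.
Qed.

Lemma fejer_ge0 F B rho h N th : (0 < N)%nat -> contC F ->
  (forall t, Cmod (F t) <= B) -> autocorr F rho ->
  0 <= cos_poly N (fejer_coef N (fun m => rho (INR m * h))) th.
Proof.
intros HN CF HB Hr.
apply (mean_ge0 _ _) with (2 := fejer_mean F B rho h N th HN CF HB Hr).
- assert (Cw : forall a : nat -> R, contC (fun t => csum N (fun j =>
    RtoC (a j) * F (t + INR j * h)%R)%C)).
  { intros a; apply (contC_csum N (fun j t => RtoC (a j) * F (t + INR j * h)%R)%C).
    intros j _; apply (contC_mult (fun _ => RtoC (a j))); auto with cont. }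
  apply cont_plus; apply cont_nsq.
  + apply (Cw (fun j => cos (INR j * th))).
  + apply (Cw (fun j => sin (INR j * th))).
- intros t; apply Rplus_le_le_0_compat; apply nsq_ge0.
Qed.

Lemma rsum_window n r K f c : (r + K <= n)%nat -> (forall i, 0 <= f i) ->
  (forall i, (r <= i < r + K)%nat -> c <= f i) -> INR K * c <= rsum n f.
Proof.
intros H H0 Hc.
replace n with (r + (K + (n - r - K)))%nat by lia.
rewrite !rsum_add.
assert (H1 : INR K * c <= rsum K (fun k => f (r + k)%nat)).
{ rewrite <- rsum_const; apply rsum_le; intros k Hk; apply Hc; lia. }
assert (H2 : 0 <= rsum r f) by (apply rsum_ge0; auto).
assert (H3 : 0 <= rsum (n - r - K) (fun k => f (r + (K + k))%nat))
  by (apply rsum_ge0; auto).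
lra.
Qed.

Lemma rsum_blocks Q J f c : (forall a, c <= rsum J (fun i => f (a + i)%nat)) ->
  INR Q * c <= rsum (Q * J) f.
Proof.
intros H; induction Q as [|Q IH]; [simpl; lra|].
replace (S Q * J)%nat with (Q * J + J)%nat by lia.
rewrite rsum_add, S_INR; generalize (H (Q * J)%nat); lra.
Qed.

(** The progression of step [h] has [K] consecutive terms in an interval of length
    [d = K h]. The resulting density [1 / (q + 1)] is independent of the step. *)
Lemma rdense_progression l d h (K q : nat) (Z : R -> Prop) : 0 < h -> d = INR K * h ->
  l <= INR q * d -> rdense l d Z ->
  forall a, exists r, (r + K <= (q + 1) * K)%nat /\
    forall i, (r <= i < r + K)%nat -> Z (INR (a + i) * h).
Proof.
intros Hh Hd Hl HZ a.
destruct (HZ (INR a * h)) as [y [Hy Hyz]].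
assert (Ha := pos_INR a).
assert (Hy0 : 0 <= y) by nra.
assert (Hm : exists m : nat, y <= INR m * h < y + h).
{ destruct (nfloor_ex (y / h)) as [n Hn]; [apply Rdiv_le_0_compat; lra|].
  assert (Hyh : y = y / h * h) by (field; lra).
  destruct (Rle_lt_dec (y / h) (INR n)).
  - exists n; split; [rewrite Hyh; apply Rmult_le_compat_r; lra|].
    apply Rle_lt_trans with (y / h * h); [apply Rmult_le_compat_r; lra|lra].
  - exists (S n); rewrite S_INR; split; nra. }
destruct Hm as [m Hm].
assert (Ham : (a <= m)%nat).
{ apply INR_le; apply Rmult_le_reg_r with h; lra. }
assert (Hmq : (m < a + q * K + 1)%nat).
{ apply INR_lt; rewrite !plus_INR, mult_INR; apply Rmult_lt_reg_r with h; auto.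
  simpl; subst d; nra. }
exists (m - a)%nat; split; [lia|].
intros i Hi; apply Hyz.
assert (H1 : INR m <= INR (a + i)) by (apply le_INR; lia).
assert (H2 : INR (a + i) + 1 <= INR m + INR K).
{ rewrite <- S_INR, <- plus_INR; apply le_INR; lia. }
subst d; split; nra.
Qed.

(** On average over the circle the Fejer sum [S] of length [N] is [N rho(0)], while the
    average of its square is at least of the order of [N ^ 3 rho(0) ^ 2], because
    [rho] is large at a positive proportion of the sampling points; hence [S] is somewhere
    at least of the order of [N ^ 2 rho(0)]. But [S / N ^ 2] is asymptotically bounded by a
    multiple of the square of the largest Fourier coefficient. With [N = 2 W] the upper bound for [S] is [72 (W k) ^ 2], and the
    ratio of averages is at least [W ^ 2 rho(0) / (16 (q + 1))]; [1152 = 16 * 72]. *)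
Lemma autocorr_le_coef F rho k l d (q : nat) : almost_periodic F -> autocorr F rho ->
  0 <= k -> (forall mu, exists c, fcoef F mu c /\ nsq c <= k * k) ->
  0 < d -> l <= INR q * d -> rdense l d (fun x => rho 0 / 2 <= rho x) ->
  rho 0 <= 1152 * (INR q + 1) * (k * k).
Proof.
intros HF Hr Hk Hc Hd Hl HZ.
assert (HFF := HF); destruct HFF as [CF [[B [HB0 HB]] HFZ]].
assert (Hq := pos_INR q).
assert (Hr0 := autocorr_0_ge0 F rho CF Hr).
assert (Heta : forall eta, 0 < eta ->
  rho 0 <= 1152 * (INR q + 1) * ((k + eta) * (k + eta))).
{ intros eta Heta.
  destruct (HFZ (eta / 4)) as [l' [d' [Hl' [Hd' HZ']]]]; [lra|].
  destruct (nfloor_ex (d / d')) as [n Hn]; [apply Rdiv_le_0_compat; lra|].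
  set (K := S n).
  assert (HK : 0 < INR K) by (apply lt_0_INR; unfold K; lia).
  set (h := d / INR K).
  assert (Hh : 0 < h) by (apply Rdiv_lt_0_compat; lra).
  assert (HdK : d = INR K * h) by (unfold h; field; lra).
  assert (Hhd : h <= d').
  { apply Rmult_le_reg_l with (INR K); auto; rewrite <- HdK.
    replace d with (d / d' * d') by (field; lra).
    apply Rmult_le_compat_r; unfold K; rewrite ?S_INR; lra. }
  destruct (fejer_upper F rho k (eta / 2) (eta / 2) h HF Hr Hk Hc ltac:(lra) ltac:(lra)
    Hh) as [N0 HN0].
  { intros x Hx; replace (eta / 2) with (2 * (eta / 4)) by field.
    apply (shift_close_small F l' d'); auto; lra. }
  set (J := ((q + 1) * K)%nat).
  set (Q := S N0).
  set (W := (Q * J)%nat).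
  assert (HJ : (1 <= J)%nat) by (unfold J, K; nia).
  assert (HW : (Q <= W)%nat) by (unfold W; nia).
  set (N := (2 * W)%nat).
  set (M := (2 * N)%nat).
  assert (HNpos : (0 < N)%nat) by (unfold N, Q in *; lia).
  set (p := fun m => rho (INR m * h)).
  set (b := fejer_coef N p).
  set (S2 := 2 * (3 * INR N * (k + eta / 2 + eta / 2) * (3 * INR N * (k + eta / 2 + eta / 2)))).
  assert (Hp0 : p O = rho 0) by (unfold p; simpl; f_equal; ring).
  assert (HM : 0 < INR M) by (apply lt_0_INR; unfold M; lia).
  assert (Hup : forall j, (j < M)%nat -> cos_poly N b (node M j) <= S2).
  { intros j Hj.
    assert (HPI := PI_RGT_0).
    assert (Hnode : 0 <= node M j <= 2 * PI).
    { unfold node; apply lt_INR in Hj; assert (H0 := pos_INR j).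
      replace (2 * PI * INR j / INR M) with (2 * PI * (INR j / INR M)) by (field; lra).
      assert (0 <= INR j / INR M) by (apply Rdiv_le_0_compat; lra).
      assert (INR j / INR M < 1) by (apply Rlt_div_l; lra).
      split; nra. }
    destruct (Rle_dec (node M j) PI).
    - apply HN0; [unfold N, Q in *; lia|auto|apply Rabs_le; lra].
    - replace (cos_poly N b (node M j)) with (cos_poly N b (node M j - 2 * PI)).
      + apply HN0; [unfold N, Q in *; lia|auto|apply Rabs_le; lra].
      + unfold cos_poly; apply rsum_ext; intros m _; now rewrite cos_period_nat. }
  assert (Hsq : rsum M (fun j => cos_poly N b (node M j) * cos_poly N b (node M j)) <=
    S2 * (INR M * (INR N * rho 0))).
  { replace (INR N * rho 0) with (b O) by (unfold b; simpl; now rewrite Hp0).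
    rewrite <- (cos_poly_sum M N b) by (unfold M; lia).
    rewrite <- rsum_scal; apply rsum_le; intros j Hj.
    apply Rmult_le_compat_r; auto.
    now apply (fejer_ge0 F B). }
  assert (Hlow := cos_poly_sum_sq M N b ltac:(unfold M; lia)).
  assert (HWpos : 0 < INR W) by (apply lt_0_INR; unfold Q in *; lia).
  assert (HNW : INR N = 2 * INR W) by (unfold N; rewrite mult_INR; simpl; ring).
  (* only the first half of the coefficients is used: there [N - m >= W] *)
  assert (Hb : INR W * INR W * rsum W (fun m => p m * p m) <= rsum N (fun m => b m * b m)).
  { replace N with (W + W)%nat at 1 by (unfold N; lia); rewrite rsum_add.
    rewrite <- rsum_scal.
    apply Rle_trans with (rsum W (fun m => b m * b m) + 0).
    - rewrite Rplus_0_r; apply rsum_le; intros m Hm.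
      assert (Hm' : INR m <= INR W) by (apply le_INR; lia).
      destruct m as [|m]; unfold b, fejer_coef; rewrite HNW.
      + assert (0 <= p O * p O) by apply Rle_0_sqr; nra.
      + assert (H1 : 0 <= p (S m) * p (S m)) by apply Rle_0_sqr.
        set (x := INR (S m)) in *.
        replace (2 * ((2 * INR W - x) * p (S m)) * (2 * ((2 * INR W - x) * p (S m)))) with
          (4 * ((2 * INR W - x) * (2 * INR W - x)) * (p (S m) * p (S m))) by ring.
        apply Rmult_le_compat_r; auto; nra.
    - apply Rplus_le_compat_l, rsum_ge0; intros; apply Rle_0_sqr. }
  assert (Hdens : INR Q * (INR K * (rho 0 / 2 * (rho 0 / 2))) <= rsum W (fun m => p m * p m)).
  { apply rsum_blocks; intros a.
    destruct (rdense_progression l d h K q _ Hh HdK Hl HZ a) as [r [Hr1 Hr2]].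
    apply (rsum_window J r); auto; [intros; apply Rle_0_sqr|].
    intros i Hi; specialize (Hr2 i Hi); fold (p (a + i)%nat) in Hr2; nra. }
  assert (HWe : INR W = INR Q * ((INR q + 1) * INR K))
    by (unfold W, J; rewrite !mult_INR, plus_INR; simpl; ring).
  assert (HQ : 0 < INR Q) by (apply lt_0_INR; unfold Q; lia).
  set (w := INR W) in *; set (Qr := INR Q) in *; set (Kr := INR K) in *.
  set (R2 := rsum W (fun m => p m * p m)) in *.
  assert (H1 : INR M / 2 * (w * w * R2) <= S2 * (INR M * (INR N * rho 0))).
  { apply Rle_trans with (2 := Hsq); apply Rle_trans with (2 := Hlow).
    apply Rmult_le_compat_l; lra. }
  assert (H2 : w * w * R2 <= 4 * S2 * w * rho 0).
  { apply Rmult_le_reg_l with (INR M / 2); [lra|].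
    apply Rle_trans with (1 := H1); right; rewrite HNW; field. }
  assert (H3 : w * rho 0 * rho 0 <= 4 * (INR q + 1) * R2).
  { rewrite HWe.
    apply Rle_trans with (4 * (INR q + 1) * (Qr * (Kr * (rho 0 / 2 * (rho 0 / 2))))).
    - right; field.
    - apply Rmult_le_compat_l; lra. }
  assert (HS2 : S2 = 72 * (w * w) * ((k + eta) * (k + eta)))
    by (unfold S2; rewrite HNW; field).
  destruct (Req_dec (rho 0) 0) as [H0|H0].
  { rewrite H0; repeat apply Rmult_le_pos; lra. }
  assert (H4 : w * w * (w * rho 0 * rho 0) <=
    4 * (INR q + 1) * (4 * S2 * w * rho 0)).
  { apply Rle_trans with (w * w * (4 * (INR q + 1) * R2)).
    - apply Rmult_le_compat_l; [nra|auto].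
    - replace (w * w * (4 * (INR q + 1) * R2)) with (4 * (INR q + 1) * (w * w * R2)) by ring.
      apply Rmult_le_compat_l; lra. }
  apply Rmult_le_reg_l with (w * w * (w * rho 0)).
  - repeat apply Rmult_lt_0_compat; lra.
  - replace (w * w * (w * rho 0) * rho 0) with (w * w * (w * rho 0 * rho 0)) by ring.
    apply Rle_trans with (1 := H4); rewrite HS2; right; ring. }
apply Rnot_lt_le; intros Hlt.
set (C := 1152 * (INR q + 1)) in *.
assert (HC : 0 < C) by (unfold C; lra).
set (g := rho 0 - C * (k * k)) in *.
(* [eta <= 1] with [C * eta * (2 k + 1) < g] gives the contradiction *)
set (eta := Rmin 1 (g / (2 * C * (2 * k + 1)))).
assert (Hg : 0 < g) by (unfold g; lra).
assert (He0 : 0 < eta).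
{ apply Rmin_pos; [lra|]; apply Rdiv_lt_0_compat; auto; nra. }
assert (He1 : eta <= 1) by apply Rmin_l.
assert (He2 : C * eta * (2 * k + 1) <= g / 2).
{ replace (g / 2) with (C * (g / (2 * C * (2 * k + 1))) * (2 * k + 1)) by (field; lra).
  apply Rmult_le_compat_r; [lra|]; apply Rmult_le_compat_l; [lra|apply Rmin_r]. }
specialize (Heta eta He0).
assert (C * ((k + eta) * (k + eta)) <= C * (k * k) + C * eta * (2 * k + 1)).
{ assert (0 <= C * eta * (1 - eta)) by (repeat apply Rmult_le_pos; lra). nra. }
unfold g in *; lra.
Qed.

(** * Parseval's identity *)

Definition fourier_line (L : exponents) (F : R -> C) (A : nat -> C) : Prop :=
  (forall j, index L j -> fcoef F (expo L j) (A j)) /\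
  (forall mu, (forall j, index L j -> expo L j <> mu) -> fcoef F mu (RtoC 0)).

Lemma le_card_index L n j : le_card L n -> (j < n)%nat -> index L j.
Proof. unfold le_card, index; destruct (card L); auto; lia. Qed.

Lemma le_card_le L n m : le_card L n -> (m <= n)%nat -> le_card L m.
Proof. unfold le_card; destruct (card L); auto; lia. Qed.

Lemma le_card_max L n m : le_card L n -> le_card L m -> le_card L (Nat.max n m).
Proof. unfold le_card; destruct (card L); auto; lia. Qed.

Fixpoint remainder (L : exponents) (F : R -> C) (A : nat -> C) (n : nat) : R -> C :=
  match n with
  | O => F
  | S m => peel (remainder L F A m) (expo L m) (A m)
  end.

Definition partial_sum (L : exponents) (A : nat -> C) (n : nat) (t : R) : C :=
  csum n (fun j => A j * cis (expo L j * t))%C.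

Lemma remainder_eq L F A n t :
  (remainder L F A n t = F t - partial_sum L A n t)%C.
Proof.
unfold partial_sum; induction n as [|n IH]; simpl; [ring|].
unfold peel; rewrite IH; ring.
Qed.

Lemma remainder_spec L F A rho n : almost_periodic F -> autocorr F rho ->
  fourier_line L F A -> le_card L n ->
  almost_periodic (remainder L F A n) /\
  autocorr (remainder L F A n)
    (fun x => rho x - rsum n (fun j => nsq (A j) * cos (expo L j * x))) /\
  (forall mu c, (forall j, (j < n)%nat -> expo L j <> mu) -> fcoef F mu c ->
    fcoef (remainder L F A n) mu c) /\
  (forall j, (j < n)%nat -> fcoef (remainder L F A n) (expo L j) (RtoC 0)).
Proof.
intros HF Hr [HA _]; induction n as [|n IH]; intros Hn.
- simpl; split; [auto|split; [|split; [auto|lia]]].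
  intros x; rewrite Rminus_0_r; apply Hr.
- destruct (IH (le_card_le L (S n) n Hn ltac:(lia))) as [HR [HRr [HRo HR0]]].
  assert (HCR := HR); destruct HCR as [CR [[B [HB0 HB]] _]].
  assert (Hidx : forall j, (j <= n)%nat -> index L j)
    by (intros j Hj; apply (le_card_index L (S n)); auto; lia).
  assert (Hne : forall j, (j < n)%nat -> expo L j <> expo L n).
  { intros j Hj Heq; apply expo_inj in Heq; try lia; apply Hidx; lia. }
  assert (Hn' : fcoef (remainder L F A n) (expo L n) (A n)) by (apply HRo; auto).
  cbn [remainder]; split; [|split; [|split]].
  + now apply almost_periodic_peel.
  + intros x; cbn [rsum].
    replace (rho x - (rsum n (fun j => nsq (A j) * cos (expo L j * x)) +
      nsq (A n) * cos (expo L n * x))) with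
      (rho x - rsum n (fun j => nsq (A j) * cos (expo L j * x)) -
       nsq (A n) * cos (expo L n * x)) by ring.
    apply (autocorr_peel _ B _ _ _ CR HB HRr Hn').
  + intros mu c Hmu Hc; apply fcoef_peel_other; auto.
  + intros j Hj; destruct (Nat.eq_dec j n) as [->|Hjn].
    * now apply fcoef_peel_same.
    * apply fcoef_peel_other; auto; [|apply HR0; lia].
      intros Heq; apply (Hne j ltac:(lia)); auto.
Qed.

Lemma bessel L F A rho n : almost_periodic F -> autocorr F rho ->
  fourier_line L F A -> le_card L n -> rsum n (fun j => nsq (A j)) <= rho 0.
Proof.
intros HF Hr HA Hn.
destruct (remainder_spec L F A rho n HF Hr HA Hn) as [[CR _] [HRr _]].
generalize (autocorr_0_ge0 _ _ CR HRr).
rewrite (rsum_ext n _ (fun j => nsq (A j)));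
  [lra|intros; rewrite Rmult_0_r, cos_0; ring].
Qed.

(** The autocorrelation of the remainder is largest at [0]. *)
Lemma bessel_shift L F A rho n x : almost_periodic F -> autocorr F rho ->
  fourier_line L F A -> le_card L n ->
  rsum n (fun j => nsq (A j) * (1 - cos (expo L j * x))) <= rho 0 - rho x.
Proof.
intros HF Hr HA Hn.
destruct (remainder_spec L F A rho n HF Hr HA Hn) as [[CR [[B [_ HB]] _]] [HRr _]].
generalize (autocorr_le _ B _ x CR HB HRr).
rewrite (rsum_ext n (fun j => nsq (A j) * cos (expo L j * 0)) (fun j => nsq (A j)))
  by (intros; rewrite Rmult_0_r, cos_0; ring).
rewrite (rsum_ext n (fun j => nsq (A j) * (1 - cos (expo L j * x)))
  (fun j => nsq (A j) + (-1) * (nsq (A j) * cos (expo L j * x)))) by (intros; ring).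
rewrite rsum_plus, rsum_scal; lra.
Qed.

Lemma rsum_le_mono n m f : (forall k, 0 <= f k) -> (n <= m)%nat -> rsum n f <= rsum m f.
Proof.
intros Hf Hnm; replace m with (n + (m - n))%nat by lia; rewrite rsum_add.
generalize (rsum_ge0 (m - n) (fun k => f (n + k)%nat) (fun k _ => Hf _)); lra.
Qed.

Lemma summable_tail L (f : nat -> R) S : (forall j, 0 <= f j) ->
  (forall n, le_card L n -> rsum n f <= S) -> forall eps, 0 < eps ->
  exists n, le_card L n /\ forall m, le_card L m -> (n <= m)%nat ->
    rsum m f <= rsum n f + eps.
Proof.
intros Hf HS eps Heps; apply NNPP; intros Hno.
(* otherwise arbitrarily many increments larger than [eps] would fit below [S] *)
assert (Hstep : forall i, exists n, le_card L n /\ INR i * eps <= rsum n f).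
{ induction i as [|i [n [Hn Hi]]].
  - exists O; split; [unfold le_card; destruct (card L); auto; lia|simpl; lra].
  - apply NNPP; intros Hi'; apply Hno; exists n; split; auto.
    intros m Hm Hnm; apply Rnot_lt_le; intros Hlt; apply Hi'.
    exists m; split; auto; rewrite S_INR; lra. }
assert (HS0 : 0 <= S).
{ destruct (Hstep O) as [n [Hn H]]; simpl in H; generalize (HS n Hn); lra. }
destruct (nfloor_ex (S / eps)) as [i Hi]; [apply Rdiv_le_0_compat; lra|].
destruct (Hstep (Datatypes.S i)) as [n [Hn H]].
rewrite S_INR in H; specialize (HS n Hn).
assert (S < (INR i + 1) * eps); [|lra].
replace S with (S / eps * eps) by (field; lra); apply Rmult_lt_compat_r; lra.
Qed.

(** The remainders [F - partial_sum] inherit from [F], uniformly in [n], the set where the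
    autocorrelation stays close to its value at [0], by [bessel_shift]. As their Fourier
    coefficients tend to [0] uniformly, [autocorr_le_coef] forces their mean squares
    to [0]. *)
Lemma parseval L F A rho : almost_periodic F -> autocorr F rho -> fourier_line L F A ->
  forall eps, 0 < eps -> exists n, le_card L n /\
    forall m, le_card L m -> (n <= m)%nat -> rho 0 - rsum m (fun j => nsq (A j)) <= eps.
Proof.
intros HF Hr HA eps Heps; apply NNPP; intros Hno.
assert (Hbig : forall n, le_card L n -> eps < rho 0 - rsum n (fun j => nsq (A j))).
{ intros n Hn; apply Rnot_le_lt; intros H; apply Hno; exists n; split; auto.
  intros m Hm Hnm; apply Rle_trans with (2 := H).
  generalize (rsum_le_mono n m (fun j => nsq (A j)) (fun k => nsq_ge0 _) Hnm); lra. }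
assert (HFF := HF); destruct HFF as [CF [[B [HB0 HB]] HZ]].
set (e := Rmin 1 eps).
assert (He : 0 < e) by (apply Rmin_pos; lra).
assert (He2 : e * e <= eps).
{ assert (e <= 1) by apply Rmin_l; assert (e <= eps) by apply Rmin_r; nra. }
destruct (HZ e He) as [l [d [Hl [Hd Hz]]]].
destruct (nfloor_ex (l / d)) as [q0 Hq0]; [apply Rdiv_le_0_compat; lra|].
set (q := S q0).
assert (Hlq : l <= INR q * d).
{ unfold q; rewrite S_INR; replace l with (l / d * d) by (field; lra).
  apply Rmult_le_compat_r; lra. }
set (Cq := 1152 * (INR q + 1)).
assert (HCq : 0 < Cq) by (unfold Cq; generalize (pos_INR q); lra).
set (del := eps / (2 * Cq)).
assert (Hdel : 0 < del) by (apply Rdiv_lt_0_compat; lra).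
destruct (summable_tail L (fun j => nsq (A j)) (rho 0) (fun j => nsq_ge0 _)
  (fun n Hn => bessel L F A rho n HF Hr HA Hn) del Hdel) as [n [Hn Htail]].
destruct (remainder_spec L F A rho n HF Hr HA Hn) as [HR [HRr [HRo HR0]]].
set (r := fun x => rho x - rsum n (fun j => nsq (A j) * cos (expo L j * x))) in *.
assert (Hr0 : r 0 = rho 0 - rsum n (fun j => nsq (A j))).
{ unfold r; f_equal; apply rsum_ext; intros; rewrite Rmult_0_r, cos_0; ring. }
assert (Hmain : r 0 <= Cq * (sqrt del * sqrt del)).
{ apply (autocorr_le_coef (remainder L F A n) r (sqrt del) l d q); auto.
  - apply sqrt_pos.
  - intros mu; rewrite sqrt_sqrt by lra.
    destruct (classic (exists j, (j < n)%nat /\ expo L j = mu)) as [[j [Hj <-]]|Hmu].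
    + exists (RtoC 0); split; auto; unfold nsq; rewrite dot_0_l; lra.
    + assert (Hmu' : forall j, (j < n)%nat -> expo L j <> mu)
        by (intros j Hj Heq; apply Hmu; exists j; auto).
      destruct (classic (exists j, index L j /\ expo L j = mu)) as [[j [Hj Heq]]|Hmu2].
      * exists (A j); split; [apply HRo; auto; rewrite <- Heq; now apply (proj1 HA)|].
        assert (Hjn : (n <= j)%nat).
        { apply Nat.nlt_ge; intros Hlt; now apply (Hmu' j). }
        assert (HSj : le_card L (S j)) by (revert Hj; unfold le_card, index;
          destruct (card L); auto; lia).
        specialize (Htail (S j) HSj ltac:(lia)); cbn [rsum] in Htail.
        generalize (rsum_le_mono n j (fun j => nsq (A j)) (fun k => nsq_ge0 _) Hjn); lra.
      * exists (RtoC 0); split; [|unfold nsq; rewrite dot_0_l; lra].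
        apply HRo; auto; apply (proj2 HA).
        intros j Hj Heq; apply Hmu2; exists j; auto.
  - apply rdense_mono with (2 := Hz); intros z Hcl.
    generalize (autocorr_shift_close F B rho e z CF HB Hr Hcl); intros H1.
    specialize (Hbig n Hn).
    assert (H2 : r 0 - r z <= rho 0 - rho z); [|lra].
    unfold r.
    assert (H3 : rsum n (fun j => nsq (A j) * cos (expo L j * z)) <=
      rsum n (fun j => nsq (A j) * cos (expo L j * 0))); [|lra].
    apply rsum_le; intros j _; apply Rmult_le_compat_l; [apply nsq_ge0|].
    rewrite Rmult_0_r, cos_0; apply COS_bound. }
rewrite sqrt_sqrt in Hmain by lra.
specialize (Hbig n Hn).
assert (Cq * del = eps / 2) by (unfold del; field; lra).
lra.
Qed.

Lemma contC_partial_sum L A n : contC (partial_sum L A n).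
Proof.
apply (contC_csum n (fun j t => A j * cis (expo L j * t))%C).
intros j _; apply contC_wave.
Qed.

Lemma mean_nsq_partial_sum L A n : le_card L n ->
  mean (fun t => nsq (partial_sum L A n t)) (rsum n (fun j => nsq (A j))).
Proof.
induction n as [|n IH]; intros Hn.
- apply (mean_ext (fun _ => 0)); [|apply mean_const].
  intros t; unfold partial_sum, nsq; simpl; now rewrite dot_0_l.
- apply (mean_ext (fun t => nsq (partial_sum L A n t) +
    (2 * rsum n (fun j => dot (A j * cis (expo L j * t))%C (A n * cis (expo L n * t))%C)
     + nsq (A n)))).
  + intros t; unfold partial_sum; simpl; rewrite nsq_plus, dot_csum_l.
    rewrite nsq_mult, nsq_cis; ring.
  + cbn [rsum].
    replace (rsum n (fun j => nsq (A j)) + nsq (A n)) with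
      (rsum n (fun j => nsq (A j)) + (2 * rsum n (fun _ => 0) + nsq (A n)))
      by (rewrite rsum_const; ring).
    assert (Cr : forall j, cont (fun t =>
      dot (A j * cis (expo L j * t))%C (A n * cis (expo L n * t))%C))
      by (intros j; apply cont_dot; apply contC_wave).
    assert (Cs : cont (fun t => rsum n (fun j =>
      dot (A j * cis (expo L j * t))%C (A n * cis (expo L n * t))%C)))
      by (apply (cont_rsum n (fun j t =>
        dot (A j * cis (expo L j * t))%C (A n * cis (expo L n * t))%C)); auto).
    apply mean_plus.
    * apply cont_nsq, contC_partial_sum.
    * auto with cont.
    * apply IH, (le_card_le L (S n)); auto.
    * apply mean_plus; auto using mean_const with cont.
      apply mean_scal; auto.
      apply (mean_rsum n (fun j t =>
        dot (A j * cis (expo L j * t))%C (A n * cis (expo L n * t))%C)); auto.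
      intros j Hj; apply mean_dot_cis; intros Heq.
      apply expo_inj in Heq; try lia; apply (le_card_index L (S n)); auto; lia.
Qed.

(** * Simultaneous approximation of characters *)

(** Equal frequencies of the list are not merged: the list of a product is then
    given by a formula that does not mention [psi]. *)
Fixpoint wave_sum (psi : R -> R) (l : list (R * R)) (t : R) : C :=
  match l with
  | nil => RtoC 0
  | (c, x) :: l' => (RtoC c * cis (x * t - psi x) + wave_sum psi l' t)%C
  end.

Fixpoint wave_mul1 (c x : R) (l : list (R * R)) : list (R * R) :=
  match l with
  | nil => nil
  | (c', x') :: l' => (c * c', x + x') :: wave_mul1 c x l'
  end.

Fixpoint wave_mul (l1 l2 : list (R * R)) : list (R * R) :=
  match l1 with
  | nil => nil
  | (c, x) :: l => wave_mul1 c x l2 ++ wave_mul l l2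
  end.

Fixpoint wave_pow (l : list (R * R)) (p : nat) : list (R * R) :=
  match p with O => (1, 0) :: nil | S q => wave_mul l (wave_pow l q) end.

Fixpoint energy1 (c x : R) (l : list (R * R)) : R :=
  match l with
  | nil => 0
  | (c', x') :: l' => (if Req_EM_T x x' then c * c' else 0) + energy1 c x l'
  end.

(** [energy l l] is the mean square of [wave_sum psi l], computed from the list alone. *)
Fixpoint energy (l1 l2 : list (R * R)) : R :=
  match l1 with
  | nil => 0
  | (c, x) :: l => energy1 c x l2 + energy l l2
  end.

Lemma cis_affine x t a : cis (x * t - a) = (cis (- a) * cis (x * t))%C.
Proof. rewrite <- cis_plus; f_equal; ring. Qed.

Lemma contC_term psi c x : contC (fun t => RtoC c * cis (x * t - psi x))%C.
Proof.
destruct (contC_wave (RtoC c * cis (- psi x))%C x) as [H1 H2].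
split.
- apply (cont_ext (fun t => Re (RtoC c * cis (- psi x) * cis (x * t))%C)); auto.
  intros t; now rewrite cis_affine, Cmult_assoc.
- apply (cont_ext (fun t => Im (RtoC c * cis (- psi x) * cis (x * t))%C)); auto.
  intros t; now rewrite cis_affine, Cmult_assoc.
Qed.

Lemma contC_wave_sum psi l : contC (wave_sum psi l).
Proof.
induction l as [|[c x] l IH]; simpl; auto with cont.
apply contC_plus; auto using contC_term.
Qed.
#[local] Hint Resolve contC_term contC_wave_sum : cont.

(** The mean square of an exponential sum pairs equal frequencies only, and equal
    frequencies carry equal phases: it does not depend on [psi]. *)
Lemma mean_dot_wave_sum psi l1 l2 :
  mean (fun t => dot (wave_sum psi l1 t) (wave_sum psi l2 t)) (energy l1 l2).
Proof.
assert (H1 : forall c x l, mean (fun t => dot (RtoC c * cis (x * t - psi x))%C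
  (wave_sum psi l t)) (energy1 c x l)).
{ intros c x l; induction l as [|[c' x'] l IH]; simpl.
  - apply (mean_ext (fun _ => 0)); [|apply mean_const].
    intros t; now rewrite dot_sym, dot_0_l.
  - apply (mean_ext (fun t =>
      dot (RtoC c * cis (x * t - psi x))%C (RtoC c' * cis (x' * t - psi x'))%C +
      dot (RtoC c * cis (x * t - psi x))%C (wave_sum psi l t))).
    { intros t; now rewrite dot_plus_r. }
    apply mean_plus; auto with cont.
    destruct (Req_EM_T x x') as [<-|Hne].
    + apply (mean_ext (fun _ => c * c')); [|apply mean_const].
      intros t; rewrite dot_rot; cring.
    + apply (mean_ext (fun t => dot (RtoC c * cis (- psi x) * cis (x * t))%C
        (RtoC c' * cis (- psi x') * cis (x' * t))%C)); [|now apply mean_dot_cis].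
      intros t; now rewrite !cis_affine, !Cmult_assoc. }
induction l1 as [|[c x] l1 IH]; simpl.
- apply (mean_ext (fun _ => 0)); [|apply mean_const].
  intros t; now rewrite dot_0_l.
- apply (mean_ext (fun t => dot (RtoC c * cis (x * t - psi x))%C (wave_sum psi l2 t) +
    dot (wave_sum psi l1 t) (wave_sum psi l2 t))).
  + intros t; now rewrite dot_plus_l.
  + apply mean_plus; auto with cont.
Qed.

Definition additive_on (V : R -> Prop) (psi : R -> R) : Prop :=
  V 0 /\ (forall x y, V x -> V y -> V (x + y)) /\
  (forall x y, V x -> V y -> psi (x + y) = psi x + psi y).

Definition freqs_in (V : R -> Prop) (l : list (R * R)) : Prop :=
  List.Forall (fun cx => V (snd cx)) l.

Lemma wave_sum_app psi l1 l2 t :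
  wave_sum psi (l1 ++ l2) t = (wave_sum psi l1 t + wave_sum psi l2 t)%C.
Proof.
induction l1 as [|[c x] l IH]; simpl; [ring|rewrite IH; ring].
Qed.

Lemma wave_sum_mul1 V psi c x l t : additive_on V psi -> V x -> freqs_in V l ->
  wave_sum psi (wave_mul1 c x l) t = (RtoC c * cis (x * t - psi x) * wave_sum psi l t)%C.
Proof.
intros [_ [_ psi_plus]] Hx; induction l as [|[c' x'] l IH]; intros Hl; simpl; [ring|].
inversion Hl; subst; simpl in *.
rewrite IH, psi_plus; auto.
replace ((x + x') * t - (psi x + psi x')) with ((x * t - psi x) + (x' * t - psi x')) by ring.
rewrite cis_plus, RtoC_mult; ring.
Qed.

Lemma wave_sum_mul V psi l1 l2 t : additive_on V psi -> freqs_in V l1 -> freqs_in V l2 ->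
  wave_sum psi (wave_mul l1 l2) t = (wave_sum psi l1 t * wave_sum psi l2 t)%C.
Proof.
intros HV H1 H2; induction l1 as [|[c x] l IH]; simpl; [ring|].
inversion H1; subst; simpl in *.
rewrite wave_sum_app, (wave_sum_mul1 V), IH; auto; ring.
Qed.

Lemma freqs_in_mul V psi l1 l2 : additive_on V psi -> freqs_in V l1 -> freqs_in V l2 ->
  freqs_in V (wave_mul l1 l2).
Proof.
intros [_ [Vplus _]] H1 H2; induction l1 as [|[c x] l IH]; simpl; [constructor|].
inversion H1; subst; simpl in *.
apply List.Forall_app; split; [|auto].
clear - H2 H3 Vplus; induction l2 as [|[c' x'] l2 IH]; simpl; constructor;
  inversion H2; subst; simpl in *; auto.
apply IH; auto.
Qed.

Lemma freqs_in_pow V psi l p : additive_on V psi -> freqs_in V l ->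
  freqs_in V (wave_pow l p).
Proof.
intros HV Hl; induction p as [|p IH]; simpl.
- constructor; [apply HV|constructor].
- now apply (freqs_in_mul V psi).
Qed.

Lemma additive_on_0 V psi : additive_on V psi -> psi 0 = 0.
Proof. intros [V0 [_ H]]; generalize (H 0 0 V0 V0); rewrite Rplus_0_r; lra. Qed.

Lemma nsq_wave_pow V psi l p t : additive_on V psi -> freqs_in V l ->
  nsq (wave_sum psi (wave_pow l p) t) = nsq (wave_sum psi l t) ^ p.
Proof.
intros HV Hl; induction p as [|p IH]; simpl.
- rewrite (additive_on_0 V psi HV), Rmult_0_l, Rminus_0_r, cis_0; cring.
- rewrite (wave_sum_mul V), nsq_mult, IH; auto; now apply (freqs_in_pow V psi).
Qed.

Lemma mean_wave_pow V psi l p : additive_on V psi -> freqs_in V l ->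
  mean (fun t => nsq (wave_sum psi l t) ^ p) (energy (wave_pow l p) (wave_pow l p)).
Proof.
intros HV Hl; apply (mean_ext (fun t => nsq (wave_sum psi (wave_pow l p) t))).
- intros t; now apply (nsq_wave_pow V).
- apply mean_dot_wave_sum.
Qed.

Lemma cont_pow u p : cont u -> cont (fun t => u t ^ p).
Proof. intros Cu; induction p; simpl; auto with cont. Qed.

Fixpoint weights (w lam : nat -> R) (n : nat) : list (R * R) :=
  match n with O => nil | S k => (w k, lam k) :: weights w lam k end.

Lemma wave_sum_weights psi w lam n t : wave_sum psi (weights w lam n) t =
  csum n (fun j => RtoC (w j) * cis (lam j * t - psi (lam j)))%C.
Proof. induction n as [|n IH]; simpl; auto; rewrite IH; ring. Qed.

Lemma Cmod_csum_le n f : Cmod (csum n f) <= rsum n (fun j => Cmod (f j)).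
Proof.
induction n as [|n IH]; simpl; [rewrite Cmod_0; lra|].
apply Rle_trans with (1 := Cmod_triangle _ _); lra.
Qed.

(** The sum is [W + P] with [|P| <= W] and [Re P = W - D]; so its square modulus is near
    the maximal value [4 W ^ 2] exactly when [D] is small. *)
Lemma nsq_weights (psi : R -> R) w lam n t : (forall j, (j < n)%nat -> 0 <= w j) -> psi 0 = 0 ->
  let W := rsum n w in
  let D := rsum n (fun j => w j * (1 - cos (lam j * t - psi (lam j)))) in
  let u := nsq (wave_sum psi ((W, 0) :: weights w lam n) t) in
  0 <= D <= 2 * W /\ u <= 4 * W * W - 2 * W * D /\ 4 * W * W - 4 * W * D <= u.
Proof.
intros Hw Hpsi W D u.
set (P := csum n (fun j => RtoC (w j) * cis (lam j * t - psi (lam j)))%C).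
assert (HW : 0 <= W) by (apply rsum_ge0; auto).
assert (HP : Cmod P <= W).
{ apply Rle_trans with (1 := Cmod_csum_le _ _); right; apply rsum_ext; intros j Hj.
  rewrite Cmod_mult, Cmod_cis, Cmod_R, Rabs_pos_eq; auto; ring. }
assert (Hu : u = nsq (RtoC W + P)%C).
{ unfold u; cbn [wave_sum]; rewrite wave_sum_weights, Hpsi, Rmult_0_l, Rminus_0_r, cis_0.
  fold P; now rewrite Cmult_1_r. }
assert (HD : dot (RtoC W) P = W * (W - D)).
{ unfold P; rewrite dot_sym, dot_csum_l; unfold D; unfold W at 3.
  replace (rsum n w - rsum n (fun j => w j * (1 - cos (lam j * t - psi (lam j))))) with
    (rsum n (fun j => w j * cos (lam j * t - psi (lam j)))).
  - rewrite <- rsum_scal; apply rsum_ext; intros; cring.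
  - rewrite (rsum_ext n (fun j => w j * (1 - cos (lam j * t - psi (lam j))))
      (fun j => w j + (-1) * (w j * cos (lam j * t - psi (lam j))))) by (intros; ring).
    rewrite rsum_plus, rsum_scal; ring. }
apply nsq_le_Cmod in HP.
assert (HnW : nsq (RtoC W) = W * W) by cring.
assert (HD1 : 0 <= D).
{ apply rsum_ge0; intros j Hj; apply Rmult_le_pos; auto.
  generalize (COS_bound (lam j * t - psi (lam j))); lra. }
assert (HD2 : D <= 2 * W).
{ unfold W; rewrite <- rsum_scal; apply rsum_le; intros j Hj.
  generalize (COS_bound (lam j * t - psi (lam j))) (Hw j Hj); nra. }
assert (HP2 : (W - D) * (W - D) <= nsq P).
{ destruct (Req_dec W 0) as [H0|H0].
  - assert (D = 0) by lra; rewrite H0; generalize (nsq_ge0 P); nra.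
  - assert (H1 : (dot (RtoC W) P) * (dot (RtoC W) P) <= W * W * nsq P).
    { rewrite <- HnW, !nsq_Cmod; generalize (dot_le (RtoC W) P); intros H.
      generalize (Rabs_pos (dot (RtoC W) P)); intros H2.
      replace (dot (RtoC W) P * dot (RtoC W) P) with
        (Rabs (dot (RtoC W) P) * Rabs (dot (RtoC W) P))
        by (rewrite <- Rabs_mult; apply Rabs_pos_eq, Rle_0_sqr).
      apply Rle_trans with ((Cmod (RtoC W) * Cmod P) * (Cmod (RtoC W) * Cmod P)).
      - apply Rmult_le_compat; auto.
      - right; ring. }
    rewrite HD in H1; apply Rmult_le_reg_l with (W * W); nra. }
split; [auto|]; rewrite Hu, nsq_plus, HD, HnW.
split; nra.
Qed.

(** The even moments of [|W + sum_j w_j exp (i (lam_j t - psi (lam_j)))|] do not depend on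
    [psi], and for [psi = 0] this sum is nearly [2 W] on a relatively dense set; high
    moments then show that it is nearly [2 W] somewhere for the given [psi] too. *)
Lemma kronecker L n w psi : (forall j, (j < n)%nat -> 0 <= w j) ->
  Qlinear_on (Vspace L n) psi ->
  (forall e, 0 < e -> exists l d, 0 < l /\ 0 < d /\ rdense l d (fun z =>
    rsum n (fun j => w j * (1 - cos (expo L j * z))) <= e)) ->
  forall e, 0 < e -> exists tau,
    rsum n (fun j => w j * (1 - cos (expo L j * tau - psi (expo L j)))) <= e.
Proof.
intros Hw [Hadd _] Hrec e He; apply NNPP; intros Hno.
set (V := Vspace L n) in *.
assert (V0 : V 0) by apply Qspan_zero.
assert (Vplus : forall x y, V x -> V y -> V (x + y)) by (intros; now apply Qspan_plus).
assert (HV : additive_on V psi) by (split; auto).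
assert (HV0 : additive_on V (fun _ => 0)) by (split; [|split]; auto; intros; ring).
assert (Hpsi0 : psi 0 = 0) by (now apply (additive_on_0 V)).
set (W := rsum n w).
set (l0 := (W, 0) :: weights w (expo L) n).
assert (Hl0 : freqs_in V l0).
{ constructor; auto.
  assert (H : forall m, (m <= n)%nat -> freqs_in V (weights w (expo L) m)); [|now apply H].
  induction m as [|m IH]; intros Hm; simpl; constructor; [|apply IH; lia].
  apply Qspan_gen; exists m; split; auto; lia. }
assert (Hbig : forall t, e < rsum n (fun j => w j * (1 - cos (expo L j * t - psi (expo L j)))))
  by (intros t; apply Rnot_le_lt; intros H; apply Hno; now exists t).
assert (HWe : e < 2 * W).
{ destruct (nsq_weights psi w (expo L) n 0 Hw Hpsi0) as [H _].
  fold W in H; generalize (Hbig 0); lra. }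
set (a := 4 * W * W - 2 * W * e).
set (b := 4 * W * W - W * e).
assert (Ha : 0 < a) by (unfold a; nra).
assert (Hab : a < b) by (unfold a, b; nra).
destruct (Hrec (e / 4)) as [l [d [Hl [Hd Hz]]]]; [lra|].
set (c := d / (2 * (l + d))).
assert (Hc : 0 < c) by (apply Rdiv_lt_0_compat; lra).
assert (Hpow : forall p, c * b ^ p <= a ^ p).
{ intros p.
  assert (Hm1 := mean_wave_pow V psi l0 p HV Hl0).
  assert (Hm0 := mean_wave_pow V (fun _ => 0) l0 p HV0 Hl0).
  set (m := energy (wave_pow l0 p) (wave_pow l0 p)) in *.
  assert (Cp : forall psi, cont (fun t => nsq (wave_sum psi l0 t) ^ p))
    by (intros; apply cont_pow, cont_nsq, contC_wave_sum).
  apply Rle_trans with m.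
  - apply (mean_ge_le (fun t => nsq (wave_sum (fun _ => 0) l0 t) ^ p)
      (fun t => nsq (wave_sum (fun _ => 0) l0 t) ^ p)); auto; [|intros; lra].
    replace (c * b ^ p) with (b ^ p * d / (2 * (l + d))) by (unfold c; field; lra).
    apply rdense_mean_ge with (6 := Hz); auto.
    + intros t; apply pow_le, nsq_ge0.
    + apply pow_lt; lra.
    + intros z Hzz; apply pow_incr; split; [lra|].
      destruct (nsq_weights (fun _ => 0) w (expo L) n z Hw eq_refl) as [_ [_ H]].
      fold W l0 in H; apply Rle_trans with (2 := H).
      rewrite (rsum_ext n _ (fun j => w j * (1 - cos (expo L j * z))))
        by (intros; now rewrite Rminus_0_r).
      unfold b; nra.
  - apply (mean_le (fun t => nsq (wave_sum psi l0 t) ^ p) (fun _ => a ^ p));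
      auto using mean_const with cont.
    intros t; apply pow_incr; split; [apply nsq_ge0|].
    destruct (nsq_weights psi w (expo L) n t Hw Hpsi0) as [_ [H _]].
    fold W l0 in H; apply Rle_trans with (1 := H).
    generalize (Hbig t); unfold a; nra. }
(* the ratio [(b / a) ^ p] grows at least linearly in [p] *)
set (x := b / a - 1).
assert (Hx : 0 < x).
{ unfold x; replace (b / a - 1) with ((b - a) / a) by (field; lra).
  apply Rdiv_lt_0_compat; lra. }
destruct (nfloor_ex (/ (c * x))) as [p0 Hp0].
{ apply Rlt_le, Rinv_0_lt_compat, Rmult_lt_0_compat; auto. }
set (p := S p0).
assert (Hp : 1 < c * (INR p * x)).
{ unfold p; rewrite S_INR.
  replace 1 with (/ (c * x) * (c * x)) at 1 by (field; split; lra).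
  replace (c * ((INR p0 + 1) * x)) with ((INR p0 + 1) * (c * x)) by ring.
  apply Rmult_lt_compat_r; [now apply Rmult_lt_0_compat|lra]. }
specialize (Hpow p).
replace b with (a * (1 + x)) in Hpow by (unfold x; field; lra).
rewrite Rpow_mult_distr in Hpow.
assert (Hap : 0 < a ^ p) by (apply pow_lt; lra).
assert (H1 : c * (1 + x) ^ p <= 1).
{ apply Rmult_le_reg_l with (a ^ p); auto; lra. }
generalize (poly p x Hx); nra.
Qed.

(** * Complex mean values *)

Lemma RInt_pair (G : R -> C) a b : contC G ->
  RInt (V := C_R_CompleteNormedModule) G a b =
  (RInt (fun t => Re (G t)) a b, RInt (fun t => Im (G t)) a b).
Proof.
intros [H1 H2].
apply (@is_RInt_unique C_R_CompleteNormedModule).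
apply (is_RInt_fct_extend_pair (U := R_NormedModule) (V := R_NormedModule) G).
- apply (RInt_correct (fun t => Re (G t))); now apply cont_ex_RInt.
- apply (RInt_correct (fun t => Im (G t))); now apply cont_ex_RInt.
Qed.

Lemma is_mean_value_iff G m : contC G ->
  is_mean_value G m <->
  mean (fun t => Re (G t)) (Re m) /\ mean (fun t => Im (G t)) (Im m).
Proof.
intros CG.
assert (Hcomp : forall (I T x e : R), 0 < T ->
  Rabs (/ (2 * T) * I - x) <= e <-> Rabs (I - 2 * T * x) <= e * (2 * T)).
{ intros I T x e HT.
  replace (/ (2 * T) * I - x) with ((I - 2 * T * x) * / (2 * T)) by (field; lra).
  rewrite Rabs_mult, Rabs_inv, (Rabs_pos_eq (2 * T)) by lra.
  rewrite <- (Rle_div_l (Rabs (I - 2 * T * x)) e (2 * T)) by lra; reflexivity. }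
assert (Hval : forall T, (RtoC (/ (2 * T)) *
  RInt (V := C_R_CompleteNormedModule) G (- T) T)%C =
  (/ (2 * T) * RInt (fun t => Re (G t)) (- T) T,
   / (2 * T) * RInt (fun t => Im (G t)) (- T) T)).
{ intros T; rewrite RInt_pair; auto; cring. }
unfold is_mean_value; split.
- intros H.
  assert (H' : forall e, 0 < e -> exists M, forall T, M < T ->
    Rabs (/ (2 * T) * RInt (fun t => Re (G t)) (- T) T - Re m) <= e /\
    Rabs (/ (2 * T) * RInt (fun t => Im (G t)) (- T) T - Im m) <= e).
  { intros e He.
    destruct (proj1 (filterlim_locally _ _) H (mkposreal e He)) as [M HM].
    exists M; intros T HT; specialize (HM T HT); rewrite Hval in HM.
    destruct HM as [HM1 HM2]; split; apply Rlt_le; [apply HM1|apply HM2]. }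
  split; intros e He; destruct (H' e He) as [M HM]; exists (Rabs M + 1);
    (split; [generalize (Rabs_pos M); lra|]); intros T HT;
    generalize (Rle_abs M) (Rabs_pos M); intros;
    destruct (HM T ltac:(lra)); now apply Hcomp; [lra|].
- intros [H1 H2]; apply filterlim_locally; intros [e He]; simpl.
  destruct (H1 (e / 2)) as [T1 [HT1 H1']]; [lra|].
  destruct (H2 (e / 2)) as [T2 [HT2 H2']]; [lra|].
  exists (T1 + T2); intros T HT; rewrite Hval.
  specialize (H1' T ltac:(lra)); specialize (H2' T ltac:(lra)).
  apply Hcomp in H1'; [|lra]; apply Hcomp in H2'; [|lra].
  split; simpl; (eapply Rle_lt_trans; [eassumption|lra]).
Qed.

Lemma Cexp_Ci x : Cexp (Ci * RtoC x)%C = cis x.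
Proof.
unfold Cexp, cis.
replace (Re (Ci * RtoC x)) with 0 by cring.
replace (Im (Ci * RtoC x)) with x by cring.
rewrite exp_0; apply Cmult_1_l.
Qed.

Lemma fourier_integrand F mu w t :
  dot (F t * Cexp (- (Ci * RtoC (mu * t))))%C w = dot (F t) (w * cis (mu * t))%C.
Proof.
replace (- (Ci * RtoC (mu * t)))%C with (Ci * RtoC (- (mu * t)))%C by cring.
rewrite Cexp_Ci, dot_rot_l; now rewrite Ropp_involutive.
Qed.

Lemma is_fourier_coef_iff F mu c : contC F -> is_fourier_coef F mu c <-> fcoef F mu c.
Proof.
intros CF; unfold is_fourier_coef.
set (G := fun t => (F t * Cexp (- (Ci * RtoC (mu * t))))%C).
assert (CG : contC G).
{ assert (H : forall t, G t = (F t * cis (- mu * t))%C).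
  { intros t; unfold G; rewrite <- (Cexp_Ci (- mu * t)); do 2 f_equal; cring. }
  destruct (contC_mult F (fun t => cis (- mu * t)) CF (contC_cis (- mu))) as [H1 H2].
  split; [apply cont_ext with (2 := H1)|apply cont_ext with (2 := H2)];
    intros t; now rewrite H. }
rewrite is_mean_value_iff; auto; split.
- intros [H1 H2] w.
  apply (mean_ext (fun t => Re w * Re (G t) + Im w * Im (G t))).
  + intros t; rewrite <- fourier_integrand; fold (G t); cring.
  + replace (dot c w) with (Re w * Re c + Im w * Im c) by cring.
    destruct CG; apply mean_plus; try apply mean_scal; auto with cont.
- intros H; split.
  + apply (mean_ext (fun t => dot (F t) (RtoC 1 * cis (mu * t))%C)).
    * intros t; rewrite <- fourier_integrand; fold (G t); cring.
    * replace (Re c) with (dot c (RtoC 1)) by cring; apply H.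
  + apply (mean_ext (fun t => dot (F t) (Ci * cis (mu * t))%C)).
    * intros t; rewrite <- fourier_integrand; fold (G t); cring.
    * replace (Im c) with (dot c Ci) by cring; apply H.
Qed.

(** * Almost periodic functions on a strip *)

Lemma vshift_eq tau s : vshift tau s = (Re s, Im s + tau).
Proof. unfold vshift; cring. Qed.

Lemma vshift_comm x y s : vshift x (vshift y s) = vshift y (vshift x s).
Proof. unfold vshift; ring. Qed.

Lemma C_eta (s : C) : (Re s, Im s) = s.
Proof. now destruct s. Qed.

Lemma line_in_reduced alpha beta (sigma : R) : Rbar_lt alpha sigma -> Rbar_lt sigma beta ->
  exists s1 s2, reduced_bounds alpha beta s1 s2 /\ s1 <= sigma <= s2.
Proof.
intros H1 H2.
assert (Ha : exists s1 : R, Rbar_lt alpha s1 /\ s1 < sigma).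
{ destruct alpha as [a| |]; simpl in *; try easy.
  - exists ((a + sigma) / 2); simpl; split; lra.
  - exists (sigma - 1); simpl; split; [easy|lra]. }
assert (Hb : exists s2 : R, Rbar_lt s2 beta /\ sigma < s2).
{ destruct beta as [b| |]; simpl in *; try easy.
  - exists ((b + sigma) / 2); simpl; split; lra.
  - exists (sigma + 1); simpl; split; [easy|lra]. }
destruct Ha as [s1 [Ha1 Ha2]]; destruct Hb as [s2 [Hb1 Hb2]].
exists s1, s2; unfold reduced_bounds; split; [split; [auto|split; [lra|auto]]|lra].
Qed.

Lemma reduced_in_strip alpha beta s1 s2 (sigma : R) : reduced_bounds alpha beta s1 s2 ->
  s1 <= sigma <= s2 -> Rbar_lt alpha sigma /\ Rbar_lt sigma beta.
Proof.
intros [H1 [H2 H3]] H; split.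
- apply Rbar_lt_le_trans with (1 := H1); simpl; lra.
- apply Rbar_le_lt_trans with (2 := H3); simpl; lra.
Qed.

Lemma holomorphic_continuous f s :
  ex_derive (K := C_AbsRing) (V := C_NormedModule) f s ->
  forall eps, 0 < eps -> exists delta, 0 < delta /\ forall s', Cmod (s' - s)%C < delta ->
    Rabs (Re (f s') - Re (f s)) < eps /\ Rabs (Im (f s') - Im (f s)) < eps.
Proof.
intros H eps Heps; apply ex_derive_continuous in H.
destruct (proj1 (filterlim_locally _ _) H (mkposreal eps Heps)) as [[delta Hd] H'].
exists delta; split; [exact Hd|]; intros s' Hs'.
destruct (H' s' Hs') as [H1 H2]; split; [apply H1|apply H2].
Qed.

Lemma Cmod_le_abs (a b : R) : Cmod (a, b) <= Rabs a + Rabs b.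
Proof.
apply Cmod_le_nsq.
- generalize (Rabs_pos a) (Rabs_pos b); lra.
- unfold nsq, dot; simpl; generalize (Rabs_pos a) (Rabs_pos b); intros.
  replace (a * a) with (Rabs a * Rabs a) by (rewrite <- Rabs_mult; apply Rabs_pos_eq, Rle_0_sqr).
  replace (b * b) with (Rabs b * Rabs b) by (rewrite <- Rabs_mult; apply Rabs_pos_eq, Rle_0_sqr).
  nra.
Qed.

Lemma AP_continuity_2d alpha beta f x y : AP alpha beta f -> strip alpha beta (x, y) ->
  continuity_2d_pt (fun u v => Re (f (u, v))) x y /\
  continuity_2d_pt (fun u v => Im (f (u, v))) x y.
Proof.
intros [Hd _] Hs; specialize (Hd _ Hs).
assert (H : forall eps : posreal, exists delta : posreal, forall u v,
  Rabs (u - x) < delta -> Rabs (v - y) < delta ->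
  Rabs (Re (f (u, v)) - Re (f (x, y))) < eps /\ Rabs (Im (f (u, v)) - Im (f (x, y))) < eps).
{ intros [eps Heps].
  destruct (holomorphic_continuous f _ Hd eps Heps) as [delta [Hdelta H]].
  exists (mkposreal (delta / 2) ltac:(lra)); simpl; intros u v Hu Hv; apply H.
  apply Rle_lt_trans with (Rabs (u - x) + Rabs (v - y)); [|lra].
  apply (Cmod_le_abs (u - x) (v - y)). }
split; intros eps; destruct (H eps) as [delta Hdelta]; exists delta; intros u v Hu Hv;
  now apply Hdelta.
Qed.

Lemma AP_line_cont alpha beta f (sigma : R) : AP alpha beta f ->
  Rbar_lt alpha sigma -> Rbar_lt sigma beta -> contC (fun t => f (sigma, t)).
Proof.
intros HAP H1 H2.
assert (H : forall t, strip alpha beta (sigma, t)) by (intros t; now split).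
split; intros t; destruct (AP_continuity_2d alpha beta f sigma t HAP (H t)) as [Hr Hi].
- apply (filterlim_locally (fun t => Re (f (sigma, t)))); intros eps.
  destruct (Hr eps) as [delta Hd]; exists delta; intros y Hy; apply Hd; auto.
  rewrite Rminus_diag, Rabs_R0; apply cond_pos.
- apply (filterlim_locally (fun t => Im (f (sigma, t)))); intros eps.
  destruct (Hi eps) as [delta Hd]; exists delta; intros y Hy; apply Hd; auto.
  rewrite Rminus_diag, Rabs_R0; apply cond_pos.
Qed.

Definition strip_close (f : C -> C) (s1 s2 e z : R) : Prop :=
  forall s, closed_strip s1 s2 s -> Cmod (f (vshift z s) - f s)%C <= e.

(** Uniform continuity on a compact rectangle, transported along the strip by almost
    periods, turns Bohr's single almost periods into intervals of them. *)
Lemma AP_strip_rdense alpha beta f s1 s2 e : AP alpha beta f ->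
  reduced_bounds alpha beta s1 s2 -> 0 < e ->
  exists l d, 0 < l /\ 0 < d /\ rdense l d (strip_close f s1 s2 e).
Proof.
intros HAP Hred He; assert (HB := HAP); destruct HB as [_ HB].
destruct (HB (e / 4) s1 s2 ltac:(lra) Hred) as [l [Hl Hz]].
assert (Hin : forall x y, s1 <= x <= s2 -> 0 <= y <= l + 1 -> strip alpha beta (x, y)).
{ intros x y Hx _; now apply (reduced_in_strip _ _ s1 s2). }
assert (He8 : 0 < e / 8) by lra.
destruct (uniform_continuity_2d (fun u v => Re (f (u, v))) s1 s2 0 (l + 1)
  (fun x y Hx Hy => proj1 (AP_continuity_2d alpha beta f x y HAP (Hin x y Hx Hy)))
  (mkposreal _ He8)) as [d1 Hd1].
destruct (uniform_continuity_2d (fun u v => Im (f (u, v))) s1 s2 0 (l + 1)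
  (fun x y Hx Hy => proj2 (AP_continuity_2d alpha beta f x y HAP (Hin x y Hx Hy)))
  (mkposreal _ He8)) as [d2 Hd2].
simpl in Hd1, Hd2.
set (d := Rmin 1 (Rmin d1 d2) / 2).
assert (Hd12 : 0 < Rmin 1 (Rmin d1 d2)).
{ repeat apply Rmin_pos; try apply cond_pos; lra. }
assert (Hd : 0 < d /\ d < 1 /\ d < d1 /\ d < d2).
{ unfold d; generalize (Rmin_l 1 (Rmin d1 d2)) (Rmin_r 1 (Rmin d1 d2))
    (Rmin_l d1 d2) (Rmin_r d1 d2); lra. }
assert (Huc : forall sigma t x, s1 <= sigma <= s2 -> 0 <= x <= d ->
  Cmod (f (sigma, t + x)%R - f (sigma, t))%C <= 3 * e / 4).
{ intros sigma t x Hsig Hx.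
  destruct (Hz (- t)) as [tau [Htau Hclose]].
  assert (H0 : Cmod (f (sigma, t + tau + x)%R - f (sigma, t + tau)%R)%C <= e / 4).
  { assert (Ht1 : 0 <= t + tau <= l + 1) by lra.
    assert (Ht2 : 0 <= t + tau + x <= l + 1) by lra.
    assert (Hr : Rabs (sigma - sigma) < d1)
      by (rewrite Rminus_diag, Rabs_R0; apply cond_pos).
    assert (Hr' : Rabs (sigma - sigma) < d2)
      by (rewrite Rminus_diag, Rabs_R0; apply cond_pos).
    assert (Hx1 : Rabs (t + tau + x - (t + tau)) < d1)
      by (replace (t + tau + x - (t + tau)) with x by ring; rewrite Rabs_pos_eq; lra).
    assert (Hx2 : Rabs (t + tau + x - (t + tau)) < d2)
      by (replace (t + tau + x - (t + tau)) with x by ring; rewrite Rabs_pos_eq; lra).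
    generalize (Hd1 sigma (t + tau) sigma (t + tau + x) Hsig Ht1 Hsig Ht2 Hr Hx1)
      (Hd2 sigma (t + tau) sigma (t + tau + x) Hsig Ht1 Hsig Ht2 Hr' Hx2).
    intros K1 K2.
    apply Rle_trans with (1 := Cmod_le_abs _ _).
    change (Rabs (Re (f (sigma, t + tau + x)) - Re (f (sigma, t + tau))) +
      Rabs (Im (f (sigma, t + tau + x)) - Im (f (sigma, t + tau))) <= e / 4).
    lra. }
  generalize (Hclose (sigma, t + x) Hsig) (Hclose (sigma, t) Hsig).
  rewrite !vshift_eq; simpl Re; simpl Im.
  replace (t + x + tau) with (t + tau + x) by ring.
  intros K1 K2.
  set (z1 := f (sigma, t + tau + x)) in *; set (z2 := f (sigma, t + tau)) in *.
  set (z3 := f (sigma, t + x)) in *; set (z4 := f (sigma, t)) in *.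
  replace (z3 - z4)%C with ((z1 - z2) - ((z1 - z3) - (z2 - z4)))%C by ring.
  apply Rle_trans with (1 := Cmod_minus_le _ _).
  generalize (Cmod_minus_le (z1 - z3)%C (z2 - z4)%C); lra. }
exists l, d; split; [auto|split; [lra|]].
intros x; destruct (Hz x) as [y [Hy Hclose]].
exists y; split; auto; intros z Hzy s Hs.
rewrite vshift_eq.
generalize (Hclose s Hs) (Huc (Re s) (Im s + y) (z - y) Hs ltac:(lra)).
rewrite vshift_eq; replace (Im s + y + (z - y)) with (Im s + z) by ring.
intros K1 K2.
set (z1 := f (Re s, Im s + z)) in *; set (z2 := f (Re s, Im s + y)) in *.
replace (z1 - f s)%C with ((z1 - z2) + (z2 - f s))%C by ring.
apply Rle_trans with (1 := Cmod_triangle _ _); lra.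
Qed.

Lemma strip_close_line f s1 s2 e z sigma : s1 <= sigma <= s2 ->
  strip_close f s1 s2 e z -> shift_close (fun t => f (sigma, t)) e z.
Proof.
intros Hs H t; specialize (H (sigma, t) Hs); now rewrite vshift_eq in H.
Qed.

Lemma AP_line alpha beta f (sigma : R) : AP alpha beta f ->
  Rbar_lt alpha sigma -> Rbar_lt sigma beta -> almost_periodic (fun t => f (sigma, t)).
Proof.
intros HAP H1 H2.
destruct (line_in_reduced alpha beta sigma H1 H2) as [s1 [s2 [Hred Hs]]].
assert (CF := AP_line_cont alpha beta f sigma HAP H1 H2).
assert (HZ : forall e, 0 < e -> exists l d, 0 < l /\ 0 < d /\
  rdense l d (shift_close (fun t => f (sigma, t)) e)).
{ intros e He.
  destruct (AP_strip_rdense alpha beta f s1 s2 e HAP Hred He) as [l [d [Hl [Hd Hz]]]].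
  exists l, d; split; [auto|split; [auto|]].
  apply rdense_mono with (2 := Hz); intros z Hcl.
  now apply (strip_close_line f s1 s2). }
split; [auto|split; [|auto]].
destruct (HZ 1 Rlt_0_1) as [l [d [Hl [Hd Hz]]]].
destruct CF as [C1 C2].
destruct (@bounded_continuity R_AbsRing R_NormedModule (fun t => Re (f (sigma, t))) 0 l
  (fun x _ => C1 x)) as [M1 HM1].
destruct (@bounded_continuity R_AbsRing R_NormedModule (fun t => Im (f (sigma, t))) 0 l
  (fun x _ => C2 x)) as [M2 HM2].
assert (HM : forall t, 0 <= t <= l -> Cmod (f (sigma, t)) <= M1 + M2).
{ intros t Ht; specialize (HM1 t Ht); specialize (HM2 t Ht).
  rewrite <- (C_eta (f (sigma, t))); apply Rle_trans with (1 := Cmod_le_abs _ _).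
  unfold norm in HM1, HM2; simpl in HM1, HM2; unfold abs in HM1, HM2; simpl in HM1, HM2.
  lra. }
exists (M1 + M2 + 1); split.
- generalize (HM 0 ltac:(lra)) (Cmod_ge_0 (f (sigma, 0))); lra.
- intros t; destruct (Hz (- t)) as [z [Hzt Hcl]].
  specialize (Hcl z ltac:(lra) t); simpl in Hcl.
  generalize (HM (t + z) ltac:(lra)); intros H.
  replace (f (sigma, t)) with (f (sigma, t + z)%R - (f (sigma, t + z)%R - f (sigma, t)))%C
    by ring.
  apply Rle_trans with (1 := Cmod_minus_le _ _); lra.
Qed.

(** * From mean squares to suprema *)

(** Where [|v|] exceeds [e], almost periodicity keeps it above [e / 2] on a relatively dense
    union of intervals, and this gives the mean square a lower bound depending only on [e],
    [l] and [d]. *)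
Lemma sup_le_of_mean v u m l d e : contC v -> cont u -> (forall t, nsq (v t) <= u t) ->
  mean u m -> 0 < l -> 0 < d -> 0 < e -> rdense l d (shift_close v (e / 2)) ->
  m < e / 2 * (e / 2) * d / (2 * (l + d)) -> forall t, Cmod (v t) <= e.
Proof.
intros Cv Cu Huv Hu Hl Hd He HZ Hm t0; apply Rnot_lt_le; intros Hlt.
apply (Rlt_not_le _ _ Hm).
apply (mean_ge_le (fun t => nsq (v t)) u); auto with cont.
assert (HZ' : rdense l d (fun z => shift_close v (e / 2) (z - t0))).
{ intros x; destruct (HZ (x - t0)) as [y [Hy Hyz]].
  exists (y + t0); split; [lra|]; intros z Hz; apply Hyz; lra. }
apply rdense_mean_ge with (6 := HZ'); auto with cont.
- intros t; apply nsq_ge0.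
- nra.
- intros z Hz; specialize (Hz t0); replace (t0 + (z - t0)) with z in Hz by ring.
  rewrite nsq_Cmod.
  assert (H : Cmod (v t0) <= Cmod (v z) + Cmod (v z - v t0)%C).
  { replace (v t0) with (v z - (v z - v t0))%C at 1 by ring; apply Cmod_minus_le. }
  nra.
Qed.

(** * Dirichlet coefficients *)

Definition line_coef (L : exponents) (a : nat -> C) (sigma : R) (j : nat) : C :=
  (a j * RtoC (exp (expo L j * sigma)))%C.

Lemma dirichlet_line L alpha beta f a (sigma : R) : AP alpha beta f ->
  dirichlet_series L alpha beta f a -> Rbar_lt alpha sigma -> Rbar_lt sigma beta ->
  fourier_line L (fun t => f (sigma, t)) (line_coef L a sigma).
Proof.
intros HAP Ha H1 H2; destruct (Ha sigma H1 H2) as [Hj Hmu].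
assert (CF := AP_line_cont alpha beta f sigma HAP H1 H2).
split.
- intros j Hi; apply is_fourier_coef_iff; auto.
- intros mu Hi; apply is_fourier_coef_iff; auto.
Qed.

Lemma nsq_line_coef L a sigma j :
  nsq (line_coef L a sigma j) = nsq (a j) * (exp (expo L j * sigma) * exp (expo L j * sigma)).
Proof. unfold line_coef; rewrite nsq_mult; f_equal; cring. Qed.

(** Exponentials being monotone, the squared coefficients on an intermediate line are
    controlled by those on two bounding lines. *)
Lemma nsq_line_coef_between L a s1 s2 sigma j : s1 <= sigma <= s2 ->
  nsq (line_coef L a sigma j) <= nsq (line_coef L a s1 j) + nsq (line_coef L a s2 j).
Proof.
intros Hs; rewrite !nsq_line_coef, <- Rmult_plus_distr_l.
apply Rmult_le_compat_l; [apply nsq_ge0|].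
rewrite <- !exp_plus.
assert (Hexp : forall x y, x <= y -> exp x <= exp y).
{ intros x y [H| ->]; [left; now apply exp_increasing|right; auto]. }
set (lam := expo L j).
generalize (exp_pos (lam * s1 + lam * s1)) (exp_pos (lam * s2 + lam * s2)); intros.
destruct (Rle_dec 0 lam) as [Hl|Hl].
- generalize (Hexp (lam * sigma + lam * sigma) (lam * s2 + lam * s2) ltac:(nra)); lra.
- generalize (Hexp (lam * sigma + lam * sigma) (lam * s1 + lam * s1) ltac:(nra)); lra.
Qed.

Lemma nsq_coef_equiv L a b j : coef_equiv L a b -> index L j -> nsq (b j) = nsq (a j).
Proof.
intros H Hj; destruct (H (S j)) as [psi [_ Hpsi]]; [lia| |].
- revert Hj; unfold index, le_card; destruct (card L); auto; lia.
- rewrite Hpsi by lia; rewrite Cexp_Ci, nsq_mult, nsq_cis; ring.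
Qed.

Lemma nsq_line_coef_equiv L a b sigma j : coef_equiv L a b -> index L j ->
  nsq (line_coef L b sigma j) = nsq (line_coef L a sigma j).
Proof. intros H Hj; now rewrite !nsq_line_coef, (nsq_coef_equiv L a b). Qed.

(** * Equivalent functions have the same almost periods *)

Lemma autocorr_ge F B rho x : contC F -> (forall t, Cmod (F t) <= B) ->
  autocorr F rho -> - rho 0 <= rho x.
Proof.
intros CF HB Hr.
assert (H : 0 <= rho 0 + rho 0 + 2 * rho x); [|lra].
apply (mean_ge0 (fun t => nsq (F (t + x)) + nsq (F t) + 2 * dot (F (t + x)) (F t))).
- auto with cont.
- apply mean_plus; [| |apply mean_plus|apply mean_scal]; auto using autocorr_nsq with cont.
  replace 0 with (x - x) at 1 by ring; now apply (autocorr_shift F B).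
- intros t; replace (_ + _) with (nsq (F (t + x)%R + F t)%C); [apply nsq_ge0|].
  rewrite nsq_plus; ring.
Qed.

(** The autocorrelation of the remainder at [x] is at least minus its value at [0]. *)
Lemma autocorr_diff_le L F A rho n x : almost_periodic F -> autocorr F rho ->
  fourier_line L F A -> le_card L n ->
  rho 0 - rho x <= 2 * (rho 0 - rsum n (fun j => nsq (A j))) +
    rsum n (fun j => nsq (A j) * (1 - cos (expo L j * x))).
Proof.
intros HF Hr HA Hn.
destruct (remainder_spec L F A rho n HF Hr HA Hn) as [[CR [[B [_ HB]] _]] [HRr _]].
generalize (autocorr_ge _ B _ x CR HB HRr).
rewrite (rsum_ext n (fun j => nsq (A j) * cos (expo L j * 0)) (fun j => nsq (A j)))
  by (intros; rewrite Rmult_0_r, cos_0; ring).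
rewrite (rsum_ext n (fun j => nsq (A j) * (1 - cos (expo L j * x)))
  (fun j => nsq (A j) + (-1) * (nsq (A j) * cos (expo L j * x)))) by (intros; ring).
rewrite rsum_plus, rsum_scal; lra.
Qed.

(** The mean square of [F (t + x) - F t] only depends on the moduli of the Fourier
    coefficients. *)
Lemma autocorr_diff_equiv L F G A B rhoF rhoG x : almost_periodic F -> almost_periodic G ->
  autocorr F rhoF -> autocorr G rhoG -> fourier_line L F A -> fourier_line L G B ->
  (forall j, index L j -> nsq (B j) = nsq (A j)) ->
  rhoG 0 - rhoG x <= rhoF 0 - rhoF x.
Proof.
intros HF HG HrF HrG HA HB HAB.
apply le_epsilon; intros eps Heps.
destruct (parseval L G B rhoG HG HrG HB (eps / 2)) as [n [Hn Hpar]]; [lra|].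
specialize (Hpar n Hn (Nat.le_refl n)).
generalize (autocorr_diff_le L G B rhoG n x HG HrG HB Hn).
generalize (bessel_shift L F A rhoF n x HF HrF HA Hn).
rewrite (rsum_ext n (fun j => nsq (B j) * _)
  (fun j => nsq (A j) * (1 - cos (expo L j * x)))); [lra|].
intros j Hj; rewrite HAB; auto; now apply (le_card_index L n).
Qed.

(** An almost period [x] of [f] makes the mean square of [g (s + i x) - g s] small on every
    line by [autocorr_diff_equiv], and [sup_le_of_mean] turns this into a uniform bound. *)
Lemma strip_close_equiv L alpha beta f g a b s1 s2 e : AP alpha beta f -> AP alpha beta g ->
  dirichlet_series L alpha beta f a -> dirichlet_series L alpha beta g b ->
  coef_equiv L a b -> reduced_bounds alpha beta s1 s2 -> 0 < e ->
  exists eta, 0 < eta /\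
    forall x, strip_close f s1 s2 eta x -> strip_close g s1 s2 e x.
Proof.
intros HAf HAg Ha Hb Hab Hred He.
destruct (AP_strip_rdense alpha beta g s1 s2 (e / 4) HAg Hred) as [l [d [Hl [Hd Hz]]]];
  [lra|].
set (c := e / 2 * (e / 2) * d / (2 * (l + d))).
assert (Hc : 0 < c) by (apply Rdiv_lt_0_compat; [|lra]; repeat apply Rmult_lt_0_compat; lra).
exists (Rmin 1 (c / 2)); split; [apply Rmin_pos; lra|]; intros x Hx s Hs.
set (eta := Rmin 1 (c / 2)) in *.
assert (Heta : 0 < eta) by (apply Rmin_pos; lra).
assert (Heta2 : eta * eta <= c / 2).
{ assert (eta <= 1) by apply Rmin_l; assert (eta <= c / 2) by apply Rmin_r; nra. }
set (sigma := Re s).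
destruct (reduced_in_strip alpha beta s1 s2 sigma Hred Hs) as [Hs1 Hs2].
assert (HF := AP_line alpha beta f sigma HAf Hs1 Hs2).
assert (HG := AP_line alpha beta g sigma HAg Hs1 Hs2).
destruct (autocorr_exists _ HF) as [rhoF HrF].
destruct (autocorr_exists _ HG) as [rhoG HrG].
assert (Hle : rhoG 0 - rhoG x <= rhoF 0 - rhoF x).
{ apply (autocorr_diff_equiv L _ _ (line_coef L a sigma) (line_coef L b sigma) rhoF rhoG x
    HF HG HrF HrG); try (eapply dirichlet_line; eassumption).
  intros j Hj; now apply nsq_line_coef_equiv. }
assert (CF := HF); destruct CF as [CF [[BF [HBF0 HBF]] _]].
assert (CG := HG); destruct CG as [CG [[BG [HBG0 HBG]] _]].
assert (H1 := autocorr_shift_close _ BF rhoF eta x CF HBF HrF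
  (strip_close_line f s1 s2 eta x sigma Hs Hx)).
set (G := fun t => g (sigma, t)) in *.
assert (Hsup := sup_le_of_mean (fun t => G (t + x)%R - G t)%C
  (fun t => nsq (G (t + x)%R - G t)%C) (2 * (rhoG 0 - rhoG x)) l d e).
rewrite vshift_eq; replace (g s) with (g (Re s, Im s)) by now rewrite C_eta.
change (Cmod (G (Im s + x)%R - G (Im s))%C <= e).
apply Hsup; auto with cont real; [| |fold c; lra].
- now apply (autocorr_diff G BG).
- apply rdense_mono with (2 := Hz); intros z Hcl t.
  assert (HGz : shift_close G _ z) by exact (strip_close_line g s1 s2 (e / 4) z sigma Hs Hcl).
  replace (G (t + z + x)%R - G (t + z)%R - (G (t + x)%R - G t))%C with
    ((G (t + x + z)%R - G (t + x)%R) - (G (t + z)%R - G t))%C.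
  + apply Rle_trans with (1 := Cmod_minus_le _ _).
    generalize (HGz (t + x)) (HGz t); lra.
  + replace (t + z + x) with (t + x + z) by ring; ring.
Qed.

(** * Density of the translates *)

Lemma nsq_plus3_le a b c : nsq (a + b + c)%C <= 3 * (nsq a + nsq b + nsq c).
Proof.
unfold nsq, dot, Cplus, Re, Im; simpl.
generalize (Rle_0_sqr (fst a - fst b)) (Rle_0_sqr (fst a - fst c))
  (Rle_0_sqr (fst b - fst c)) (Rle_0_sqr (snd a - snd b)) (Rle_0_sqr (snd a - snd c))
  (Rle_0_sqr (snd b - snd c)); unfold Rsqr; nra.
Qed.

Lemma nsq_minus_le a b : nsq (a - b)%C <= 2 * (nsq a + nsq b).
Proof.
unfold nsq, dot, Cminus, Cplus, Copp, Re, Im; simpl.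
generalize (Rle_0_sqr (fst a + fst b)) (Rle_0_sqr (snd a + snd b)); unfold Rsqr; nra.
Qed.

(** Write [F (t + tau) - G t] as the difference of the two partial sums plus two remainders.
    The first term of the mean value and the last are the mean squares of the
    remainders, which Parseval's identity makes small. *)
Lemma mean_shift_sub L F G A B rhoF rhoG n tau : almost_periodic F -> almost_periodic G ->
  autocorr F rhoF -> autocorr G rhoG -> fourier_line L F A -> fourier_line L G B ->
  le_card L n ->
  exists u, cont u /\ (forall t, nsq (F (t + tau)%R - G t)%C <= u t) /\
    mean u (3 * ((rhoF 0 - rsum n (fun j => nsq (A j))) +
      rsum n (fun j => nsq (A j * cis (expo L j * tau) - B j)%C) +
      (rhoG 0 - rsum n (fun j => nsq (B j))))).
Proof.
intros HF HG HrF HrG HA HB Hn.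
destruct (remainder_spec L F A rhoF n HF HrF HA Hn) as [[CRF [[BF [_ HBF]] _]] [HRF _]].
destruct (remainder_spec L G B rhoG n HG HrG HB Hn) as [[CRG [[BG [_ HBG]] _]] [HRG _]].
set (RF := remainder L F A n) in *; set (RG := remainder L G B n) in *.
set (D := fun j => (A j * cis (expo L j * tau) - B j)%C).
assert (CD := contC_partial_sum L D n).
apply autocorr_nsq in HRF; apply autocorr_nsq in HRG.
rewrite (rsum_ext n (fun j => nsq (A j) * cos (expo L j * 0)) (fun j => nsq (A j)))
  in HRF by (intros; rewrite Rmult_0_r, cos_0; ring).
rewrite (rsum_ext n (fun j => nsq (B j) * cos (expo L j * 0)) (fun j => nsq (B j)))
  in HRG by (intros; rewrite Rmult_0_r, cos_0; ring).
assert (C1 : cont (fun t => nsq (RF (t + tau)%R)))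
  by (apply (cont_shift (fun t => nsq (RF t))); auto with cont).
exists (fun t => 3 * (nsq (RF (t + tau)%R) + nsq (partial_sum L D n t) + nsq (RG t))).
split; [auto with cont|split].
- intros t.
  replace (F (t + tau)%R - G t)%C with
    (RF (t + tau)%R + partial_sum L D n t + (- RG t))%C.
  + apply Rle_trans with (1 := nsq_plus3_le _ _ _).
    replace (nsq (- RG t)%C) with (nsq (RG t)) by cring; lra.
  + unfold RF, RG; rewrite !remainder_eq.
    assert (H : partial_sum L D n t =
      (partial_sum L A n (t + tau) - partial_sum L B n t)%C).
    { unfold partial_sum, D; clear; induction n as [|n IH]; simpl; [ring|].
      rewrite IH, Rmult_plus_distr_l, cis_plus; ring. }
    rewrite H; ring.
- apply mean_scal; auto with cont.
  apply mean_plus; auto with cont.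
  apply mean_plus; auto with cont.
  + apply (mean_shift (fun t => nsq (RF t)) (BF * BF)); auto with cont.
    intros t; rewrite Rabs_pos_eq by apply nsq_ge0; now apply nsq_le_Cmod.
  + now apply mean_nsq_partial_sum.
Qed.

(** The phases of finitely many coefficients of [g] are nearly attained by a translate of [f];
    the other coefficients have small total weight, on all lines of the strip at once. *)
Lemma coef_approximation L alpha beta f a b s1 s2 eps : AP alpha beta f ->
  dirichlet_series L alpha beta f a -> coef_equiv L a b ->
  reduced_bounds alpha beta s1 s2 -> 0 < eps ->
  exists tau, forall sigma n, s1 <= sigma <= s2 -> le_card L n ->
    rsum n (fun j => nsq (line_coef L a sigma j * cis (expo L j * tau) -
      line_coef L b sigma j)%C) <= eps.
Proof.
intros HAf Ha Hab Hred Heps.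
assert (Hss : s1 < s2) by apply Hred.
destruct (reduced_in_strip alpha beta s1 s2 s1 Hred ltac:(lra)) as [H11 H12].
destruct (reduced_in_strip alpha beta s1 s2 s2 Hred ltac:(lra)) as [H21 H22].
assert (HF1 := AP_line alpha beta f s1 HAf H11 H12).
assert (HF2 := AP_line alpha beta f s2 HAf H21 H22).
assert (HA1 := dirichlet_line L alpha beta f a s1 HAf Ha H11 H12).
assert (HA2 := dirichlet_line L alpha beta f a s2 HAf Ha H21 H22).
destruct (autocorr_exists _ HF1) as [rho1 Hr1].
destruct (autocorr_exists _ HF2) as [rho2 Hr2].
set (w := fun j => nsq (line_coef L a s1 j) + nsq (line_coef L a s2 j)).
assert (Hw : forall j, 0 <= w j)
  by (intros j; apply Rplus_le_le_0_compat; apply nsq_ge0).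
destruct (summable_tail L w (rho1 0 + rho2 0) Hw) with (eps := eps / 8)
  as [N [HN Htail]]; [|lra|].
{ intros n Hn; unfold w; rewrite rsum_plus.
  generalize (bessel L _ _ rho1 n HF1 Hr1 HA1 Hn) (bessel L _ _ rho2 n HF2 Hr2 HA2 Hn); lra. }
assert (Hphase : exists tau psi,
  (forall j, (j < N)%nat -> b j = (a j * cis (psi (expo L j)))%C) /\
  rsum N (fun j => w j * (1 - cos (expo L j * tau - psi (expo L j)))) <= eps / 8).
{ destruct (Nat.eq_dec N 0) as [->|HN0].
  - exists 0, (fun _ => 0); split; [lia|simpl; lra].
  - destruct (Hab N ltac:(lia) HN) as [psi [Hlin Hpsi]].
    destruct (kronecker L N w psi) with (e := eps / 8) as [tau Htau]; auto; [|lra|].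
    + intros e He.
      set (e' := Rmin 1 e).
      assert (He' : 0 < e') by (apply Rmin_pos; lra).
      assert (He2 : e' * e' <= e).
      { assert (e' <= 1) by apply Rmin_l; assert (e' <= e) by apply Rmin_r; nra. }
      destruct (AP_strip_rdense alpha beta f s1 s2 e' HAf Hred He')
        as [l [d [Hl [Hd Hz]]]].
      exists l, d; split; [auto|split; [auto|]].
      apply rdense_mono with (2 := Hz); intros z Hcl.
      rewrite (rsum_ext N _ (fun j =>
        nsq (line_coef L a s1 j) * (1 - cos (expo L j * z)) +
        nsq (line_coef L a s2 j) * (1 - cos (expo L j * z))))
        by (intros; unfold w; ring).
      rewrite rsum_plus.
      generalize (bessel_shift L _ _ rho1 N z HF1 Hr1 HA1 HN)
        (bessel_shift L _ _ rho2 N z HF2 Hr2 HA2 HN).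
      destruct HF1 as [CF1 [[B1 [_ HB1]] _]]; destruct HF2 as [CF2 [[B2 [_ HB2]] _]].
      generalize (autocorr_shift_close _ B1 rho1 e' z CF1 HB1 Hr1
        (strip_close_line f s1 s2 e' z s1 ltac:(lra) Hcl))
        (autocorr_shift_close _ B2 rho2 e' z CF2 HB2 Hr2
        (strip_close_line f s1 s2 e' z s2 ltac:(lra) Hcl)).
      lra.
    + exists tau, psi; split; auto.
      intros j Hj; rewrite <- Cexp_Ci; now apply Hpsi. }
destruct Hphase as [tau [psi [Hpsi Htau]]].
exists tau; intros sigma n Hsig Hn.
set (D := fun j => nsq (line_coef L a sigma j * cis (expo L j * tau) -
  line_coef L b sigma j)%C).
assert (HD0 : forall j, 0 <= D j) by (intros; apply nsq_ge0).
assert (HDhead : forall j, (j < N)%nat ->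
  D j <= 2 * (w j * (1 - cos (expo L j * tau - psi (expo L j))))).
{ intros j Hj; unfold D.
  set (p := psi (expo L j)).
  assert (Hb : line_coef L b sigma j = (line_coef L a sigma j * cis p)%C)
    by (unfold line_coef; rewrite (Hpsi j Hj); fold p; ring).
  rewrite Hb; set (z := line_coef L a sigma j).
  replace (z * cis (expo L j * tau) - z * cis p)%C with
    ((z * cis (expo L j * tau - p) - z) * cis p)%C.
  - rewrite nsq_mult, nsq_cis, nsq_rot_sub.
    generalize (nsq_line_coef_between L a s1 s2 sigma j Hsig)
      (COS_bound (expo L j * tau - p)); fold z (w j); intros; nra.
  - transitivity (z * (cis (expo L j * tau - p) * cis p) - z * cis p)%C; [ring|].
    rewrite <- cis_plus; do 3 f_equal; ring. }
assert (HDtail : forall j, index L j -> D j <= 4 * w j).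
{ intros j Hj; unfold D; apply Rle_trans with (1 := nsq_minus_le _ _).
  rewrite nsq_mult, nsq_cis, (nsq_line_coef_equiv L a b) by auto.
  generalize (nsq_line_coef_between L a s1 s2 sigma j Hsig); unfold w; lra. }
set (M := Nat.max n N).
assert (HM : le_card L M) by now apply le_card_max.
apply Rle_trans with (rsum M D); [apply rsum_le_mono; auto; lia|].
specialize (Htail M HM ltac:(lia)).
replace M with (N + (M - N))%nat in Htail |- * by lia.
rewrite rsum_add in Htail |- *.
assert (H1 : rsum N D <= 2 * (eps / 8)).
{ apply Rle_trans with (2 := Rmult_le_compat_l 2 _ _ ltac:(lra) Htau).
  rewrite <- rsum_scal; now apply rsum_le. }
assert (H2 : rsum (M - N) (fun k => D (N + k)%nat) <=
  4 * rsum (M - N) (fun k => w (N + k)%nat)).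
{ rewrite <- rsum_scal; apply rsum_le; intros k Hk; apply HDtail.
  apply (le_card_index L M); auto; lia. }
lra.
Qed.

(** The almost periods common to [f] and [g] are almost periods of [f (s + i tau) - g s], so
    that [sup_le_of_mean] applies on each line with the same [l] and [d]. *)
Lemma translate_approximation L alpha beta f g a b s1 s2 eps :
  AP alpha beta f -> AP alpha beta g ->
  dirichlet_series L alpha beta f a -> dirichlet_series L alpha beta g b ->
  coef_equiv L a b -> reduced_bounds alpha beta s1 s2 -> 0 < eps ->
  exists tau, forall s, closed_strip s1 s2 s -> Cmod (f (vshift tau s) - g s)%C <= eps.
Proof.
intros HAf HAg Ha Hb Hab Hred Heps.
destruct (strip_close_equiv L alpha beta f g a b s1 s2 (eps / 4)) as [eta [Heta Hfg]];
  auto; [lra|].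
set (eta' := Rmin eta (eps / 4)).
assert (Heta' : 0 < eta') by (apply Rmin_pos; lra).
destruct (AP_strip_rdense alpha beta f s1 s2 eta' HAf Hred Heta') as [l [d [Hl [Hd Hz]]]].
set (c := eps / 2 * (eps / 2) * d / (2 * (l + d))).
assert (Hc : 0 < c) by (apply Rdiv_lt_0_compat; [|lra]; repeat apply Rmult_lt_0_compat; lra).
destruct (coef_approximation L alpha beta f a b s1 s2 (c / 12)) as [tau Htau]; auto; [lra|].
exists tau; intros s Hs.
set (sigma := Re s).
destruct (reduced_in_strip alpha beta s1 s2 sigma Hred Hs) as [Hs1 Hs2].
assert (HF := AP_line alpha beta f sigma HAf Hs1 Hs2).
assert (HG := AP_line alpha beta g sigma HAg Hs1 Hs2).
assert (HA := dirichlet_line L alpha beta f a sigma HAf Ha Hs1 Hs2).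
assert (HB := dirichlet_line L alpha beta g b sigma HAg Hb Hs1 Hs2).
destruct (autocorr_exists _ HF) as [rhoF HrF].
destruct (autocorr_exists _ HG) as [rhoG HrG].
destruct (parseval L _ _ rhoF HF HrF HA (c / 12)) as [nF [HnF HpF]]; [lra|].
destruct (parseval L _ _ rhoG HG HrG HB (c / 12)) as [nG [HnG HpG]]; [lra|].
set (n := Nat.max nF nG).
assert (Hn : le_card L n) by now apply le_card_max.
specialize (HpF n Hn ltac:(lia)); specialize (HpG n Hn ltac:(lia)).
specialize (Htau sigma n Hs Hn).
destruct (mean_shift_sub L _ _ _ _ rhoF rhoG n tau HF HG HrF HrG HA HB Hn)
  as [u [Cu [Hu Hm]]].
set (F := fun t => f (sigma, t)) in *; set (G := fun t => g (sigma, t)) in *.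
rewrite vshift_eq; replace (g s) with (g (Re s, Im s)) by now rewrite C_eta.
change (Cmod (F (Im s + tau)%R - G (Im s))%C <= eps).
destruct HF as [CF _]; destruct HG as [CG _].
apply (sup_le_of_mean (fun t => F (t + tau)%R - G t)%C u _ l d eps) with (4 := Hm);
  auto with cont.
- apply rdense_mono with (2 := Hz); intros z Hcl t.
  assert (Hcl1 : strip_close f s1 s2 eta z).
  { intros s' Hs'; apply Rle_trans with (1 := Hcl s' Hs'), Rmin_l. }
  assert (HGz : shift_close G _ z) by exact (strip_close_line g s1 s2 (eps / 4) z sigma Hs (Hfg z Hcl1)).
  assert (HFz : shift_close F _ z) by exact (strip_close_line f s1 s2 eta' z sigma Hs Hcl).
  assert (Hmin : eta' <= eps / 4) by apply Rmin_r.
  replace (F (t + z + tau)%R - G (t + z)%R - (F (t + tau)%R - G t))%C with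
    ((F (t + tau + z)%R - F (t + tau)%R) - (G (t + z)%R - G t))%C.
  + apply Rle_trans with (1 := Cmod_minus_le _ _).
    generalize (HFz (t + tau)) (HGz t); lra.
  + replace (t + z + tau) with (t + tau + z) by ring; ring.
- fold c; lra.
Qed.

(** * Equivalence of coefficients and of functions *)

Lemma dirichlet_unique L alpha beta f a a' : Rbar_lt alpha beta -> AP alpha beta f ->
  dirichlet_series L alpha beta f a -> dirichlet_series L alpha beta f a' ->
  forall j, index L j -> a j = a' j.
Proof.
intros Hab HAP Ha Ha' j Hj.
assert (Hs : exists sigma : R, Rbar_lt alpha sigma /\ Rbar_lt sigma beta).
{ destruct alpha as [x| |], beta as [y| |]; simpl in *; try easy.
  - exists ((x + y) / 2); simpl; split; lra.
  - exists (x + 1); simpl; split; [lra|easy].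
  - exists (y - 1); simpl; split; [easy|lra].
  - now exists 0. }
destruct Hs as [sigma [H1 H2]].
assert (CF := AP_line_cont alpha beta f sigma HAP H1 H2).
generalize (fcoef_unique _ _ _ _ CF
  (proj1 (dirichlet_line L alpha beta f a sigma HAP Ha H1 H2) j Hj)
  (proj1 (dirichlet_line L alpha beta f a' sigma HAP Ha' H1 H2) j Hj)).
unfold line_coef; set (E := RtoC (exp (expo L j * sigma))); intros H.
assert (HE : E <> RtoC 0).
{ intros H0; apply RtoC_inj in H0; generalize (exp_pos (expo L j * sigma)); lra. }
replace (a j) with (a j * E / E)%C by (field; auto).
rewrite H; field; auto.
Qed.

Lemma Qlinear_on_minus V psi psi' : Qlinear_on V psi -> Qlinear_on V psi' ->
  Qlinear_on V (fun x => psi' x - psi x).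
Proof.
intros [H1 H2] [H3 H4]; split; intros.
- rewrite H1, H3 by auto; ring.
- rewrite H2, H4 by auto; ring.
Qed.

Lemma coef_equiv_comp L a a' b b' : (forall j, index L j -> a j = a' j) ->
  coef_equiv L a b -> coef_equiv L a' b' -> coef_equiv L b b'.
Proof.
intros Ha H H' n Hn1 Hn.
destruct (H n Hn1 Hn) as [psi [Hl Hpsi]]; destruct (H' n Hn1 Hn) as [psi' [Hl' Hpsi']].
exists (fun x => psi' x - psi x); split; [now apply Qlinear_on_minus|].
intros j Hj; rewrite Hpsi, Hpsi', Ha by eauto using le_card_index.
rewrite !Cexp_Ci, <- Cmult_assoc, <- cis_plus; do 2 f_equal; ring.
Qed.

Lemma coef_equiv_translate L a b tau : coef_equiv L a b ->
  coef_equiv L a (fun j => b j * cis (expo L j * tau))%C.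
Proof.
intros H n Hn1 Hn; destruct (H n Hn1 Hn) as [psi [[Hl1 Hl2] Hpsi]].
exists (fun x => psi x + x * tau); split.
- split; intros; [rewrite Hl1 by auto; ring|rewrite Hl2 by auto; ring].
- intros j Hj; rewrite Hpsi by auto; rewrite !Cexp_Ci, cis_plus; ring.
Qed.

(** * Translates stay in the class *)

Lemma strip_vshift alpha beta tau s : strip alpha beta s -> strip alpha beta (vshift tau s).
Proof. intros H; rewrite vshift_eq; exact H. Qed.

Lemma strip_open alpha beta s : strip alpha beta s ->
  exists delta, 0 < delta /\ forall s', Cmod (s' - s)%C < delta -> strip alpha beta s'.
Proof.
intros [H1 H2].
destruct (line_in_reduced alpha beta (Re s) H1 H2) as [r1 [r2 [[Hr1 [_ Hr2]] Hr]]].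
assert (Ha : exists d1, 0 < d1 /\ Rbar_le alpha (Re s - d1)).
{ destruct alpha as [x| |]; simpl in *; try easy.
  - exists (Re s - x); split; lra.
  - now exists 1; split; [lra|]. }
assert (Hb : exists d2, 0 < d2 /\ Rbar_le (Re s + d2) beta).
{ destruct beta as [x| |]; simpl in *; try easy.
  - exists (x - Re s); split; lra.
  - now exists 1; split; [lra|]. }
destruct Ha as [d1 [Hd1 Ha]]; destruct Hb as [d2 [Hd2 Hb]].
exists (Rmin d1 d2); split; [now apply Rmin_pos|]; intros s' Hs'.
assert (Hre : Rabs (Re s' - Re s) < Rmin d1 d2).
{ apply Rle_lt_trans with (2 := Hs'); apply (re_le_Cmod (s' - s)%C). }
apply Rabs_def2 in Hre.
generalize (Rmin_l d1 d2) (Rmin_r d1 d2); intros.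
split.
- apply Rbar_le_lt_trans with (1 := Ha); simpl; lra.
- apply Rbar_lt_le_trans with (2 := Hb); simpl; lra.
Qed.

Lemma AP_translate alpha beta f h tau : AP alpha beta f ->
  (forall s, strip alpha beta s -> h s = f (vshift tau s)) -> AP alpha beta h.
Proof.
intros [Hd HB] Hh; split.
- intros s Hs.
  apply (ex_derive_ext_loc (K := C_AbsRing) (V := C_NormedModule)
    (fun s => f (vshift tau s))).
  + destruct (strip_open alpha beta s Hs) as [delta [Hdelta H]].
    exists (mkposreal delta Hdelta); intros s' Hs'; symmetry; apply Hh, H, Hs'.
  + apply (ex_derive_comp (K := C_AbsRing) (V := C_NormedModule) f (vshift tau)).
    * now apply Hd, strip_vshift.
    * apply (ex_derive_plus (K := C_AbsRing) (V := AbsRing_NormedModule C_AbsRing)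
        (fun s => s) (fun _ => (Ci * RtoC tau)%C)).
      -- apply ex_derive_id.
      -- apply ex_derive_const.
- intros eps s1 s2 Heps Hred; destruct (HB eps s1 s2 Heps Hred) as [l [Hl Hz]].
  exists l; split; auto; intros x; destruct (Hz x) as [z [Hxz Hcl]].
  exists z; split; auto; intros s Hs.
  assert (Hstrip : strip alpha beta s) by now apply (reduced_in_strip _ _ s1 s2).
  rewrite !Hh, (vshift_comm tau z) by auto using strip_vshift.
  apply Hcl; rewrite vshift_eq; exact Hs.
Qed.

Lemma dirichlet_translate L alpha beta f h a tau : AP alpha beta f ->
  dirichlet_series L alpha beta f a ->
  (forall s, strip alpha beta s -> h s = f (vshift tau s)) ->
  dirichlet_series L alpha beta h (fun j => a j * cis (expo L j * tau))%C.
Proof.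
intros HAP Ha Hh sigma H1 H2.
assert (HF := AP_line alpha beta f sigma HAP H1 H2).
destruct HF as [CF [[B [_ HB]] _]].
destruct (dirichlet_line L alpha beta f a sigma HAP Ha H1 H2) as [Hj Hmu].
assert (HAh := AP_translate alpha beta f h tau HAP Hh).
assert (CH := AP_line_cont alpha beta h sigma HAh H1 H2).
assert (Hline : forall t, f (sigma, t + tau)%R = h (sigma, t)).
{ intros t; rewrite Hh by now split. now rewrite vshift_eq. }
split.
- intros j Hi; apply is_fourier_coef_iff; auto.
  apply (fcoef_ext (fun t => f (sigma, t + tau)%R)); auto.
  replace (a j * cis (expo L j * tau) * RtoC (exp (expo L j * sigma)))%C with
    (line_coef L a sigma j * cis (expo L j * tau))%C by (unfold line_coef; ring).
  apply (fcoef_shift (fun t => f (sigma, t)) B); auto.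
- intros mu Hi; apply is_fourier_coef_iff; auto.
  apply (fcoef_ext (fun t => f (sigma, t + tau)%R)); auto.
  replace (RtoC 0) with (RtoC 0 * cis (mu * tau))%C by ring.
  apply (fcoef_shift (fun t => f (sigma, t)) B); auto.
Qed.

Theorem theorem4 (L : exponents) (alpha beta : Rbar)
    (G : (C -> C) -> Prop) (f : C -> C) :
  Rbar_lt alpha beta ->
  star_class L alpha beta G ->
  G f ->
  strip_dense alpha beta (translates alpha beta f) G.
Proof.
intros Hab [f0 [[HAP0 _] HG]] Hf.
destruct (proj1 (HG f) Hf) as [[HAPf _] [a0 [a [Ha0 [Ha Heq]]]]].
split.
- intros h [tau Hh]; apply HG.
  assert (HAPh := AP_translate alpha beta f h tau HAPf Hh).
  assert (Hdir := dirichlet_translate L alpha beta f h a tau HAPf Ha Hh).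
  split; [split; [auto|eexists; eassumption]|].
  exists a0, (fun j => a j * cis (expo L j * tau))%C.
  split; [auto|split; [auto|]]; now apply coef_equiv_translate.
- intros g Hg A [s1 [s2 [eps [Hred [Heps HA]]]]].
  destruct (proj1 (HG g) Hg) as [[HAPg _] [b0 [b [Hb0 [Hb Heq']]]]].
  assert (Hequiv : coef_equiv L a b).
  { apply (coef_equiv_comp L a0 b0); auto.
    now apply (dirichlet_unique L alpha beta f0). }
  destruct (translate_approximation L alpha beta f g a b s1 s2 (eps / 2)) as [tau Htau];
    auto; [lra|].
  exists (fun s => f (vshift tau s)); split.
  + apply HA; intros s Hs; generalize (Htau s Hs); lra.
  + now exists tau.
Qed.
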